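(* For every fixed $r$, checking whether a given nonnegative matrix of rank $r$ satisfies the RCGC, i.e., $\{x^TM: x\in\mathbb{R}_+^p\}=\{x^TM: x\in\mathbb{R}^p\}\cap\mathbb{R}_+^q$ (equivalently, the CCGC: $\{Mz: z\in\mathbb{R}_+^q\}=\{Mz: z\in\mathbb{R}^q\}\cap\mathbb{R}_+^p$), can be done in polynomial time. In particular, checking whether matrices of fixed rank are slack matrices of polyhedral cones or of polytopes can be done in polynomial time.
   Context: Matrices are given as input with rational entries in binary encoding. A matrix $S\in\mathbb{R}^{p\times q}$ is a slack matrix of a polyhedral cone $K\subseteq\mathbb{R}^n$ if there are $A\in\mathbb{R}^{p\times n}$, $B\in\mathbb{R}^{n\times q}$ with $K=\{x\in\mathbb{R}^n: x^TB\ge 0\}=\{y^TA: y\in\mathbb{R}_+^p\}$ and $S=AB$. For a polytope $P\subseteq\mathbb{R}^n$ with $\dim(P)\ge 1$, a slack matrix of $P$ is any matrix $[\mathbb{1},V]\cdot[w,-W]^T$, where $P=\operatorname{conv}(\text{rows of }V)$ and $P=\{x: Wx\le w\}$. *)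

(* Defs.v *)
From HB Require Import structures.
From Stdlib Require Import Reals BinNat BinPos.
From mathcomp Require Import all_boot all_order all_algebra.
From mathcomp Require Import Rstruct.
Set Implicit Arguments. Unset Strict Implicit. Unset Printing Implicit Defensive.
Import Order.TTheory GRing.Theory Num.Theory.
Local Open Scope ring_scope.

Definition nonneg_rv (m : nat) (x : 'rV[R]_m) : Prop := forall i, 0 <= x 0 i.
Definition nonneg_cv (m : nat) (x : 'cV[R]_m) : Prop := forall i, 0 <= x i 0.

Definition RCGC (p q : nat) (S : 'M[R]_(p, q)) : Prop :=
  forall z : 'rV[R]_q,
    (exists x : 'rV[R]_p, nonneg_rv x /\ z = x *m S) <->
    ((exists x : 'rV[R]_p, z = x *m S) /\ nonneg_rv z).

Definition CCGC (p q : nat) (S : 'M[R]_(p, q)) : Prop :=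
  forall y : 'cV[R]_p,
    (exists z : 'cV[R]_q, nonneg_cv z /\ y = S *m z) <->
    ((exists z : 'cV[R]_q, y = S *m z) /\ nonneg_cv y).

(* S is a slack matrix of some polyhedral cone K in R^n:
   K = {x : x^T B >= 0} = {y^T A : y in R_+^p}, S = A B. *)
Definition is_cone_slack (p q : nat) (S : 'M[R]_(p, q)) : Prop :=
  exists (n : nat) (A : 'M[R]_(p, n)) (B : 'M[R]_(n, q)),
    (forall x : 'rV[R]_n,
        nonneg_rv (x *m B) <-> exists y : 'rV[R]_p, nonneg_rv y /\ x = y *m A)
    /\ S = A *m B.

Definition in_conv_rows (p n : nat) (V : 'M[R]_(p, n)) (x : 'rV[R]_n) : Prop :=
  exists l : 'rV[R]_p, nonneg_rv l /\ \sum_i l 0 i = 1 /\ x = l *m V.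

(* S is a slack matrix of some polytope P in R^n with dim P >= 1:
   P = conv(rows V) = {x : W x <= w}, S = [1, V] [w, -W]^T. *)
Definition is_polytope_slack (p q : nat) (S : 'M[R]_(p, q)) : Prop :=
  exists (n : nat) (V : 'M[R]_(p, n)) (W : 'M[R]_(q, n)) (w : 'cV[R]_q),
    (forall x : 'rV[R]_n,
        in_conv_rows V x <-> (forall j, (W *m x^T) j 0 <= w j 0))
    /\ (exists x1 x2 : 'rV[R]_n, in_conv_rows V x1 /\ in_conv_rows V x2 /\ x1 <> x2)
    /\ S = row_mx (const_mx 1) V *m (row_mx w (- W))^T.

(* Symbols: 0 = blank, 1 = bit '0', 2 = bit '1', 3 = '-', 4 = '#'     *)

Fixpoint pos_bits (x : positive) : seq nat :=
  match x with
  | xH => [:: 2%N]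
  | xO x' => rcons (pos_bits x') 1%N
  | xI x' => rcons (pos_bits x') 2%N
  end.

Definition nat_bits (n : nat) : seq nat :=
  match N.of_nat n with N0 => [:: 1%N] | Npos x => pos_bits x end.

Definition int_bits (z : int) : seq nat :=
  match z with
  | Posz n => nat_bits n
  | Negz n => 3%N :: nat_bits n.+1
  end.

Definition rat_bits (a : rat) : seq nat :=
  int_bits (numq a) ++ 4%N :: int_bits (denq a).

Definition encode_mx (p q : nat) (M : 'M[rat]_(p, q)) : seq nat :=
  nat_bits p ++ 4%N :: nat_bits q ++ 4%N ::
  flatten [seq rat_bits (M i j) ++ [:: 4%N] | i <- enum 'I_p, j <- enum 'I_q].

(* It halts when no entry applies; it accepts iff it halts in state 1. *)
(* Start state 0, head on the first input symbol; blank = 0.           *)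

Inductive move := MLeft | MRight | MStay.

Record entry := Entry { e_state : nat; e_read : nat;
                        e_next : nat; e_write : nat; e_move : move }.

Definition TM := seq entry.

(* state, left tape (nearest cell first), head symbol, right tape *)
Record config := Config { c_state : nat; c_left : seq nat;
                          c_head : nat; c_right : seq nat }.

Definition do_move (d : move) (q : nat) (l : seq nat) (a : nat) (r : seq nat)
  : config :=
  match d with
  | MStay => Config q l a r
  | MLeft => match l with
             | [::] => Config q [::] 0%N (a :: r)
             | b :: l' => Config q l' b (a :: r)
             end
  | MRight => match r with
              | [::] => Config q (a :: l) 0%N [::]
              | b :: r' => Config q (a :: l) b r'
              end
  end.

Definition step (M : TM) (c : config) : option config :=
  match [seq e <- M | (e_state e == c_state c) && (e_read e == c_head c)] with
  | [::] => None
  | e :: _ => Some (do_move (e_move e) (e_next e) (c_left c) (e_write e) (c_right c))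
  end.

Fixpoint run (M : TM) (n : nat) (c : config) : option config :=
  match step M c with
  | None => Some c
  | Some c' => match n with 0%N => None | n'.+1 => run M n' c' end
  end.

Definition init_config (w : seq nat) : config :=
  match w with
  | [::] => Config 0 [::] 0 [::]
  | a :: w' => Config 0 [::] a w'
  end.

Definition poly_time_decidable
  (Dom Pr : forall p q : nat, 'M[rat]_(p, q) -> Prop) : Prop :=
  exists (M : TM) (k : nat),
    forall (p q : nat) (A : 'M[rat]_(p, q)), Dom p q A ->
      exists c : config,
        run M (k * (size (encode_mx A)).+1 ^ k)%N (init_config (encode_mx A)) = Some c
        /\ (c_state c = 1%N <-> Pr p q A).

Definition real_mx (p q : nat) (A : 'M[rat]_(p, q)) : 'M[R]_(p, q) :=
  map_mx (fun a : rat => ratr a) A.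

Definition nonneg_rank (r : nat) (p q : nat) (A : 'M[rat]_(p, q)) : Prop :=
  (forall i j, 0 <= A i j) /\ \rank (real_mx A) = r.

Definition has_rank (r : nat) (p q : nat) (A : 'M[rat]_(p, q)) : Prop :=
  \rank (real_mx A) = r.

(* Main.v *)
Require Import Defs.
From Stdlib Require Import Reals BinNat BinPos FunctionalExtensionality.
From mathcomp Require Import all_boot all_order all_algebra.
From mathcomp Require Import Rstruct.
From mathcomp Require Import perm zify ring lra.
Set Implicit Arguments. Unset Strict Implicit. Unset Printing Implicit Defensive.
Import Order.TTheory GRing.Theory Num.Theory.

(** Let M be nonnegative of rank r + 1. The cone rowspace(M) ∩ R_+^q is pointed,
    so M has the RCGC iff every extreme ray of that cone is spanned by a row of M.
    An extreme ray is cut out of the row space by r columns T, and for row indices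
    I with M[I, _] of full rank it is spanned by the vector z with
    z_j = det M[I, (T, j)]; any row of M that is nonzero and vanishes on T spans it.
    So the RCGC says: for all I and T, if z is nonzero and of constant weak sign,
    then some nonzero row of M vanishes on T. For fixed r this is a first-order
    condition on the indices whose atoms are signs of fixed polynomials in the
    entries. The CCGC is the transposed condition; S is a slack matrix of a cone
    iff it is nonnegative with the RCGC, and of a polytope iff moreover
    rank S >= 2 and the all-ones vector is in the column space, a condition on the
    minors of [S, 1]. Such a condition is checked by nested loops over unary
    indices and binary integer arithmetic, in a language of stack programs that a
    one-tape Turing machine executes with polynomial overhead. *)

(** Polynomial time is stated here for a bare table of machine entries with an explicit step bound,
    so every program below carries a proved running time. Two choices keep these proofs short.
    Fractions are never reduced: a formula is fixed, hence only a fixed number of multiplications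
    occurs and lengths grow by a constant factor; a sum is kept as (P - N) / D with natural P, N, D,
    so that its sign is a comparison. Index variables are unary, so that a quantifier is a counting
    loop. This asks for p and q to be at most the input length, which holds when p q > 0, because
    every entry is written out, but can fail for an empty matrix, whose other dimension is written
    in binary. Empty matrices have rank 0, and for rank 0 each answer is constant.

    A nonzero z certifies by itself that the rows I span the row space and that the columns T cut
    out a line, so neither independence nor extremality has to be expressed in the formula. *)

(** * Symbols, stores and stack instructions *)

Definition sym := (bool * bool)%type.
Notation Bz := ((false, false) : sym).
Notation Bo := ((false, true) : sym).
Notation Mi := ((true, false) : sym).
Notation Ha := ((true, true) : sym).

(** The codes are those of the input alphabet, and the second component of a symbol is its value as
    a bit. *)
Definition code (s : sym) : nat := 1 + 2 * s.1 + s.2.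
Definition ocode (o : option sym) : nat := if o is Some s then code s else 0.

Lemma ocode_inj : injective ocode.
Proof. by case=> [[[] []]|] [[[] []]|]. Qed.

Definition upd {T : Type} (f : nat -> T) (j : nat) (x : T) : nat -> T :=
  fun i => if i == j then x else f i.

Lemma upd_same T (f : nat -> T) j x : upd f j x j = x.
Proof. by rewrite /upd eqxx. Qed.

Lemma upd_diff T (f : nat -> T) j x i : i != j -> upd f j x i = f i.
Proof. by rewrite /upd => /negbTE ->. Qed.

Lemma upd_id T (f : nat -> T) j x : x = f j -> upd f j x = f.
Proof.
by move=> ->; apply: functional_extensionality => i; rewrite /upd; case: eqP => [->|].
Qed.

Definition store := nat -> seq sym.

(** Every nonhalting instruction names the address to continue at. A run that leaves the program
    meets [IReject], the default value of [nth]. *)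
Inductive instr :=
| IPush of nat & sym & nat
| IPop of nat & nat
| ITest of nat & option sym & nat & nat
| IAccept
| IReject.

Definition ireg (i : instr) :=
  match i with IPush j _ _ | IPop j _ | ITest j _ _ _ => j | _ => 0 end.
Definition ihalts (i : instr) := if i is (IAccept | IReject) then true else false.
Definition itarget (i : instr) :=
  match i with
  | IPush _ _ n | IPop _ n => n
  | ITest _ _ n1 n2 => maxn n1 n2
  | _ => 0
  end.

Definition istep (i : instr) (st : store) : option (nat * store) :=
  match i with
  | IPush j a n => Some (n, upd st j (a :: st j))
  | IPop j n => Some (n, upd st j (behead (st j)))
  | ITest j o n1 n2 => Some (if ohead (st j) == o then n1 else n2, st)
  | _ => None
  end.

Fixpoint isteps (P : seq instr) (n pc : nat) (st : store) (pc' : nat) (st' : store) : Prop :=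
  if n is m.+1 then
    exists pc1 st1, istep (nth IReject P pc) st = Some (pc1, st1)
                    /\ isteps P m pc1 st1 pc' st'
  else pc = pc' /\ st = st'.

Lemma isteps_trans P n1 n2 pc1 st1 pc2 st2 pc3 st3 :
  isteps P n1 pc1 st1 pc2 st2 -> isteps P n2 pc2 st2 pc3 st3 ->
  isteps P (n1 + n2) pc1 st1 pc3 st3.
Proof.
elim: n1 pc1 st1 => [|n1 IH] pc1 st1 /= => [[-> ->]//|[pc [st [E H1]]] H2].
by exists pc, st; split=> //; apply: IH H1 H2.
Qed.

(** * Stack programs on a one-tape Turing machine *)

(* Register [j] is track [j] of the tape: a cell holds the base-5 digits of all
   tracks, the bottom of each stack being next to the marker [5 ^ k] that sits
   on the left end of the tape. A raw input symbol is a cell whose tracks other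
   than 0 are blank. *)
Definition cell (k : nat) (t : nat -> nat) : nat := \sum_(j < k) t j * 5 ^ j.
Definition track (j c : nat) : nat := (c %/ 5 ^ j) %% 5.

Lemma cellS k t : cell k.+1 t = cell k t + t k * 5 ^ k.
Proof. by rewrite /cell big_ord_recr. Qed.

Lemma cell_lt k t : (forall j, t j < 5) -> cell k t < 5 ^ k.
Proof.
move=> Ht; elim: k => [|k IH]; first by rewrite /cell big_ord0.
by rewrite cellS expnS; move: (Ht k) IH; set x := 5 ^ k; nia.
Qed.


Lemma track_cell k t j : (forall j, t j < 5) -> j < k -> track j (cell k t) = t j.
Proof.
move=> Ht; elim: k => // k IH; rewrite ltnS leq_eqVlt => /orP[/eqP ->|ltjk].
  rewrite cellS /track divnDMl ?expn_gt0 // divn_small ?cell_lt // add0n.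
  by rewrite modn_small.
rewrite -[RHS](IH ltjk) cellS /track.
(* A higher digit contributes a multiple of 5 after division by [5 ^ j]. *)
have -> : t k * 5 ^ k = (t k * 5 ^ (k - j.+1) * 5) * 5 ^ j.
  by rewrite -!mulnA -expnS -expnD; congr (_ * 5 ^ _); lia.
by rewrite divnDMl ?expn_gt0 // addnC modnMDl.
Qed.

(** The additive form avoids truncated subtraction. *)
Lemma cell_upd k t j x : j < k -> cell k (upd t j x) + t j * 5 ^ j = cell k t + x * 5 ^ j.
Proof.
move=> ltjk; rewrite /cell (bigD1 (Ordinal ltjk)) //= upd_same.
rewrite [in RHS](bigD1 (Ordinal ltjk)) //=.
rewrite (eq_bigr (fun i : 'I_k => t i * 5 ^ i)); first by lia.
by move=> i ni; rewrite upd_diff.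
Qed.

Lemma cell_track0 k t : (forall j, 0 < j -> t j = 0) -> cell k.+1 t = t 0.
Proof.
move=> Ht; rewrite /cell big_ord_recl big1 ?addn0 ?muln1 // => j _.
by rewrite Ht.
Qed.

(** The instruction at [pc] is executed in phases: go right to the first free cell of its track,
    look at the cell to the left of it, return to the marker. [back] already carries the next
    address. States 0 and 2 prepare the tape, 1 accepts. *)
Definition walk pc := 3 + 3 * pc.
Definition exam pc := 4 + 3 * pc.
Definition back pc := 5 + 3 * pc.

(** Meeting the marker in phase [exam] means that the stack is empty: a pop changes nothing and a
    test sees 0, the code of [None]. Adding or removing a multiple of [5 ^ j] rewrites one track
    only. *)
Definition delta (k : nat) (P : seq instr) (s c : nat) : option (nat * nat * move) :=
  let free j := (c != 5 ^ k) && (track j c == 0) in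
  match s with
  | 0 => Some (2, c, MLeft)
  | 1 => None
  | 2 => Some (walk 0, 5 ^ k, MStay)
  | s'.+3 =>
    let pc := s' %/ 3 in
    match s' %% 3 with
    | 0 =>
      match nth IReject P pc with
      | IPush j a n => if free j then Some (back n, c + code a * 5 ^ j, MLeft)
                       else Some (walk pc, c, MRight)
      | IPop j _ | ITest j _ _ _ =>
          if free j then Some (exam pc, c, MLeft) else Some (walk pc, c, MRight)
      | IAccept => Some (1, c, MStay)
      | IReject => None
      end
    | 1 =>
      match nth IReject P pc with
      | IPop j n => Some (back n, if c == 5 ^ k then c else c - track j c * 5 ^ j, MStay)
      | ITest j o n1 n2 =>
          Some (back (if (if c == 5 ^ k then 0 else track j c) == ocode o then n1 else n2),
                c, MStay)
      | _ => None
      end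
    | _ => if c == 5 ^ k then Some (walk pc, c, MStay) else Some (back pc, c, MLeft)
    end
  end.

Arguments delta : simpl never.

(** Pairs without a transition are filtered out beforehand; the dummy entry only makes the match
    total. *)
Definition tm_of (f : nat -> nat -> option (nat * nat * move)) (ns nc : nat) : TM :=
  [seq match f x.1 x.2 with
       | Some (s, c, d) => Entry x.1 x.2 s c d
       | None => Entry x.1 x.2 0 0 MStay
       end
  | x <- [seq x <- [seq (s, c) | s <- iota 0 ns, c <- iota 0 nc] | f x.1 x.2]].

Lemma step_tm_of f ns nc s l c r : s < ns -> c < nc ->
  step (tm_of f ns nc) (Config s l c r) =
  omap (fun y => do_move y.2 y.1.1 l y.1.2 r) (f s c).
Proof.
move=> lts ltc; rewrite /step /tm_of filter_map -filter_predI.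
set e := (X in map X _); set L := (X in filter _ X).
rewrite (@eq_filter _ _ [pred x | f x.1 x.2 && (x == (s, c))]); last first.
  move=> [s1 c1] /=; rewrite /e /= xpair_eqE.
  by case: (f s1 c1) => [[[s' c'] d]|] /=; rewrite ?andbT ?andbF ?andTb.
have Lin : (s, c) \in L by apply/allpairsP; exists (s, c); rewrite !mem_iota.
case E: (f s c) => [[[s' c'] d]|] /=.
  case EL: [seq _ <- L | _] => [|x l'].
    by have : (s, c) \in [::] by rewrite -EL mem_filter /= E eqxx.
  have : x \in [seq y <- L | f y.1 y.2 & y == (s, c)] by rewrite EL mem_head.
  by rewrite mem_filter /= => /andP[/andP[_ /eqP ->] _] /=; rewrite /e /= E.
case EL: [seq _ <- L | _] => [|x l'] //=.
have : x \in [seq y <- L | f y.1 y.2 & y == (s, c)] by rewrite EL mem_head.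
by rewrite mem_filter /= => /andP[/andP[fx /eqP xE] _]; rewrite xE E in fx.
Qed.

Fixpoint tsteps (M : TM) (n : nat) (c c' : config) : Prop :=
  if n is m.+1 then exists2 c1, step M c = Some c1 & tsteps M m c1 c' else c = c'.

Lemma tsteps_trans M n1 n2 c1 c2 c3 :
  tsteps M n1 c1 c2 -> tsteps M n2 c2 c3 -> tsteps M (n1 + n2) c1 c3.
Proof.
elim: n1 c1 => [|n1 IH] c1 /= => [->//|[c E H1] H2].
by exists c => //; apply: IH H1 H2.
Qed.

Lemma tsteps_run M n c c' N :
  tsteps M n c c' -> step M c' = None -> n <= N -> run M N c = Some c'.
Proof.
move=> H1 H2; elim: n c N H1 => [|n IH] c N /=.
  by move=> -> _; case: N => /=; rewrite H2.
by move=> [c1 E H] ltnN; case: N ltnN => //= N leN; rewrite E; apply: IH.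
Qed.

(** The right part is compared through [nth 0], so trailing blanks may be present or absent. The
    left part is exact, since the head never leaves cell 0 to the left. *)
Definition conf (s : nat) (T : nat -> nat) (h : nat) (cf : config) : Prop :=
  [/\ c_state cf = s, c_left cf = rev (mkseq T h), c_head cf = T h
    & forall i, nth 0 (c_right cf) i = T (h + i).+1].

Lemma mkseq_upd T h x n : n <= h -> mkseq (upd T h x) n = mkseq T n :> seq nat.
Proof.
move=> lenh; apply/eq_in_map => i; rewrite mem_iota => /andP[_ ltin].
by rewrite upd_diff // ltn_eqF // (leq_trans ltin).
Qed.

Lemma mkseqSr (T : nat -> nat) h : mkseq T h.+1 = rcons (mkseq T h) (T h).
Proof. by rewrite /mkseq -addn1 iotaD map_cat /= cats1. Qed.

Lemma conf_step f ns nc s T h cf s' x d : conf s T h cf -> s < ns -> T h < nc ->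
  f s (T h) = Some (s', x, d) -> (d = MLeft -> 0 < h) ->
  exists2 cf', step (tm_of f ns nc) cf = Some cf'
             & conf s' (upd T h x) (match d with MLeft => h.-1 | MRight => h.+1 | MStay => h end) cf'.
Proof.
case: cf => s0 l c r [/= -> -> -> Hr] lts ltc E Hd.
eexists; first by rewrite step_tm_of // E /=.
case: d {E} Hd => /= Hd.
- case: h Hr Hd {ltc} => [|h] Hr Hd; first by have := Hd erefl.
  rewrite mkseqSr rev_rcons /=; split=> //=.
  + by rewrite mkseq_upd.
  + by rewrite upd_diff // ltn_eqF.
  + case=> [|i] /=; first by rewrite addn0 upd_same.
    by rewrite Hr upd_diff ?addnS ?addSn //; lia.
- have E0 : T h.+1 = nth 0 r 0 by rewrite Hr addn0.
  case: r Hr E0 => [|b r] Hr E0; split=> //=.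
  + by rewrite mkseqSr rev_rcons upd_same mkseq_upd.
  + by rewrite upd_diff ?E0 //; lia.
  + by move=> i; move: (Hr i.+1); rewrite !nth_nil upd_diff ?addnS ?addSn //; lia.
  + by rewrite mkseqSr rev_rcons upd_same mkseq_upd.
  + by rewrite upd_diff ?E0 //; lia.
  + by move=> i; move: (Hr i.+1) => /= ->; rewrite upd_diff ?addnS ?addSn //; lia.
- split=> //=; rewrite ?upd_same ?mkseq_upd //.
  by move=> i; rewrite Hr upd_diff //; lia.
Qed.

Definition tape (k : nat) (st : store) (i : nat) : nat :=
  if i is i'.+1 then cell k (fun j => nth 0 (map code (rev (st j))) i') else 5 ^ k.

Lemma digit_lt (st : store) j i : nth 0 (map code (rev (st j))) i < 5.
Proof.
have [lti|gei] := ltnP i (size (rev (st j))); last by rewrite nth_default ?size_map.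
by rewrite (nth_map Bz) //; case: (nth _ _ _) => [[] []].
Qed.

Lemma tape_lt k st i : tape k st i < (5 ^ k).+1.
Proof. by case: i => // i /=; rewrite ltnS ltnW // cell_lt // => j; apply: digit_lt. Qed.

Lemma tapeS_neq k st i : (tape k st i.+1 == 5 ^ k) = false.
Proof. by apply/negbTE; rewrite neq_ltn /= cell_lt // => j; apply: digit_lt. Qed.

Lemma track_tape k st i j : j < k ->
  track j (tape k st i.+1) = nth 0 (map code (rev (st j))) i.
Proof. by move=> ltjk; rewrite /= track_cell // => j'; apply: digit_lt. Qed.

Lemma track_tape_eq0 k st i j : j < k ->
  (track j (tape k st i.+1) == 0) = (size (st j) <= i).
Proof.
move=> ltjk; rewrite track_tape //; have [gei|lti] := leqP (size (st j)) i.
  by rewrite nth_default ?size_map ?size_rev.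
by rewrite (nth_map Bz) ?size_rev.
Qed.

(** Cell 0 is the marker, so the first free cell has index one more than the height. Its digit [j]
    is 0, so adding a code causes no carry. *)
Lemma tape_push k st j a : j < k ->
  tape k (upd st j (a :: st j)) =
  upd (tape k st) (size (st j)).+1 (tape k st (size (st j)).+1 + code a * 5 ^ j).
Proof.
move=> ltjk; apply: functional_extensionality => -[|i] //.
rewrite {2}/upd eqSS /=.
set t := fun _ : nat => _; set t1 := fun j => nth 0 (map code (rev (st j))) i.
have -> : t = upd t1 j (nth 0 (map code (rev (a :: st j))) i).
  by apply: functional_extensionality => x; rewrite /t /t1 /upd; case: eqP.
have := @cell_upd k t1 j (nth 0 (map code (rev (a :: st j))) i) ltjk.
rewrite /t1 rev_cons map_rcons nth_rcons size_map size_rev.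
case: ltngtP => [lti|gti|->].
- by lia.
- by rewrite nth_default ?size_map ?size_rev ?(ltnW gti) //; lia.
- by rewrite nth_default ?size_map ?size_rev //; lia.
Qed.

Lemma tape_pop k st j a l : j < k -> st j = a :: l ->
  tape k (upd st j l) =
  upd (tape k st) (size (st j)) (tape k st (size (st j)) - track j (tape k st (size (st j))) * 5 ^ j).
Proof.
move=> ltjk E; apply: functional_extensionality => -[|i]; first by rewrite /upd E.
rewrite {2}/upd E eqSS; case: eqP => [->|ni]; last first.
  rewrite /=; congr cell; apply: functional_extensionality => x; rewrite /upd; case: eqP => // ->.
  rewrite E rev_cons map_rcons nth_rcons size_map size_rev.
  case: ltngtP ni => // gti _; last by rewrite nth_default ?size_map ?size_rev // ltnW.
rewrite [size (a :: l)]/= track_tape //=.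
set t := fun _ : nat => _; set t1 := fun j => nth 0 (map code (rev (st j))) (size l).
have -> : t = upd t1 j 0.
  apply: functional_extensionality => x; rewrite /t /t1 /upd; case: eqP => // _.
  by rewrite nth_default // size_map size_rev.
by have := @cell_upd k t1 j 0 ltjk; rewrite /t1; lia.
Qed.

Section Simulation.
Variable P : seq instr.

Definition width := (\max_(i < size P) ireg (nth IReject P i)).+1.
Definition extent := (\max_(i < size P) itarget (nth IReject P i)).+1.
Definition machine : TM := tm_of (delta width P) (6 + 3 * extent) (5 ^ width).+1.

Lemma ireg_lt pc : ireg (nth IReject P pc) < width.
Proof.
have [ltpc|gepc] := ltnP pc (size P); last by rewrite nth_default.
by rewrite ltnS (leq_bigmax (Ordinal ltpc)).
Qed.

Lemma itarget_lt pc : itarget (nth IReject P pc) < extent.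
Proof.
have [ltpc|gepc] := ltnP pc (size P); last by rewrite nth_default.
by rewrite ltnS (leq_bigmax (Ordinal ltpc)).
Qed.

Lemma delta_walk pc c : delta width P (walk pc) c =
  match nth IReject P pc with
  | IPush j a n => if (c != 5 ^ width) && (track j c == 0)
                   then Some (back n, c + code a * 5 ^ j, MLeft)
                   else Some (walk pc, c, MRight)
  | IPop j _ | ITest j _ _ _ =>
      if (c != 5 ^ width) && (track j c == 0) then Some (exam pc, c, MLeft)
      else Some (walk pc, c, MRight)
  | IAccept => Some (1, c, MStay)
  | IReject => None
  end.
Proof.
rewrite {1}(_ : walk pc = (pc * 3 + 0).+3) ?/delta; last by rewrite /walk; lia.
by rewrite modnMDl divnMDl //= addn0.
Qed.

Lemma delta_exam pc c : delta width P (exam pc) c =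
  match nth IReject P pc with
  | IPop j n => Some (back n, if c == 5 ^ width then c else c - track j c * 5 ^ j, MStay)
  | ITest j o n1 n2 =>
      Some (back (if (if c == 5 ^ width then 0 else track j c) == ocode o then n1 else n2),
            c, MStay)
  | _ => None
  end.
Proof.
rewrite {1}(_ : exam pc = (pc * 3 + 1).+3) ?/delta; last by rewrite /exam; lia.
by rewrite modnMDl divnMDl //= addn0.
Qed.

Lemma delta_back pc c : delta width P (back pc) c =
  if c == 5 ^ width then Some (walk pc, c, MStay) else Some (back pc, c, MLeft).
Proof.
rewrite {1}(_ : back pc = (pc * 3 + 2).+3) ?/delta; last by rewrite /back; lia.
by rewrite modnMDl divnMDl //= addn0.
Qed.

Lemma machine_step s st h cf s' x d : conf s (tape width st) h cf -> s < 6 + 3 * extent ->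
  delta width P s (tape width st h) = Some (s', x, d) -> (d = MLeft -> 0 < h) ->
  exists2 cf', step machine cf = Some cf'
    & conf s' (upd (tape width st) h x)
           (match d with MLeft => h.-1 | MRight => h.+1 | MStay => h end) cf'.
Proof. by move=> cc lts E hd; apply: conf_step cc lts _ E hd; apply: tape_lt. Qed.

Lemma machine_back n st h cf : n < extent -> conf (back n) (tape width st) h cf ->
  exists2 cf', tsteps machine h.+1 cf cf' & conf (walk n) (tape width st) 0 cf'.
Proof.
move=> ltn; have lts : back n < 6 + 3 * extent by rewrite /back; lia.
elim: h cf => [|h IH] cf cc.
  have [|//|cf' E cc'] := machine_step (s' := walk n) (x := 5 ^ width) (d := MStay) cc lts.
    by rewrite delta_back eqxx.
  by exists cf'; [exists cf'|rewrite upd_id in cc'].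
have [|//|cf' E cc'] :=
    machine_step (s' := back n) (x := tape width st h.+1) (d := MLeft) cc lts.
  by rewrite delta_back tapeS_neq.
rewrite upd_id // in cc'; have [cf2 E2 cc2] := IH _ cc'.
by exists cf2 => //; exists cf'.
Qed.

Lemma machine_walk pc st h cf : pc < extent ->
  ihalts (nth IReject P pc) = false ->
  conf (walk pc) (tape width st) h cf -> h <= (size (st (ireg (nth IReject P pc)))).+1 ->
  exists n cf', [/\ n <= (size (st (ireg (nth IReject P pc)))).+1 - h, tsteps machine n cf cf'
    & conf (walk pc) (tape width st) (size (st (ireg (nth IReject P pc)))).+1 cf'].
Proof.
move=> ltpc Hi; have lts : walk pc < 6 + 3 * extent by rewrite /walk; lia.
set j := ireg _; set m := (size _).+1.
move En: (m - h) => n; elim: n h En cf => [|n IH] h En cf cc leh.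
  by exists 0, cf; split=> //; have -> : m = h by lia.
have [|//|cf' E cc'] :=
    machine_step (s' := walk pc) (x := tape width st h) (d := MRight) cc lts.
  have : (tape width st h != 5 ^ width) && (track j (tape width st h) == 0) = false.
    case: h {IH cc leh} En => [|h] En; first by rewrite eqxx.
    by rewrite tapeS_neq track_tape_eq0 ?ireg_lt //=; rewrite /m in En; lia.
  by rewrite delta_walk /j; case: (nth _ _ _) Hi => //= [j' a n'|j' n'|j' o n1 n2] _ ->.
rewrite upd_id // in cc'; have [||n' [cf2 [len H1 H2]]] := IH h.+1 _ _ cc'; try lia.
by exists n'.+1, cf2; split=> //; exists cf'.
Qed.

(** The cost is a walk to the top of one stack and back, linear in its height. *)
Lemma machine_istep pc st pc' st' cf : pc < extent ->
  istep (nth IReject P pc) st = Some (pc', st') -> conf (walk pc) (tape width st) 0 cf ->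
  exists n cf', [/\ n <= 2 * size (st (ireg (nth IReject P pc))) + 6, tsteps machine n cf cf',
    conf (walk pc') (tape width st') 0 cf' & pc' < extent].
Proof.
move=> ltpc Ei cc.
have Hi : ihalts (nth IReject P pc) = false by case: (nth _ _ _) Ei.
have [n [cf1 [len St1 cc1]]] := machine_walk ltpc Hi cc (leq0n _).
rewrite subn0 in len.
have ltr := ireg_lt pc; have ltt := itarget_lt pc.
have lts : walk pc < 6 + 3 * extent by rewrite /walk; lia.
have lts2 : exam pc < 6 + 3 * extent by rewrite /exam; lia.
have Hdw := delta_walk pc; have Hde := delta_exam pc.
case: (nth IReject P pc) Ei ltr ltt len cc1 Hdw Hde {Hi} => //=.
- move=> j a m [<- <-] ltj ltm len cc1 Hdw _.
  have [|//|cf2 E cc2] := machine_step (s' := back m)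
     (x := tape width st (size (st j)).+1 + code a * 5 ^ j) (d := MLeft) cc1 lts.
    by rewrite Hdw tapeS_neq track_tape_eq0 // leqnn.
  rewrite -tape_push // in cc2; have [cf3 St3 cc3] := machine_back ltm cc2.
  exists (n + (1 + (size (st j)).+1)), cf3; split=> //; first by lia.
  by apply: tsteps_trans St1 _; exists cf2.
- move=> j m [<- <-] ltj ltm len cc1 Hdw Hde.
  have [|//|cf2 E cc2] := machine_step (s' := exam pc)
     (x := tape width st (size (st j)).+1) (d := MLeft) cc1 lts.
    by rewrite Hdw tapeS_neq track_tape_eq0 // leqnn.
  rewrite upd_id // in cc2.
  have [//|cf3 E3 cc3] := machine_step cc2 lts2 (Hde _).
  have {}cc3 : conf (back m) (tape width (upd st j (behead (st j)))) (size (st j)) cf3.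
    case Es: (st j) => [|b l] /=; rewrite Es /= in cc3.
      by rewrite eqxx upd_id // in cc3; rewrite upd_id.
    by rewrite (tape_pop ltj Es) Es; rewrite tapeS_neq in cc3.
  have [cf4 St4 cc4] := machine_back ltm cc3.
  exists (n + (1 + (1 + (size (st j)).+1))), cf4; split=> //; first by lia.
  by apply: tsteps_trans St1 _; exists cf2 => //; exists cf3.
- move=> j o n1 n2 [<- <-] ltj ltm len cc1 Hdw Hde.
  have [|//|cf2 E cc2] := machine_step (s' := exam pc)
     (x := tape width st (size (st j)).+1) (d := MLeft) cc1 lts.
    by rewrite Hdw tapeS_neq track_tape_eq0 // leqnn.
  rewrite upd_id // in cc2.
  have [//|cf3 E3 cc3] := machine_step cc2 lts2 (Hde _).
  rewrite upd_id //= in cc3.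
  have Et : (if tape width st (size (st j)) == 5 ^ width then 0
             else track j (tape width st (size (st j)))) = ocode (ohead (st j)).
    case Es: (st j) => [|b l]; first by rewrite eqxx.
    by rewrite tapeS_neq track_tape // Es rev_cons map_rcons nth_rcons size_map size_rev ltnn eqxx.
  rewrite Et (inj_eq ocode_inj) in cc3.
  have [|cf4 St4 cc4] := machine_back _ cc3; first by case: ifP; lia.
  exists (n + (1 + (1 + (size (st j)).+1))), cf4; split=> //.
  + by lia.
  + by apply: tsteps_trans St1 _; exists cf2 => //; exists cf3.
  + by case: ifP; lia.
Qed.

Lemma size_istep i st pc' st' S : istep i st = Some (pc', st') ->
  (forall j, size (st j) <= S) -> forall j, size (st' j) <= S.+1.
Proof.
move=> Ei HS j; case: i Ei => //= [j' a n|j' n|j' o n1 n2] [_ <-]; rewrite ?/upd.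
- by case: eqP => _ /=; rewrite ?ltnS // leqW.
- by case: eqP => _ /=; rewrite ?size_behead ?leqW // (leq_trans (leq_pred _)).
- by rewrite leqW.
Qed.

(** A step raises a stack by at most one symbol, so heights stay below [S + n] and the overhead of
    the simulation is quadratic. *)
Lemma machine_isteps n pc st pc' st' S cf : pc < extent ->
  isteps P n pc st pc' st' -> (forall j, size (st j) <= S) ->
  conf (walk pc) (tape width st) 0 cf ->
  exists m cf', [/\ m <= n * (2 * (S + n) + 6), tsteps machine m cf cf',
    conf (walk pc') (tape width st') 0 cf' & pc' < extent].
Proof.
elim: n pc st S cf => [|n IH] pc st S cf ltpc /=.
  by case=> <- <- _ cc; exists 0, cf.
case=> pc1 [st1 [E1 H2]] HS cc.
have [m1 [cf1 [lem1 St1 cc1 ltpc1]]] := machine_istep ltpc E1 cc.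
have [m2 [cf2 [lem2 St2 cc2 ltpc2]]] := IH _ _ S.+1 _ ltpc1 H2 (size_istep E1 HS) cc1.
exists (m1 + m2), cf2; split=> //; last by apply: tsteps_trans St1 St2.
by have := HS (ireg (nth IReject P pc)); nia.
Qed.

(* The first two steps put the marker to the left of the input. *)
Lemma machine_start (w : seq sym) : exists cf,
  tsteps machine 2 (init_config (map code w)) cf
  /\ conf (walk 0) (tape width (upd (fun=> [::]) 0 (rev w))) 0 cf.
Proof.
have -> : init_config (map code w) =
    Config 0 [::] (head 0 (map code w)) (behead (map code w)) by case: w.
have ltc : head 0 (map code w) < (5 ^ width).+1.
  rewrite ltnS (@leq_trans (5 ^ 1)) ?leq_exp2l //.
  by case: w => //= -[[] []].
eexists; split.
  by do 2!(eexists; first by rewrite /machine step_tm_of).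
split=> //= i; rewrite add0n /= /width cell_track0 => [|j lt0j].
  by rewrite upd_same revK; case: w {ltc} i => [|a w] [|i] //=; rewrite nth_nil.
by rewrite upd_diff ?nth_nil // -lt0n.
Qed.

Lemma machine_run (w : seq sym) n pc st N : isteps P n 0 (upd (fun=> [::]) 0 (rev w)) pc st ->
  n * (2 * (size w + n) + 6) + 3 <= N ->
  match nth IReject P pc with
  | IAccept => exists2 c, run machine N (init_config (map code w)) = Some c & c_state c = 1
  | IReject => exists2 c, run machine N (init_config (map code w)) = Some c & c_state c != 1
  | _ => True
  end.
Proof.
move=> Hi leN; have [cf0 [St0 cc0]] := machine_start w.
have [|m [cf [lem St cc ltpc]]] := machine_isteps (ltn0Sn _) Hi (S := size w) _ cc0.
  by move=> j; rewrite /upd; case: eqP => //; rewrite size_rev.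
have lts : walk pc < 6 + 3 * extent by rewrite /walk; lia.
have St1 := tsteps_trans St0 St.
case Ep: (nth _ _ _) => //.
  have [||cf' E cc'] := machine_step (s' := 1) (x := tape width st 0) (d := MStay) cc lts => //.
    by rewrite delta_walk Ep.
  exists cf'; last by case: cc'.
  (* Two steps place the marker; the last one leads from [IAccept] to state 1. *)
  apply: (tsteps_run (n := (2 + m) + 1)); last by lia.
    by apply: tsteps_trans St1 _; exists cf'.
  case: cf' cc' {E} => s l c r [/= -> _ -> _].
  by rewrite /machine step_tm_of //; rewrite upd_same; apply: (tape_lt width st 0).
exists cf; last by case: cc => ->.
apply: tsteps_run St1 _ _; last by lia.
case: cf cc {St} => s l c r [/= -> _ -> _].
by rewrite /machine step_tm_of // delta_walk Ep.
Qed.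

End Simulation.

(** * Structured commands and their compilation to instructions *)

Inductive cmd :=
| Skip
| Push of nat & sym
| Pop of nat
| Seq of cmd & cmd
| If of nat & option sym & cmd & cmd
| While of nat & option sym & cmd.

Notation "c1 ;; c2" := (Seq c1 c2) (at level 60, right associativity).

(* [If j o c1 c2] runs [c1] when the top of register [j] is [o], where [None]
   stands for the empty register; [While j o c] runs until the top is [o]. *)
Inductive exec : cmd -> store -> store -> nat -> Prop :=
| exec_skip st : exec Skip st st 0
| exec_push j a st : exec (Push j a) st (upd st j (a :: st j)) 1
| exec_pop j st : exec (Pop j) st (upd st j (behead (st j))) 1
| exec_seq c1 c2 st1 st2 st3 t1 t2 :
    exec c1 st1 st2 t1 -> exec c2 st2 st3 t2 -> exec (c1 ;; c2) st1 st3 (t1 + t2)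
| exec_if j o c1 c2 st st' t :
    exec (if ohead (st j) == o then c1 else c2) st st' t -> exec (If j o c1 c2) st st' (t + 2)
| exec_done j o c st : ohead (st j) = o -> exec (While j o c) st st 1
| exec_loop j o c st1 st2 st3 t1 t2 : ohead (st1 j) <> o ->
    exec c st1 st2 t1 -> exec (While j o c) st2 st3 t2 -> exec (While j o c) st1 st3 (t1 + t2 + 2)
| exec_weak c st st' t t' : exec c st st' t -> t <= t' -> exec c st st' t'.

Fixpoint clen (c : cmd) : nat :=
  match c with
  | Skip => 0
  | Push _ _ | Pop _ => 1
  | c1 ;; c2 => clen c1 + clen c2
  | If _ _ c1 c2 => clen c1 + clen c2 + 2
  | While _ _ c => clen c + 2
  end.

(** A jump is a test with equal outcomes; the register tested is arbitrary. *)
Definition IGoto n := ITest 0 None n n.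

Fixpoint compile (c : cmd) (b : nat) : seq instr :=
  match c with
  | Skip => [::]
  | Push j a => [:: IPush j a b.+1]
  | Pop j => [:: IPop j b.+1]
  | c1 ;; c2 => compile c1 b ++ compile c2 (b + clen c1)
  | If j o c1 c2 =>
      ITest j o b.+1 (b + clen c1 + 2) :: compile c1 b.+1 ++
      IGoto (b + clen c1 + clen c2 + 2) :: compile c2 (b + clen c1 + 2)
  | While j o c => ITest j o (b + clen c + 2) b.+1 :: rcons (compile c b.+1) (IGoto b)
  end.

Lemma size_compile c b : size (compile c b) = clen c.
Proof.
elim: c b => //= [c1 IH1 c2 IH2|j o c1 IH1 c2 IH2|j o c IH] b.
- by rewrite size_cat IH1 IH2.
- by rewrite size_cat /= IH1 IH2; lia.
- by rewrite size_rcons IH; lia.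
Qed.

(** Jump targets are absolute, so the surrounding code enters only through the length of [P1].
    Because of [exec_weak], the time in [exec] is only an upper bound, whence some [n <= t]. *)
Lemma exec_isteps c st st' t : exec c st st' t -> forall P1 P2,
  exists2 n, n <= t & isteps (P1 ++ compile c (size P1) ++ P2) n (size P1) st
                             (size P1 + clen c) st'.
Proof.
elim=> {c st st' t} [st|j a st|j st|c1 c2 st1 st2 st3 t1 t2 _ IH1 _ IH2
  |j o c1 c2 st st' t _ IH|j o c st Ho|j o c st1 st2 st3 t1 t2 Ho _ IH1 _ IH2
  |c st st' t t' _ IH let'] P1 P2 /=.
- by exists 0; rewrite //= addn0.
- exists 1 => //; exists (size P1).+1, (upd st j (a :: st j)).
  by rewrite nth_cat ltnn subnn /= addn1.
- exists 1 => //; exists (size P1).+1, (upd st j (behead (st j))).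
  by rewrite nth_cat ltnn subnn /= addn1.
- have [n1 len1 H1] := IH1 P1 (compile c2 (size P1 + clen c1) ++ P2).
  have [n2 len2 H2] := IH2 (P1 ++ compile c1 (size P1)) P2.
  exists (n1 + n2); first by lia.
  rewrite -catA; apply: isteps_trans H1 _; move: H2.
  by rewrite size_cat size_compile -!catA addnA.
- have G0 : istep (nth IReject (P1 ++ compile (If j o c1 c2) (size P1) ++ P2) (size P1)) st =
     Some (if ohead (st j) == o then (size P1).+1 else size P1 + clen c1 + 2, st).
    by rewrite nth_cat ltnn subnn.
  case: eqP IH G0 => _ IH G0.
    have [n len H] := IH (rcons P1 (ITest j o (size P1).+1 (size P1 + clen c1 + 2)))
      (IGoto (size P1 + clen c1 + clen c2 + 2) :: compile c2 (size P1 + clen c1 + 2) ++ P2).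
    exists (n + 1).+1; first by lia.
    exists (size P1).+1, st; split=> //.
    apply: (@isteps_trans _ n 1 _ _ ((size P1).+1 + clen c1) st').
      by move: H; rewrite size_rcons -cats1 -!catA /=.
    exists (size P1 + (clen c1 + clen c2 + 2)), st'; split=> //.
    rewrite nth_cat ifF; last by lia.
    rewrite -catA -cat_cons nth_cat ifF /= ?size_compile; last by lia.
    by rewrite (_ : _ - _ - _ = 0) /=; [case: ifP => _; congr (Some (_, _)); lia|lia].
  have [n len H] := IH (P1 ++ ITest j o (size P1).+1 (size P1 + clen c1 + 2) ::
    rcons (compile c1 (size P1).+1) (IGoto (size P1 + clen c1 + clen c2 + 2))) P2.
  exists n.+1; first by lia.
  exists (size P1 + clen c1 + 2), st; split=> //.
  move: H; rewrite size_cat /= size_rcons size_compile.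
  rewrite (_ : size P1 + (clen c1).+2 = size P1 + clen c1 + 2); last by lia.
  rewrite (_ : size P1 + clen c1 + 2 + clen c2 = size P1 + (clen c1 + clen c2 + 2)); last by lia.
  by rewrite -!catA /= -cats1 -!catA.
- exists 1 => //; exists (size P1 + clen c + 2), st.
  by rewrite nth_cat ltnn subnn /= Ho eqxx addnA.
- have [n1 len1 H1] := IH1 (rcons P1 (ITest j o (size P1 + clen c + 2) (size P1).+1))
    (IGoto (size P1) :: P2).
  have [n2 len2 H2] := IH2 P1 P2.
  exists (n1 + n2.+1).+1; first by lia.
  exists (size P1).+1, st1; split.
    by rewrite nth_cat ltnn subnn /= (introF eqP Ho).
  apply: (@isteps_trans _ n1 n2.+1 _ _ ((size P1).+1 + clen c) st2).
    by move: H1; rewrite size_rcons -!cats1 -!catA.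
  exists (size P1), st2; split=> //.
  rewrite nth_cat ifF; last by lia.
  rewrite -cats1 -catA -cat_cons nth_cat ifF /= ?size_compile; last by lia.
  by rewrite (_ : _ - _ - _ = 0) /=; [case: ifP|lia].
- by have [n len H] := IH P1 P2; exists n => //; lia.
Qed.

(* A program answers in register 4, by its being nonempty. *)
Definition cmd_tm (c : cmd) : TM :=
  machine (compile c 0 ++ [:: ITest 4 None (clen c + 2) (clen c + 1); IAccept; IReject]).

Lemma cmd_tm_run c (w : seq sym) st t (b : bool) N :
  exec c (upd (fun=> [::]) 0 (rev w)) st t -> (st 4 != [::]) = b ->
  (t + 1) * (2 * (size w + t + 1) + 6) + 3 <= N ->
  exists2 cf, run (cmd_tm c) N (init_config (map code w)) = Some cf & (c_state cf == 1) = b.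
Proof.
move=> Hc Hb leN.
have [n len Hi] := exec_isteps Hc [::] [:: ITest 4 None (clen c + 2) (clen c + 1); IAccept; IReject].
rewrite add0n cat0s in Hi.
set P := (X in isteps X) in Hi.
have H2 : (n + 1) * (2 * (size w + (n + 1)) + 6) + 3 <= N by nia.
have Hs : isteps P 1 (clen c) st (if b then clen c + 1 else clen c + 2) st.
  exists (if b then clen c + 1 else clen c + 2), st.
  rewrite /P nth_cat size_compile ltnn subnn /=; split=> //.
  by rewrite -Hb; case: (st 4).
have := machine_run (isteps_trans Hi Hs) H2.
rewrite /P nth_cat size_compile ifF; last by case: (b); lia.
case: b {Hs Hb}.
  rewrite (_ : _ - _ = 1) /=; last by lia.
  by case=> cf E1 E2; exists cf => //; rewrite E2.
rewrite (_ : _ - _ = 2) /=; last by lia.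
by case=> cf E1 E2; exists cf => //; rewrite (negbTE E2).
Qed.

(** * Stack programs for binary arithmetic *)

(* Register map. 0: input; 1: the encoded entries; 2, 3: the numbers of rows and
   columns in unary; 4: truth value; 5: copy of register 1 that is consumed;
   8, 9, 10: sign, numerator and denominator of the entry being read; 8, 11, 12:
   the product being computed; 13, 14, 15: the sum (P - N) / D being computed;
   6, 7, 16 to 19: scratch; from 20 on: three registers per index variable.
   Binary numbers have their least significant bit on top. *)

Ltac regs := rewrite /upd; repeat match goal with |- context [if ?a == ?b then _ else _] =>
  first [rewrite (_ : (a == b) = true); [|by lia] | rewrite (_ : (a == b) = false); [|by lia]] end;
  rewrite /=.

Ltac store_eq := apply: functional_extensionality => ?; rewrite /upd;
  repeat match goal with |- context [if ?a == ?b then _ else _] => case: (@eqP nat a b) => ?; try by [lia] end;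
  subst; try done.

Lemma exec_eq c st st' st'' t t' : exec c st st' t -> st' = st'' -> t <= t' -> exec c st st'' t'.
Proof. by move=> H <-; apply: exec_weak. Qed.

Definition Case (j : nat) (f : sym -> cmd) (d : cmd) : cmd :=
  If j (Some Bz) (f Bz) (If j (Some Bo) (f Bo) (If j (Some Mi) (f Mi)
    (If j (Some Ha) (f Ha) d))).

Lemma exec_case j f d st st' t :
  exec (if st j is s :: _ then f s else d) st st' t -> exec (Case j f d) st st' (t + 8).
Proof.
move=> H; have E n : t + n.+2 = t + n + 2 by lia.
rewrite /Case !E addn0; case Ej: (st j) H => [|[[] []] l] H.
- by do 4!(apply: exec_if; rewrite Ej /=).
- by do 4!(apply: exec_if; rewrite Ej /=).
- by do 3!(apply: exec_if; rewrite Ej /=); apply: exec_weak H _; lia.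
- by do 2!(apply: exec_if; rewrite Ej /=); apply: exec_weak H _; lia.
- by do 1!(apply: exec_if; rewrite Ej /=); apply: exec_weak H _; lia.
Qed.

Definition Foreach (j : nat) (f : sym -> cmd) : cmd :=
  While j None (Case j (fun s => Pop j ;; f s) Skip).

(* [I l st] holds when [l] is still to be read from register [j]. *)
Lemma exec_foreach j f (I : seq sym -> store -> Prop) T :
  (forall l st, I l st -> st j = l) ->
  (forall s l st, I (s :: l) st -> exists2 st', exec (f s) (upd st j l) st' T & I l st') ->
  forall L st, I L st ->
  exists2 st', I [::] st' & exec (Foreach j f) st st' (size L * (T + 11) + 1).
Proof.
move=> HI Hf; elim=> [|s l IH] st HL.
  by exists st => //; apply: exec_done; rewrite (HI _ _ HL).
have [st1 H1 I1] := Hf _ _ _ HL; have [st2 I2 H2] := IH _ I1.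
exists st2 => //=; have Ej := HI _ _ HL.
(* One step for [Pop], eight for [Case]; the loop adds two, which gives [T + 11] per symbol. *)
apply: exec_weak (exec_loop (t1 := T + 1 + 8) _ _ H2) _; first by rewrite Ej.
  apply: exec_case; rewrite Ej addnC; apply: exec_seq H1.
  by apply: exec_eq (exec_pop _ _) _ _ => //; rewrite Ej.
by rewrite mulSn; lia.
Qed.

Definition Clear (j : nat) : cmd := While j None (Pop j).


Lemma exec_clear j st : exec (Clear j) st (upd st j [::]) (3 * size (st j) + 1).
Proof.
move El: (st j) => l; elim: l st El => [|s l IH] st El.
  by rewrite upd_id //; apply: exec_done; rewrite El.
apply: exec_weak (exec_loop _ (exec_pop _ _) _) _; rewrite ?El //.
  apply: exec_eq (IH _ _) _ (leqnn _); first by rewrite upd_same.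
  by store_eq.
by rewrite /=; lia.
Qed.

Definition Move (a b : nat) : cmd := Foreach a (fun s => Push b s).

Lemma exec_move a b st : a <> b ->
  exec (Move a b) st (upd (upd st a [::]) b (catrev (st a) (st b))) (12 * size (st a) + 1).
Proof.
move=> nab.
pose I l st1 := exists2 lb, st1 = upd (upd st a l) b lb & catrev l lb = catrev (st a) (st b).
have [l st1|s l st1||st' [lb -> Elb] H] := @exec_foreach a (fun s => Push b s) I 1 _ _ (st a) st.
- by case=> lb -> _; regs.
- case=> lb -> Elb; eexists; first by apply: exec_push.
  by exists (s :: lb) => //; store_eq; regs.
- by exists (st b) => //; store_eq.
- by rewrite -Elb; apply: exec_eq H _ _ => //; lia.
Qed.

(** Moving a stack reverses it; the second reversal restores the order in [a] and in [b]. *)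
Definition Copy (a b t : nat) : cmd := Move a t ;; Foreach t (fun s => Push a s ;; Push b s).

Lemma exec_copy a b t st : a <> b -> a <> t -> b <> t -> st t = [::] ->
  exec (Copy a b t) st (upd st b (st a ++ st b)) (25 * size (st a) + 2).
Proof.
move=> nab nat_ nbt Et.
pose I l st1 := exists la lb, [/\ st1 = upd (upd (upd st t l) a la) b lb,
  catrev l la = st a & catrev l lb = st a ++ st b].
have [l st1|s l st1||st' [la [lb [-> Ela Elb]]] H] :=
  @exec_foreach t (fun s => Push a s ;; Push b s) I 2 _ _ (rev (st a))
    (upd (upd st a [::]) t (rev (st a))).
- by case=> la [lb [-> _]]; regs.
- case=> la [lb [-> Ela Elb]]; eexists; first by apply: exec_seq (exec_push _ _ _) (exec_push _ _ _).
  by exists (s :: la), (s :: lb); split=> //; store_eq; regs.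
- exists [::], (st b); split; rewrite ?catrevE ?revK ?cats0 //.
  by store_eq.
have H1 := exec_move st nat_; rewrite Et in H1.
apply: exec_eq (exec_seq H1 H) _ _; last by rewrite size_rev; lia.
by move: Ela Elb => /= -> ->; store_eq; rewrite Et.
Qed.

Fixpoint bval (l : seq sym) : nat := if l is s :: l' then s.2 + (bval l').*2 else 0.
(** Horner's scheme from the most significant bit, with [v] as the part already read; [bval] reads
    the opposite order. *)
Fixpoint rbval (l : seq sym) (v : nat) : nat := if l is s :: l' then rbval l' (s.2 + v.*2) else v.

Lemma bval_catrev l1 l2 : bval (catrev l1 l2) = rbval l1 (bval l2).
Proof. by elim: l1 l2 => //= s l IH l2; rewrite IH. Qed.

(** One column of an addition: [m] is the sum of the two bits, register 18 is nonempty when there is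
    a carry, and the resulting bit goes to register 16. *)
Definition bitadd (m : nat) : cmd :=
  If 18 (Some Bo)
    (Push 16 (false, odd m.+1) ;; if m.+1 < 2 then Pop 18 else Skip)
    (Push 16 (false, odd m) ;; if m < 2 then Skip else Push 18 Bo).

Lemma exec_bitadd m (c : bool) st : m <= 2 -> st 18 = nseq c Bo ->
  exec (bitadd m) st
     (upd (upd st 16 ((false, odd (m + c)) :: st 16)) 18 (nseq (1 < m + c) Bo)) 4.
Proof.
move=> lem E; apply: (@exec_if _ _ _ _ _ _ 2); rewrite E; case: c E => E /=.
  rewrite addn1; case: ifP => [lt2|/negbT]; last rewrite -leqNgt => ge2.
    apply: exec_eq (exec_seq (exec_push _ _ _) (exec_pop _ _)) _ _ => //.
    by rewrite (_ : 1 < m.+1 = false); [store_eq; rewrite E|lia].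
  apply: exec_eq (exec_seq (exec_push _ _ _) (exec_skip _)) _ _ => //.
  by rewrite ge2; store_eq; rewrite E.
rewrite addn0; case: ifP => [lt2|/negbT]; last rewrite -leqNgt => ge2.
  apply: exec_eq (exec_seq (exec_push _ _ _) (exec_skip _)) _ _ => //.
  by rewrite (_ : 1 < m = false); [store_eq; rewrite E|lia].
apply: exec_eq (exec_seq (exec_push _ _ _) (exec_push _ _ _)) _ _ => //.
by rewrite ge2; store_eq; rewrite E.
Qed.

Definition AddTo (x y : nat) : cmd :=
  Foreach y (fun s => Push 17 s ;;
     Case x (fun s' => Pop x ;; bitadd (s.2 + s'.2)) (bitadd s.2)) ;;
  Foreach x (fun s => bitadd s.2) ;;
  If 18 (Some Bo) (Pop 18 ;; Push 16 Bo) Skip ;;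
  Move 16 x ;; Move 17 y.

Lemma exec_add x y B st : x < 16 -> y < 16 -> x <> y ->
  st 16 = [::] -> st 17 = [::] -> st 18 = [::] -> size (st x) <= B -> size (st y) <= B ->
  exists l, [/\ bval l = bval (st x) + bval (st y), size l <= B.+1
    & exec (AddTo x y) st (upd st x l) (100 * B.+1)].
Proof.
move=> ltx lty nxy E16 E17 E18 leX leY.
pose S lx ly lt lu (c : bool) :=
  upd (upd (upd (upd (upd st y ly) x lx) 16 lt) 17 lu) 18 (nseq c Bo).
(* The bits in register 16 are the low ones of the result, so the sum still to be formed enters
   [rbval] as its high part. Register 17 collects the bits of [y] for restoring it. *)
pose I1 ly st1 := exists lx lt lu c, [/\ st1 = S lx ly lt lu c,
  rbval lt (bval lx + bval ly + c) = bval (st x) + bval (st y), catrev lu ly = st y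
  & size lt + maxn (size lx) (size ly) <= B].
have [ly st1|s ly st1||st1 [lx1 [lt1 [lu1 [c1 [-> V1 Elu le1]]]]] H1] :=
  @exec_foreach y (fun s => Push 17 s ;;
     Case x (fun s' => Pop x ;; bitadd (s.2 + s'.2)) (bitadd s.2)) I1 14 _ _ (st y) st.
- by case=> lx [lt [lu [c [-> _ _ _]]]]; rewrite /S; regs.
- case=> lx [lt [lu [c [-> Vx Elu lex]]]].
  case: lx Vx lex => [|s' lx] Vx lex.
    eexists; first apply: (@exec_seq _ _ _ (S [::] ly lt (s :: lu) c) _ 1 13).
    + by apply: exec_eq (exec_push _ _ _) _ _ => //; rewrite /S; store_eq; regs.
    + apply: (@exec_case _ _ _ _ _ 5); rewrite {1}/S; regs.
      by apply: exec_weak (exec_bitadd (c := c) _ _) _; [case: (s.2)|rewrite /S; regs|].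
    exists [::], ((false, odd (s.2 + c)) :: lt), (s :: lu), (1 < s.2 + c); split=> //=.
    + by rewrite /S; store_eq; regs.
    + by rewrite -Vx /=; congr rbval; case: (s.2) (c) => [] [] /=; lia.
    + by rewrite /= in lex; lia.
  eexists; first apply: (@exec_seq _ _ _ (S (s' :: lx) ly lt (s :: lu) c) _ 1 13).
  + by apply: exec_eq (exec_push _ _ _) _ _ => //; rewrite /S; store_eq; regs.
  + apply: (@exec_case _ _ _ _ _ 5); rewrite {1}/S; regs.
    apply: (@exec_seq _ _ _ (S lx ly lt (s :: lu) c) _ 1 4).
      by apply: exec_eq (exec_pop _ _) _ _ => //; rewrite /S; store_eq; regs.
    by apply: exec_bitadd; [case: (s.2) (s'.2) => [] []|rewrite /S; regs].
  exists lx, ((false, odd (s.2 + s'.2 + c)) :: lt), (s :: lu), (1 < s.2 + s'.2 + c); split=> //=.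
  + by rewrite /S; store_eq; regs.
  + by rewrite -Vx /=; congr rbval; case: (s.2) (s'.2) (c) => [] [] [] /=; lia.
  + by rewrite /= in lex; lia.
- exists (st x), [::], [::], false; split=> //=; last by lia.
    by rewrite /S; store_eq; regs; rewrite ?E16 ?E17 ?E18.
  by rewrite addn0.
pose I2 lx st2 := exists lt c, [/\ st2 = S lx [::] lt lu1 c,
  rbval lt (bval lx + c) = bval (st x) + bval (st y) & size lt + size lx <= B].
have [lx st2|s lx st2||st2 [lt2 [c2 [-> V2 le2]]] H2] :=
  @exec_foreach x (fun s => bitadd s.2) I2 4 _ _ lx1 (S lx1 [::] lt1 lu1 c1).
- by case=> lt [c [-> _ _]]; rewrite /S; regs.
- case=> lt [c [-> Vx lex]]; eexists.
    by apply: (exec_bitadd (c := c)); [case: (s.2)|rewrite /S; regs].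
  exists ((false, odd (s.2 + c)) :: lt), (1 < s.2 + c); split=> //=.
  + by rewrite /S; store_eq; regs.
  + by rewrite -Vx /=; congr rbval; case: (s.2) (c) => [] [] /=; lia.
  + by rewrite /= in lex; lia.
- exists lt1, c1; split=> //.
  by rewrite -V1 /= addn0.
have H3 : exec (If 18 (Some Bo) (Pop 18 ;; Push 16 Bo) Skip) (S [::] [::] lt2 lu1 c2)
    (S [::] [::] (nseq c2 Bo ++ lt2) lu1 false) 4.
  apply: (@exec_if _ _ _ _ _ _ 2); rewrite {1}/S; regs; case: (c2) => /=.
    by apply: exec_eq (exec_seq (exec_pop _ _) (exec_push _ _ _)) _ _ => //; rewrite /S; store_eq; regs.
  by apply: exec_weak (exec_skip _) _.
have n16 : 16 <> x by lia.
have n17 : 17 <> y by lia.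
exists (catrev (nseq c2 Bo ++ lt2) [::]); split.
- by rewrite bval_catrev -V2; case: (c2).
- by rewrite catrevE !size_cat size_rev size_cat addn0; case: (c2) => /=; rewrite /= in le2; lia.
apply: exec_eq (exec_seq H1 (exec_seq H2 (exec_seq H3 (exec_seq (exec_move _ n16) (exec_move _ n17))))) _ _.
  by rewrite /S; store_eq; regs; rewrite ?Elu ?E16 ?E17 ?E18.
have Eu : size lu1 = size (st y) by rewrite -Elu catrevE size_cat size_rev addn0.
have E1 : S [::] [::] (nseq c2 Bo ++ lt2) lu1 false 16 = nseq c2 Bo ++ lt2 by rewrite /S; regs.
rewrite E1 (_ : upd _ _ _ 17 = lu1); last by rewrite /S; regs.
rewrite size_cat Eu size_nseq; rewrite /= in le1 le2.
by case: (c2) => /=; lia.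
Qed.

(** Schoolbook multiplication by Horner: the move to register 19 puts the most significant bit of
    [x] on top, and pushing a zero bit doubles the accumulator. *)
Definition Mul (x y : nat) : cmd :=
  Move x 19 ;; Foreach 19 (fun s => Push x Bz ;; if s.2 then AddTo x y else Skip).

Lemma exec_mul x y B st : x < 16 -> y < 16 -> x <> y ->
  st 16 = [::] -> st 17 = [::] -> st 18 = [::] -> st 19 = [::] ->
  size (st x) <= B -> size (st y) <= B ->
  exists l, [/\ bval l = bval (st x) * bval (st y), size l <= 3 * B
    & exec (Mul x y) st (upd st x l) (1000 * B.+1 * B.+1)].
Proof.
move=> ltx lty nxy E16 E17 E18 E19 leX leY.
(* [v] is the number formed by the bits of [x] already read. A round uses one bit and lengthens [a]
   by at most two, unless [y] is the longer summand, a case covered by its length in the bound; the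
   total is at most [3 * B]. *)
pose I l st1 := exists a v, [/\ st1 = upd (upd st 19 l) x a, bval a = v * bval (st y),
  rbval l v = bval (st x), size l <= size (st x)
  & size a + 2 * size l <= size (st y) + 2 * size (st x)].
have [l st1|s l st1||st1 [a [v [-> Ea Ev lel lea]]] H1] :=
  @exec_foreach 19 (fun s => Push x Bz ;; if s.2 then AddTo x y else Skip) I
    (500 * B.+1) _ _ (rev (st x)) (upd (upd st x [::]) 19 (rev (st x))).
- by case=> a [v [-> _ _ _ _]]; regs.
- case=> a [v [-> Ea Ev lel lea]]; rewrite /= in lea lel.
  have Hp : exec (Push x Bz) (upd (upd (upd st 19 (s :: l)) x a) 19 l)
     (upd (upd st 19 l) x (Bz :: a)) 1.
    by apply: exec_eq (exec_push _ _ _) _ _ => //; store_eq; regs.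
  case E2: s.2; last first.
    eexists; first by apply: exec_weak (exec_seq Hp (exec_skip _)) _; lia.
    exists (Bz :: a), v.*2; split=> //=; try lia.
    by rewrite -Ev /= E2; congr rbval; lia.
  have [|||||b []] := @exec_add x y (maxn (size a).+1 (size (st y)))
    (upd (upd st 19 l) x (Bz :: a)) ltx lty nxy; try (regs => //; lia).
  regs => Eb leb Hb.
  eexists; first by apply: exec_weak (exec_seq Hp Hb) _; lia.
  exists b, (v.*2 + 1); split; try lia.
  + by store_eq.
  + by rewrite -Ev /= E2; congr rbval; lia.
- exists [::], 0; split=> //; rewrite ?size_rev //=; try lia.
    by store_eq.
  by rewrite -[rbval _ _]/(rbval _ (bval [::])) -bval_catrev catrevE revK cats0.
have n19 : x <> 19 by lia.
have Hm := exec_move st n19; rewrite E19 in Hm.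
exists a; split; rewrite /= in lea Ev.
- by rewrite Ea Ev.
- by lia.
- apply: exec_eq (exec_seq Hm H1) _ _; first by store_eq; rewrite E19.
  rewrite size_rev; have := leq_mul leX (leqnn (500 * B.+1 + 11)); lia.
Qed.

(** Register 4 records whether the low bits read so far make the first number larger. Each new bit
    is more significant, so a difference there overrides the record. *)
Definition setflag (b b' : bool) : cmd :=
  if b && ~~ b' then Pop 4 ;; Push 4 Bo else if ~~ b && b' then Pop 4 else Skip.

Lemma exec_setflag b b' (f : bool) st : st 4 = nseq f Bo ->
  exec (setflag b b') st (upd st 4 (nseq (b && ~~ b' || (b == b') && f) Bo)) 2.
Proof.
move=> E4; case: b b' => [] [] /=.
- by apply: exec_eq (exec_skip _) _ _ => //; rewrite upd_id.
- by apply: exec_eq (exec_seq (exec_pop _ _) (exec_push _ _ _)) _ _ => //; store_eq; rewrite E4; case: (f).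
- by apply: exec_eq (exec_pop _ _) _ _ => //; rewrite E4; case: (f).
- by apply: exec_eq (exec_skip _) _ _ => //; rewrite upd_id.
Qed.

Definition Greater : cmd :=
  Foreach 13 (fun s => Case 14 (fun s' => Pop 14 ;; setflag s.2 s'.2) (setflag s.2 false)) ;;
  Foreach 14 (fun s => setflag false s.2).

Lemma exec_greater st B : st 4 = [::] -> size (st 13) <= B -> size (st 14) <= B ->
  exec Greater st
     (upd (upd (upd st 13 [::]) 14 [::]) 4 (nseq (bval (st 14) < bval (st 13)) Bo)) (50 * B.+1).
Proof.
move=> E4 leP leN.
pose S lp ln (f : bool) := upd (upd (upd st 13 lp) 14 ln) 4 (nseq f Bo).
pose I1 lp st1 := exists ln f, [/\ st1 = S lp ln f,
  (bval ln < bval lp) || (bval ln == bval lp) && f = (bval (st 14) < bval (st 13)) & size ln <= B].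
have [lp st1|s lp st1||st1 [ln1 [f1 [-> V1 le1]]] H1] :=
  @exec_foreach 13 (fun s => Case 14 (fun s' => Pop 14 ;; setflag s.2 s'.2) (setflag s.2 false))
    I1 11 _ _ (st 13) st.
- by case=> ln [f [-> _ _]]; rewrite /S; regs.
- case=> ln [f [-> Vf lef]]; case: ln Vf lef => [|s' ln] Vf lef.
    eexists.
      apply: (@exec_case _ _ _ _ _ 3); rewrite {1}/S; regs.
      by apply: exec_weak (@exec_setflag _ _ f _ _) _ => //; rewrite /S; regs.
    exists [::], (s.2 && ~~ false || (s.2 == false) && f); split=> //.
      by rewrite /S; store_eq; regs.
    by rewrite -Vf /=; case: (s.2) (f) => [] [] /=; lia.
  eexists.
    apply: (@exec_case _ _ _ _ _ 3); rewrite {1}/S; regs.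
    apply: (@exec_seq _ _ _ (S lp ln f) _ 1 2).
      by apply: exec_eq (exec_pop _ _) _ _ => //; rewrite /S; store_eq; regs.
    by apply: (@exec_setflag _ _ f); rewrite /S; regs.
  exists ln, (s.2 && ~~ s'.2 || (s.2 == s'.2) && f); split=> //.
  + by rewrite /S; store_eq; regs.
  + by rewrite -Vf /=; case: (s.2) (s'.2) (f) => [] [] [] /=; lia.
  + by rewrite /= in lef; lia.
- exists (st 14), false; split=> //; last by rewrite andbF orbF.
  by rewrite /S; store_eq.
pose I2 ln st2 := exists2 f : bool, st2 = S [::] ln f
  & (bval ln == 0) && f = (bval (st 14) < bval (st 13)).
have [ln st2|s ln st2||st2 [f2 -> V2] H2] :=
  @exec_foreach 14 (fun s => setflag false s.2) I2 2 _ _ ln1 (S [::] ln1 f1).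
- by case=> f -> _; rewrite /S; regs.
- case=> f -> Vf; eexists; first by apply: (@exec_setflag _ _ f); rewrite /S; regs.
  exists (false && ~~ s.2 || (false == s.2) && f); first by rewrite /S; store_eq; regs.
  by rewrite -Vf /=; case: (s.2) (f) => [] [] /=; lia.
- by exists f1 => //; rewrite -V1 /= ltn0.
apply: exec_eq (exec_seq H1 H2) _ _; last by lia.
by rewrite -V2 /S /=.
Qed.

(** * Reading the encoding *)

Definition decode (x : nat) : sym := (2 < x, (x == 2) || (x == 4)).

Lemma code_decode (l : seq nat) : all (fun x => 0 < x < 5) l -> map code (map decode l) = l.
Proof.
rewrite -map_comp => /allP Hl; rewrite -[RHS]map_id; apply/eq_in_map => x /Hl /=.
by case: x => [|[|[|[|[|x]]]]].
Qed.

Definition nbits (n : nat) : seq sym := map decode (nat_bits n).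
Definition ratstr (a : rat) : seq sym := map decode (rat_bits a ++ [:: 4]).
Definition ratstrs (l : seq rat) : seq sym := flatten (map ratstr l).

Lemma pos_bits_ok x : all (fun x => (x == 1) || (x == 2)) (pos_bits x).
Proof. by elim: x => //= x IH; rewrite all_rcons IH. Qed.

Lemma nat_bits_ok n : all (fun x => (x == 1) || (x == 2)) (nat_bits n).
Proof. by rewrite /nat_bits; case: N.of_nat => // x; apply: pos_bits_ok. Qed.

Lemma rbval_rcons l s v : rbval (rcons l s) v = s.2 + (rbval l v).*2.
Proof. by elim: l v => //= s' l IH v; rewrite IH. Qed.

Lemma rbval_nbits n : rbval (nbits n) 0 = n.
Proof.
rewrite /nbits /nat_bits -[RHS]Nnat.Nat2N.id; case: N.of_nat => //= x.
elim: x => [x IH|x IH|] //=; rewrite map_rcons rbval_rcons IH /=.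
  by rewrite Pos2Nat.inj_xI; lia.
by rewrite Pos2Nat.inj_xO; lia.
Qed.

Lemma nbits_fst n : all (fun s => ~~ s.1) (nbits n).
Proof.
rewrite /nbits all_map; apply/allP => x /(allP (nat_bits_ok n)) /=.
by case/orP => /eqP ->.
Qed.

Lemma Ha_nbits n : Ha \notin nbits n.
Proof. by apply/negP => /(allP (nbits_fst n)). Qed.

Lemma ohead_nbits n l : ohead (nbits n ++ Ha :: l) <> Some Mi.
Proof. by case E: (nbits n) => [|s m] //= [Es]; have := nbits_fst n; rewrite E Es. Qed.

Lemma int_bitsE z : map decode (int_bits z) = nseq (z < 0)%R Mi ++ nbits `|z|%N.
Proof. by case: z. Qed.

Lemma ratstrE a : ratstr a =
  (nseq (a < 0)%R Mi ++ nbits `|numq a|%N) ++ Ha :: nbits `|denq a|%N ++ [:: Ha].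
Proof.
rewrite /ratstr /rat_bits map_cat map_cat /= !int_bitsE numq_lt0 -catA cat_cons.
by rewrite [(denq a < 0)%R]ltNge ltW ?denq_gt0.
Qed.

(** A field is written from its most significant bit; reading reverses it into the order of
    [bval]. *)
Definition ReadField (a b : nat) : cmd :=
  While a (Some Ha) (Case a (fun s => Pop a ;; Push b s) Skip) ;; Pop a.

Lemma exec_read_field a b st l l' : a <> b -> Ha \notin l -> st a = l ++ Ha :: l' ->
  exec (ReadField a b) st (upd (upd st a l') b (catrev l (st b))) (12 * size l + 2).
Proof.
move=> nab Hl Ea.
have {Hl Ea} H : exec (While a (Some Ha) (Case a (fun s => Pop a ;; Push b s) Skip)) st
    (upd (upd st a (Ha :: l')) b (catrev l (st b))) (12 * size l + 1).
  elim: l st Hl Ea => [|s l IH] st Hl Ea.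
    by apply: exec_eq (exec_done _ _) _ _; rewrite ?Ea //; store_eq.
  rewrite inE negb_or in Hl; case/andP: Hl => ns Hl.
  have E1 : upd (upd st a (l ++ Ha :: l')) b (s :: st b) a = l ++ Ha :: l' by regs.
  apply: exec_eq (exec_loop (t1 := 2 + 8) _ _ (IH _ Hl E1)) _ _; last by rewrite /=; lia.
  - by rewrite Ea => -[Es]; rewrite Es eqxx in ns.
  - apply: exec_case; rewrite Ea; apply: exec_eq (exec_seq (exec_pop _ _) (exec_push _ _ _)) _ _ => //.
    by rewrite Ea; store_eq; regs.
  - by store_eq; regs.
apply: exec_eq (exec_seq H (exec_pop _ _)) _ _; last by lia.
by store_eq; regs.
Qed.

Definition SkipField (a : nat) : cmd := While a (Some Ha) (Pop a) ;; Pop a.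

Lemma exec_skip_field a st l l' : Ha \notin l -> st a = l ++ Ha :: l' ->
  exec (SkipField a) st (upd st a l') (3 * size l + 2).
Proof.
move=> Hl Ea.
have {Hl Ea} H : exec (While a (Some Ha) (Pop a)) st (upd st a (Ha :: l')) (3 * size l + 1).
  elim: l st Hl Ea => [|s l IH] st Hl Ea.
    by apply: exec_eq (exec_done _ _) _ _; rewrite ?Ea //; store_eq.
  rewrite inE negb_or in Hl; case/andP: Hl => ns Hl.
  apply: exec_eq (exec_loop _ (exec_pop _ _) (IH _ Hl _)) _ _; last by rewrite /=; lia.
  - by rewrite Ea => -[Es]; rewrite Es eqxx in ns.
  - by rewrite Ea upd_same.
  - by store_eq.
apply: exec_eq (exec_seq H (exec_pop _ _)) _ _; last by lia.
by store_eq; regs.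
Qed.

Definition Times (x sv : nat) (c : cmd) : cmd :=
  Foreach x (fun s => Push sv s ;; c) ;; Move sv x.

(** [S k] is the store after [k] rounds, up to the two counters. Within a round these hold partial
    counts, so [c] has to work for arbitrary contents [lx] and [ls]. *)
Lemma exec_times x sv c n (S : nat -> store) T : x <> sv ->
  (forall k, S k x = nseq n Bz) -> (forall k, S k sv = [::]) ->
  (forall k lx ls, k < n -> exec c (upd (upd (S k) x lx) sv ls) (upd (upd (S k.+1) x lx) sv ls) T) ->
  exec (Times x sv c) (S 0) (S n) (n * (T + 24) + 2).
Proof.
move=> nx Ex Es Hc.
pose I l st := exists k, [/\ l = nseq (n - k) Bz, k <= n & st = upd (upd (S k) x l) sv (nseq k Bz)].
have [l st|s l st||st [k [Ek lek ->]] H] :=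
  @exec_foreach x (fun s => Push sv s ;; c) I T.+1 _ _ (nseq n Bz) (S 0).
- by case=> k [_ _ ->]; regs.
- case=> k [El lek ->]; have ltk : k < n by case: (ltngtP k n) lek El => // ->; rewrite subnn.
  move: El; rewrite (_ : n - k = (n - k.+1).+1) /=; last by lia.
  case=> -> ->.
  eexists; last by exists k.+1; split.
  apply: (@exec_seq _ _ _ _ _ 1 T); last by apply: Hc.
  by apply: exec_eq (exec_push _ _ _) _ _ => //; store_eq; regs.
- exists 0; split=> //; first by rewrite subn0.
  by store_eq; rewrite ?Es ?Ex.
have {Ek} Ek : k = n by apply/eqP; move: (congr1 size Ek) lek; rewrite size_nseq /=; lia.
rewrite {}Ek {lek} in H.
have nsx : sv <> x by move=> E; apply: nx.
have Hm := @exec_move sv x (upd (upd (S n) x [::]) sv (nseq n Bz)) nsx.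
apply: exec_eq (exec_seq H Hm) _ _; last by regs; rewrite !size_nseq; lia.
by store_eq; regs; rewrite ?Es ?Ex // catrevE rev_nseq cats0.
Qed.

Lemma ratstrs_drop (l : seq rat) k : k < size l ->
  ratstrs (drop k l) = ratstr (nth 0%R l k) ++ ratstrs (drop k.+1 l).
Proof. by move=> ltk; rewrite (drop_nth 0%R). Qed.

Lemma size_ratstrs_drop (l : seq rat) k : size (ratstrs (drop k l)) <= size (ratstrs l).
Proof. by rewrite -{2}(cat_take_drop k l) /ratstrs map_cat flatten_cat size_cat leq_addl. Qed.

Lemma size_ratstr_nth (l : seq rat) k : k < size l ->
  size (ratstr (nth 0%R l k)) <= size (ratstrs l).
Proof.
move=> ltk; apply: leq_trans (size_ratstrs_drop l k).
by rewrite ratstrs_drop // size_cat leq_addr.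
Qed.

Lemma Ha_ratnum (a : rat) : Ha \notin nseq (a < 0)%R Mi ++ nbits `|numq a|%N.
Proof. by rewrite mem_cat negb_or Ha_nbits andbT; case: (a < 0)%R. Qed.

Definition SkipEntry : cmd := SkipField 5 ;; SkipField 5.

Lemma exec_skip_entry st a l : st 5 = ratstr a ++ l ->
  exec SkipEntry st (upd st 5 l) (3 * size (ratstr a) + 4).
Proof.
rewrite ratstrE => E5.
have E5' : st 5 = (nseq (a < 0)%R Mi ++ nbits `|numq a|%N) ++ Ha :: (nbits `|denq a|%N ++ Ha :: l).
  by rewrite E5 -!catA /= -catA.
apply: exec_eq (exec_seq (exec_skip_field (Ha_ratnum a) E5') (exec_skip_field (Ha_nbits _) _)) _ _.
- by rewrite upd_same.
- by store_eq.
- rewrite !size_cat /= !size_cat /=.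
  by move: (size (nseq _ _)) (size (nbits _)) (size (nbits _)) => x y z; lia.
Qed.

Lemma exec_skip_entries (ents : seq rat) b m n x sv st : b + m <= size ents ->
  size (ratstrs ents) <= n -> x <> sv -> x <> 5 -> sv <> 5 ->
  st x = nseq m Bz -> st sv = [::] -> st 5 = ratstrs (drop b ents) ->
  exec (Times x sv SkipEntry) st (upd st 5 (ratstrs (drop (b + m) ents))) (m * (3 * n + 28) + 2).
Proof.
move=> lem len nx n5 ns Ex Es E5.
pose S k := upd st 5 (ratstrs (drop (b + k) ents)).
have ES0 : st = S 0 by rewrite /S addn0 upd_id.
rewrite {1}ES0 => {ES0}; apply: exec_weak (exec_times (T := 3 * n + 4) nx _ _ _) _; last by lia.
- by move=> k; rewrite /S; regs.
- by move=> k; rewrite /S; regs.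
move=> k lx ls ltk; have ltb : b + k < size ents by lia.
apply: exec_eq (@exec_skip_entry _ (nth 0%R ents (b + k)) (ratstrs (drop (b + k).+1 ents)) _) _ _.
- by rewrite /S; regs; rewrite ratstrs_drop.
- by rewrite /S addnS; store_eq.
- by have := size_ratstr_nth ltb; lia.
Qed.

(** Entries are listed row by row, so [xu * q + xv] of them are skipped, with [q] in register 3. A
    minus sign flips register 8, which accumulates the sign of the whole product. *)
Definition LoadEntry (xu xv : nat) : cmd :=
  Copy 1 5 16 ;; Times xu 6 (Times 3 7 SkipEntry) ;; Times xv 6 SkipEntry ;;
  If 5 (Some Mi) (Pop 5 ;; If 8 None (Push 8 Bo) (Pop 8)) Skip ;;
  ReadField 5 9 ;; ReadField 5 10 ;; Clear 5.

Definition load_time n := 1000 * n.+1 * n.+1 * n.+1.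

Lemma exec_load_entry (ents : seq rat) i j p q n xu xv (f : bool) st :
  size ents = p * q -> i < p -> j < q -> size (ratstrs ents) <= n -> p <= n -> q <= n ->
  19 < xu -> 19 < xv ->
  st 1 = ratstrs ents -> st 3 = nseq q Bz -> st xu = nseq i Bz -> st xv = nseq j Bz ->
  (forall k, 5 <= k <= 16 -> k != 8 -> k < 11 \/ k = 16 -> st k = [::]) -> st 8 = nseq f Bo ->
  let a := nth 0%R ents (i * q + j) in
  exists ln ld, [/\ bval ln = `|numq a|%N, bval ld = `|denq a|%N, size ln <= n, size ld <= n
    & exec (LoadEntry xu xv) st
         (upd (upd (upd st 8 (nseq (f (+) (a < 0)%R) Bo)) 9 ln) 10 ld) (load_time n)].
Proof.
move=> Hs ltip ltjq len lep leq gtu gtv E1 E3 Eu Ev E0 E8 a.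
have lte : i * q + j < size ents by rewrite Hs; nia.
have [E5 E6 E7 E9 E10] : [/\ st 5 = [::], st 6 = [::], st 7 = [::], st 9 = [::] & st 10 = [::]].
  by split; apply: E0 => //; left.
have E16 : st 16 = [::] by apply: E0 => //; right.
pose S k := upd st 5 (ratstrs (drop k ents)).
have H1 : exec (Copy 1 5 16) st (S 0) (25 * n + 2).
  have := @exec_copy 1 5 16 st; rewrite E16 => /(_ _ _ _ erefl) H.
  apply: exec_eq (H _ _ _) _ _ => //; last by rewrite E1; lia.
  by rewrite /S drop0 E1 E5 cats0.
have H2 : exec (Times xu 6 (Times 3 7 SkipEntry)) (S 0) (S (i * q)) (i * (q * (3 * n + 28) + 2 + 24) + 2).
  have -> : S 0 = (fun k => S (k * q)) 0 by [].
  apply: (@exec_times xu 6 _ i (fun k => S (k * q))); first by lia.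
  - by move=> k; rewrite /S; regs.
  - by move=> k; rewrite /S; regs.
  move=> k lx ls ltk.
  apply: exec_eq (@exec_skip_entries ents (k * q) q n 3 7 _ _ len _ _ _ _ _ _) _ _ => //.
  - by rewrite Hs -mulSnr leq_mul2r (leq_trans ltk) ?orbT // ltnW.
  - by rewrite /S; regs.
  - by rewrite /S; regs.
  - by rewrite /S; regs.
  - by rewrite /S -mulSnr; store_eq.
have H3 : exec (Times xv 6 SkipEntry) (S (i * q)) (S (i * q + j)) (j * (3 * n + 28) + 2).
  apply: exec_eq (@exec_skip_entries ents (i * q) j n xv 6 _ _ len _ _ _ _ _ _) _ _ => //; try lia.
  - by rewrite /S; regs.
  - by rewrite /S; store_eq.
pose rest := ratstrs (drop (i * q + j).+1 ents).
pose S4 := upd (upd st 5 (nbits `|numq a|%N ++ Ha :: (nbits `|denq a|%N ++ Ha :: rest)))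
  8 (nseq (f (+) (a < 0)%R) Bo).
have E4 : S (i * q + j) = upd st 5 (nseq (a < 0)%R Mi ++ nbits `|numq a|%N ++
   Ha :: (nbits `|denq a|%N ++ Ha :: rest)).
  by rewrite /S ratstrs_drop // ratstrE -!catA /= -catA.
have H4 : exec (If 5 (Some Mi) (Pop 5 ;; If 8 None (Push 8 Bo) (Pop 8)) Skip) (S (i * q + j)) S4 6.
  rewrite E4 /S4; apply: (@exec_if _ _ _ _ _ _ 4); regs; case: (a < 0)%R => /=.
    apply: (@exec_seq _ _ _ (upd st 5 (nbits `|numq a|%N ++ Ha :: (nbits `|denq a|%N ++ Ha :: rest)))
       _ 1 3).
      by apply: exec_eq (exec_pop _ _) _ _ => //; store_eq.
    apply: (@exec_if _ _ _ _ _ _ 1); regs; rewrite E8; case: (f) E8 => E8 /=.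
      by apply: exec_eq (exec_pop _ _) _ _ => //; regs; rewrite E8.
    by apply: exec_eq (exec_push _ _ _) _ _ => //; regs; rewrite E8.
  rewrite addbF; case: eqP => [/ohead_nbits//|_].
  by apply: exec_eq (exec_skip _) _ _ => //; store_eq.
have sz : size (nbits `|numq a|%N) + size (nbits `|denq a|%N) + size rest <= n.
  apply: leq_trans len; apply: leq_trans (size_ratstrs_drop _ (i * q + j)).
  rewrite ratstrs_drop // ratstrE !size_cat /= !size_cat /= -/rest.
  by move: (size (nseq _ _)) (size (nbits _)) (size (nbits _)) => x y z; lia.
have [szn szd szr] : [/\ size (nbits `|numq a|%N) <= n, size (nbits `|denq a|%N) <= n
    & size rest <= n].
  by move: sz; move: (size (nbits _)) (size (nbits _)) => x y sz; split; lia.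
pose ln := rev (nbits `|numq a|%N); pose ld := rev (nbits `|denq a|%N).
have Hrev m : bval (rev (nbits m)) = m.
  by rewrite -[rev _]cats0 -catrevE bval_catrev rbval_nbits.
exists ln, ld; split; rewrite ?Hrev ?size_rev //.
have H5 : exec (ReadField 5 9) S4 (upd (upd S4 5 (nbits `|denq a|%N ++ Ha :: rest)) 9 ln)
   (12 * n + 2).
  apply: exec_eq (@exec_read_field 5 9 S4 _ _ _ (Ha_nbits `|numq a|%N) _) _ _ => //.
  - by rewrite catrevE; congr upd; rewrite /S4; regs; rewrite E9 cats0.
  - by rewrite leq_add2r leq_mul2l.
have H6 : exec (ReadField 5 10) (upd (upd S4 5 (nbits `|denq a|%N ++ Ha :: rest)) 9 ln)
  (upd (upd (upd S4 9 ln) 10 ld) 5 rest) (12 * n + 2).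
  apply: exec_eq (@exec_read_field 5 10 _ _ _ _ (Ha_nbits `|denq a|%N) _) _ _ => //.
  - by rewrite catrevE /S4; store_eq; rewrite E10 cats0.
  - by rewrite leq_add2r leq_mul2l.
apply: exec_eq (exec_seq H1 (exec_seq H2 (exec_seq H3 (exec_seq H4 (exec_seq H5 (exec_seq H6 (exec_clear _ _))))))) _ _.
  by rewrite /S4; store_eq; rewrite E5.
rewrite upd_same /load_time.
have lei : i <= n by lia.
have lej : j <= n by lia.
have : i * (q * (3 * n + 28) + 2 + 24) <= n * (n * (3 * n + 28) + 2 + 24).
  by apply: leq_mul => //; rewrite !leq_add2r leq_mul2r leq orbT.
have : j * (3 * n + 28) <= n * (3 * n + 28) by rewrite leq_mul2r lej orbT.
nia.
Qed.

(** * Polynomial bounds *)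

Definition polyb (T : nat -> nat) : Prop := exists k, forall n, T n <= k * n.+1 ^ k.

Lemma polyb_le T T' : (forall n, T n <= T' n) -> polyb T' -> polyb T.
Proof. by move=> le [k Hk]; exists k => n; apply: leq_trans (Hk n). Qed.

Lemma polyb_const c : polyb (fun=> c).
Proof. by exists c => n; rewrite leq_pmulr // expn_gt0. Qed.

Lemma polyb_succ : polyb S.
Proof. by exists 1 => n; rewrite mul1n expn1. Qed.

Lemma polyb_id : polyb id.
Proof. by apply: polyb_le polyb_succ => n; apply: leqnSn. Qed.

Lemma polyb_add T1 T2 : polyb T1 -> polyb T2 -> polyb (fun n => T1 n + T2 n).
Proof.
move=> [k1 H1] [k2 H2]; exists (k1 + k2) => n; rewrite mulnDl.
by apply: leq_add; [apply: leq_trans (H1 n) _|apply: leq_trans (H2 n) _];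
  rewrite leq_mul2l leq_pexp2l ?orbT // ?leq_addr ?leq_addl.
Qed.

Lemma polyb_mul T1 T2 : polyb T1 -> polyb T2 -> polyb (fun n => T1 n * T2 n).
Proof.
move=> [k1 H1] [k2 H2]; exists (k1 * k2 + (k1 + k2)) => n.
apply: leq_trans (leq_mul (H1 n) (H2 n)) _.
by rewrite mulnACA -expnD; apply: leq_mul; [apply: leq_addr|rewrite leq_pexp2l // leq_addl].
Qed.

Lemma polyb_S T : polyb T -> polyb (fun n => (T n).+1).
Proof. by move=> HT; apply: polyb_add (polyb_const 1) HT. Qed.

Ltac polyb_tac := repeat lazymatch goal with
  | |- polyb (fun _ => ?c) => exact (polyb_const c)
  | |- polyb (fun n => n) => exact polyb_id
  | |- polyb (fun n => addn (@?f n) (@?g n)) => apply: (@polyb_add f g)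
  | |- polyb (fun n => muln (@?f n) (@?g n)) => apply: (@polyb_mul f g)
  | |- polyb (fun n => S (@?f n)) => apply: (@polyb_S f)
  | |- _ => assumption
  end.

(** * Signs of polynomials in the entries *)

(* A term [(b, m)] stands for the product of the entries at the index pairs of
   [m], negated when [b] holds. *)
Definition poly_expr := seq (bool * seq (nat * nat)).

Definition peval (e : nat -> nat -> rat) (rho : nat -> nat) (P : poly_expr) : rat :=
  (\sum_(t <- P) (-1) ^+ t.1 * \prod_(uv <- t.2) e (rho uv.1) (rho uv.2))%R.

Definition entry_at (ents : seq rat) (q i j : nat) : rat := nth 0%R ents (i * q + j).

(** The three registers of a variable hold its value, the number of values still to try, and the
    truth value of its quantifier so far. *)
Definition xreg (v : nat) : nat := 20 + 3 * v.

Definition input_ok (ents : seq rat) (p q n : nat) : Prop :=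
  [/\ size ents = p * q, size (ratstrs ents) <= n, p <= n & q <= n].

(* [vt] tells which index variables range over rows. *)
Definition loaded (ents : seq rat) (p q : nat) (vt : seq bool) (rho : nat -> nat) (st : store) :=
  [/\ st 1 = ratstrs ents, st 2 = nseq p Bz, st 3 = nseq q Bz
    & forall v, v < size vt ->
        st (xreg v) = nseq (rho v) Bz /\ rho v < if nth false vt v then p else q].

(** The registers left out, 13 to 15, hold the running sum. *)
Definition clean (st : store) : Prop := forall k, 5 <= k < 20 -> (k < 13) || (15 < k) -> st k = [::].

Definition wf_pair (vt : seq bool) (uv : nat * nat) : bool :=
  [&& uv.1 < size vt, nth false vt uv.1, uv.2 < size vt & ~~ nth false vt uv.2].

Definition Factor (uv : nat * nat) : cmd :=
  LoadEntry (xreg uv.1) (xreg uv.2) ;; Mul 11 9 ;; Mul 12 10 ;; Clear 9 ;; Clear 10.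

Definition sfrac (f : bool) (ln ld : seq sym) : rat :=
  ((-1) ^+ f * (bval ln)%:R / (bval ld)%:R)%R.

Definition term_regs (st : store) (f : bool) (ln ld : seq sym) : store :=
  upd (upd (upd st 8 (nseq f Bo)) 11 ln) 12 ld.

Definition factor_time C n :=
  load_time n + 2 * (1000 * (C * n.+1).+1 * (C * n.+1).+1) + 2 * (3 * n + 1).

Lemma rat_sfrac (a : rat) :
  a = ((-1) ^+ (a < 0)%R * `|numq a|%N%:R / `|denq a|%N%:R)%R.
Proof.
have Hd : (`|denq a|%N%:R = (denq a)%:~R :> rat)%R by rewrite -[in RHS]absz_denq.
rewrite Hd -[in LHS](divq_num_den a); congr (_ / _)%R.
rewrite {1}(intEsign (numq a)) rmorphM rmorphXn rmorphN rmorph1 numq_lt0 /=.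
by [].
Qed.

Lemma exec_factor vt uv C n ents p q rho st f ln ld : wf_pair vt uv -> 0 < C ->
  input_ok ents p q n -> loaded ents p q vt rho st -> clean st ->
  size ln <= C * n.+1 -> size ld <= C * n.+1 -> 0 < bval ld ->
  exists f' ln' ld', [/\ size ln' <= 3 * C * n.+1, size ld' <= 3 * C * n.+1, 0 < bval ld',
    sfrac f' ln' ld' = (sfrac f ln ld * entry_at ents q (rho uv.1) (rho uv.2))%R
    & exec (Factor uv) (term_regs st f ln ld) (term_regs st f' ln' ld') (factor_time C n)].
Proof.
case: uv => u v /and4P[/= ltu tu ltv tv] C0 [Hs len lep leq] [E1 E2 E3 Ei] Hc leln leld ld0.
have [Eu] := Ei u ltu; rewrite tu => ltu'.
have [Ev] := Ei v ltv; rewrite (negbTE tv) => ltv'.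
have gu : 19 < xreg u by rewrite /xreg; lia.
have gv : 19 < xreg v by rewrite /xreg; lia.
have lenC : n <= C * n.+1 by nia.
set st1 := term_regs st f ln ld.
have [] := @exec_load_entry ents (rho u) (rho v) p q n (xreg u) (xreg v) f st1 Hs ltu' ltv' len lep leq gu gv;
  try by rewrite /st1 /term_regs; regs.
  move=> k Hk nk8 Hk2; rewrite /st1 /term_regs !upd_diff //; try lia.
  by apply: Hc; lia.
move=> ne [de [Ene Ede sne sde H1]].
set a := nth _ _ _ in Ene Ede H1.
set st2 := upd _ 10 de in H1.
have [|||||||||ln' [Vn sn H2]] := @exec_mul 11 9 (C * n.+1) st2;
  rewrite ?/st2 ?/st1 ?/term_regs; try (by regs; rewrite ?Hc //; lia).
set st3 := upd _ 11 ln' in H2.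
have [|||||||||ld' [Vd sd H3]] := @exec_mul 12 10 (C * n.+1) st3;
  rewrite ?/st3 ?/st2 ?/st1 ?/term_regs; try (by regs; rewrite ?Hc //; lia).
move: Vn Vd; rewrite /st3 /st2 /st1 /term_regs; regs => Vn Vd.
exists (f (+) (a < 0)%R), ln', ld'; split; rewrite -?mulnA //.
- by rewrite Vd Ede muln_gt0 ld0 absz_gt0 denq_neq0.
- rewrite /sfrac Vn Vd Ene Ede !natrM signr_addb /entry_at -/a.
  rewrite [in RHS](rat_sfrac a); field.
  by rewrite !pnatr_eq0 -!lt0n ld0 absz_gt0 denq_neq0.
apply: exec_eq (exec_seq H1 (exec_seq H2 (exec_seq H3 (exec_seq (exec_clear _ _) (exec_clear _ _))))) _ _.
  by rewrite /st3 /st2 /st1 /term_regs; store_eq; rewrite Hc.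
rewrite (_ : upd _ 12 ld' 9 = ne); last by rewrite /st3 /st2 /st1 /term_regs; regs.
rewrite (_ : upd _ 9 [::] 10 = de); last by rewrite /st3 /st2 /st1 /term_regs; regs.
by rewrite /factor_time; move: (1000 * _ * _) (load_time n) => x y; lia.
Qed.

Lemma polyb_load : polyb load_time.
Proof. by rewrite /load_time; polyb_tac. Qed.

Lemma polyb_factor C : polyb (factor_time C).
Proof.
rewrite /factor_time; apply: polyb_add; last by polyb_tac.
by apply: polyb_add; [apply: polyb_load|polyb_tac].
Qed.

Definition Factors (m : seq (nat * nat)) : cmd := foldr (fun uv c => Factor uv ;; c) Skip m.

(** Each factor at most triples the lengths. Since [m] is fixed before the matrix, numerator and
    denominator stay linear in [n] without any reduction of fractions. *)
Lemma exec_factors vt m C : all (wf_pair vt) m -> 0 < C -> exists C' T, [/\ 0 < C', polyb T &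
  forall n ents p q rho st f ln ld,
  input_ok ents p q n -> loaded ents p q vt rho st -> clean st ->
  size ln <= C * n.+1 -> size ld <= C * n.+1 -> 0 < bval ld ->
  exists f' ln' ld', [/\ size ln' <= C' * n.+1, size ld' <= C' * n.+1, 0 < bval ld',
    sfrac f' ln' ld' =
      (sfrac f ln ld * \prod_(uv <- m) entry_at ents q (rho uv.1) (rho uv.2))%R
    & exec (Factors m) (term_regs st f ln ld) (term_regs st f' ln' ld') (T n)]].
Proof.
elim: m C => [|uv m IH] C /=.
  move=> _ C0; exists C, (fun=> 0); split=> //; first exact: polyb_const.
  move=> n ents p q rho st f ln ld _ _ _ sn sd d0; exists f, ln, ld; split=> //.
    by rewrite big_nil mulr1.
  exact: exec_skip.
case/andP=> Huv Hm C0; have [|C' [T [C'0 HT HF]]] := IH (3 * C) Hm; first by lia.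
exists C', (fun n => factor_time C n + T n); split=> //.
  by apply: polyb_add => //; apply: polyb_factor.
move=> n ents p q rho st f ln ld Hi Hl Hc sn sd d0.
have [f1 [ln1 [ld1 [sn1 sd1 d1 E1 H1]]]] := exec_factor f Huv C0 Hi Hl Hc sn sd d0.
have [f2 [ln2 [ld2 [sn2 sd2 d2 E2 H2]]]] := HF _ _ _ _ _ _ f1 _ _ Hi Hl Hc sn1 sd1 d1.
exists f2, ln2, ld2; split=> //; last by apply: exec_seq H1 H2.
by rewrite E2 E1 big_cons mulrA.
Qed.

(** Addition over the common denominator: a positive term is added to P and a negative one to N, so
    no subtraction is ever performed. *)
Definition AddTerm : cmd :=
  Mul 13 12 ;; Mul 14 12 ;; Mul 11 15 ;; If 8 None (AddTo 13 11) (AddTo 14 11) ;;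
  Mul 15 12 ;; Clear 8 ;; Clear 11 ;; Clear 12.

Definition acc_regs (st : store) (lp ln ld : seq sym) : store :=
  upd (upd (upd st 13 lp) 14 ln) 15 ld.

Definition dfrac (lp ln ld : seq sym) : rat :=
  (((bval lp)%:R - (bval ln)%:R) / (bval ld)%:R)%R.

Definition add_term_time B :=
  4 * (1000 * B.+1 * B.+1) + 100 * (3 * B).+1 + 12 * B + 10.

Lemma exec_add_term st B f ln ld ap an ad : clean st ->
  size ln <= B -> size ld <= B -> 0 < bval ld ->
  size ap <= B -> size an <= B -> size ad <= B -> 0 < bval ad ->
  exists ap' an' ad', [/\ size ap' <= 3 * B + 1, size an' <= 3 * B + 1, size ad' <= 3 * B + 1
    & [/\ 0 < bval ad', dfrac ap' an' ad' = (dfrac ap an ad + sfrac f ln ld)%R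
    & exec AddTerm (term_regs (acc_regs st ap an ad) f ln ld) (acc_regs st ap' an' ad')
         (add_term_time B)]].
Proof.
move=> Hc sn sd d0 sap san sad ad0.
pose S f ln ld ap an ad := term_regs (acc_regs st ap an ad) f ln ld.
have HS f' ln' ld' ap' an' ad' x : 15 < x < 20 -> S f' ln' ld' ap' an' ad' x = [::].
  by move=> Hx; rewrite /S /term_regs /acc_regs; regs; apply: Hc; lia.
have [Sx11 Sx12 [Sx13 Sx14 Sx15]] :
  [/\ forall f' ln' ld' ap' an' ad', S f' ln' ld' ap' an' ad' 11 = ln',
      forall f' ln' ld' ap' an' ad', S f' ln' ld' ap' an' ad' 12 = ld'
    & [/\ forall f' ln' ld' ap' an' ad', S f' ln' ld' ap' an' ad' 13 = ap',
      forall f' ln' ld' ap' an' ad', S f' ln' ld' ap' an' ad' 14 = an'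
    & forall f' ln' ld' ap' an' ad', S f' ln' ld' ap' an' ad' 15 = ad']] by [].
have [|||||||||p1 [Vp sp H1]] := @exec_mul 13 12 B (S f ln ld ap an ad); rewrite ?Sx12 ?Sx13 ?HS //.
rewrite (_ : upd _ _ _ = S f ln ld p1 an ad) in H1; last first.
  by rewrite /S /term_regs /acc_regs; store_eq.
have [|||||||||n1 [Vn sn1 H2]] := @exec_mul 14 12 B (S f ln ld p1 an ad); rewrite ?Sx12 ?Sx14 ?HS //.
rewrite (_ : upd _ _ _ = S f ln ld p1 n1 ad) in H2; last first.
  by rewrite /S /term_regs /acc_regs; store_eq.
have [|||||||||m1 [Vm sm1 H3]] := @exec_mul 11 15 B (S f ln ld p1 n1 ad); rewrite ?Sx11 ?Sx15 ?HS //.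
rewrite (_ : upd _ _ _ = S f m1 ld p1 n1 ad) in H3; last first.
  by rewrite /S /term_regs /acc_regs; store_eq.
have [p2 [n2 [sp2 sn2 V2 H4]]] : exists p2 n2, [/\ size p2 <= 3 * B + 1, size n2 <= 3 * B + 1,
    ((bval p2)%:R - (bval n2)%:R = (bval p1)%:R - (bval n1)%:R + (-1) ^+ f * (bval m1)%:R :> rat)%R
    & exec (If 8 None (AddTo 13 11) (AddTo 14 11)) (S f m1 ld p1 n1 ad) (S f m1 ld p2 n2 ad)
       (100 * (3 * B).+1 + 2)].
  case: f {Vp Vn Vm H1 H2 H3} => /=.
    have [||||||||n2 [Vn2 sn2 H4]] := @exec_add 14 11 (3 * B) (S true m1 ld p1 n1 ad);
      rewrite ?Sx11 ?Sx14 ?HS //.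
    exists p1, n2; split; rewrite ?addn1 ?(leqW sp) //.
      by rewrite Vn2 Sx14 Sx11 natrD; ring.
    apply: exec_if; apply: exec_eq H4 _ _ => //.
    by rewrite /S /term_regs /acc_regs; store_eq.
  have [||||||||p2 [Vp2 sp2 H4]] := @exec_add 13 11 (3 * B) (S false m1 ld p1 n1 ad);
    rewrite ?Sx11 ?Sx13 ?HS //.
  exists p2, n1; split; rewrite ?addn1 ?(leqW sn1) //.
    by rewrite Vp2 Sx13 Sx11 natrD; ring.
  apply: exec_if; apply: exec_eq H4 _ _ => //.
  by rewrite /S /term_regs /acc_regs; store_eq.
have [|||||||||d1 [Vd sd1 H5]] := @exec_mul 15 12 B (S f m1 ld p2 n2 ad); rewrite ?Sx12 ?Sx15 ?HS //.
rewrite (_ : upd _ _ _ = S f m1 ld p2 n2 d1) in H5; last first.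
  by rewrite /S /term_regs /acc_regs; store_eq.
rewrite ?Sx11 ?Sx12 ?Sx13 ?Sx14 ?Sx15 in Vp Vn Vm Vd.
exists p2, n2, d1; split=> //; first by rewrite (leq_trans sd1) ?leq_addr.
split; first by rewrite Vd muln_gt0 ad0.
  rewrite /dfrac /sfrac V2 Vd Vp Vn Vm !natrM; field.
  by rewrite !pnatr_eq0 -!lt0n ad0 d0.
apply: exec_eq (exec_seq H1 (exec_seq H2 (exec_seq H3 (exec_seq H4 (exec_seq H5 (exec_seq (exec_clear _ _)
  (exec_seq (exec_clear _ _) (exec_clear _ _)))))))) _ _.
  by rewrite /S /term_regs /acc_regs; store_eq; rewrite Hc.
rewrite (_ : upd _ 11 [::] 12 = ld) // (_ : upd _ 8 [::] 11 = m1) //.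
rewrite (_ : S f m1 ld p2 n2 d1 8 = nseq f Bo) // size_nseq /add_term_time.
by move: (1000 * _ * _) => x; case: (f) => /=; lia.
Qed.

Definition Term (t : bool * seq (nat * nat)) : cmd :=
  (if t.1 then Push 8 Bo else Skip) ;; Push 11 Bo ;; Push 12 Bo ;; Factors t.2 ;; AddTerm.

Lemma exec_term vt (t : bool * seq (nat * nat)) C : all (wf_pair vt) t.2 -> 0 < C -> exists C' T, [/\ 0 < C', polyb T &
  forall n ents p q rho st ap an ad,
  input_ok ents p q n -> loaded ents p q vt rho st -> clean st ->
  size ap <= C * n.+1 -> size an <= C * n.+1 -> size ad <= C * n.+1 -> 0 < bval ad ->
  exists ap' an' ad', [/\ size ap' <= C' * n.+1, size an' <= C' * n.+1, size ad' <= C' * n.+1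
    & [/\ 0 < bval ad',
       dfrac ap' an' ad' = (dfrac ap an ad
         + (-1) ^+ t.1 * \prod_(uv <- t.2) entry_at ents q (rho uv.1) (rho uv.2))%R
    & exec (Term t) (acc_regs st ap an ad) (acc_regs st ap' an' ad') (T n)]]].
Proof.
case: t => b m /= Hm C0.
have [C1 [T1 [C10 HT1 H1]]] := exec_factors Hm (ltn0Sn 0).
exists (3 * (C + C1) + 1), (fun n => 3 + T1 n + add_term_time ((C + C1) * n.+1)).
split; first by lia.
  by rewrite /add_term_time; polyb_tac.
move=> n ents p q rho st ap an ad Hi Hl Hc sap san sad ad0.
pose st1 := acc_regs st ap an ad.
have Hl1 : loaded ents p q vt rho st1.
  by case: Hl => E1 E2 E3 Ei; split.
have Hc1 : clean st1.
  by move=> k Hk Hk2; rewrite /st1 /acc_regs; regs; apply: Hc.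
have [||//|f [ln [ld [sn sd d0 E1 HF]]]] := H1 _ _ _ _ _ _ b [:: Bo] [:: Bo] Hi Hl1 Hc1.
- by rewrite mul1n.
- by rewrite mul1n.
have [|||||||ap' [an' [ad' [s1 s2 s3 [d1 E2 HA]]]]] :=
  @exec_add_term st ((C + C1) * n.+1) f ln ld ap an ad Hc; try by [|rewrite mulnDl; lia].
have le3 : 3 * ((C + C1) * n.+1) + 1 <= (3 * (C + C1) + 1) * n.+1.
  by rewrite [in X in _ <= X]mulnDl -mulnA leq_add2l mul1n.
exists ap', an', ad'; split; rewrite ?(leq_trans _ le3) //; split=> //.
  by rewrite E2 E1 /sfrac /= divr1 mulr1.
have H0 : exec (if b then Push 8 Bo else Skip) st1 (upd st1 8 (nseq b Bo)) 1.
  case: b {E1 HF} => /=; last by apply: exec_eq (exec_skip _) _ _ => //; rewrite upd_id // Hc1.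
  by apply: exec_eq (exec_push _ _ _) _ _ => //; rewrite Hc1.
have H3 : exec (Push 11 Bo ;; Push 12 Bo ;; Factors m ;; AddTerm) (upd st1 8 (nseq b Bo))
   (acc_regs st ap' an' ad') (2 + T1 n + add_term_time ((C + C1) * n.+1)).
  apply: exec_weak (exec_seq (exec_push _ _ _) (exec_seq (exec_push _ _ _) (exec_seq _ HA))) _; last first.
    by rewrite -[in 2 + _]/(1 + 1) !addnA.
  rewrite (_ : upd _ _ _ = term_regs st1 b [:: Bo] [:: Bo]) //.
  by regs; rewrite !Hc1.
by apply: exec_weak (exec_seq H0 H3) _; rewrite !addnA.
Qed.

Definition Terms (P : poly_expr) : cmd := foldr (fun t c => Term t ;; c) Skip P.

Lemma exec_terms vt (P : poly_expr) C : all (fun t => all (wf_pair vt) t.2) P -> 0 < C ->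
  exists C' T, [/\ 0 < C', polyb T &
  forall n ents p q rho st ap an ad,
  input_ok ents p q n -> loaded ents p q vt rho st -> clean st ->
  size ap <= C * n.+1 -> size an <= C * n.+1 -> size ad <= C * n.+1 -> 0 < bval ad ->
  exists ap' an' ad', [/\ size ap' <= C' * n.+1, size an' <= C' * n.+1, size ad' <= C' * n.+1
    & [/\ 0 < bval ad',
       dfrac ap' an' ad' = (dfrac ap an ad + peval (entry_at ents q) rho P)%R
    & exec (Terms P) (acc_regs st ap an ad) (acc_regs st ap' an' ad') (T n)]]].
Proof.
elim: P C => [|t P IH] C /=.
  move=> _ C0; exists C, (fun=> 0); split=> //; first exact: polyb_const.
  move=> n ents p q rho st ap an ad _ _ _ s1 s2 s3 d0; exists ap, an, ad; split=> //.
  by split=> //; [rewrite /peval big_nil addr0|apply: exec_skip].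
case/andP=> Ht HP C0; have [C1 [T1 [C10 HT1 H1]]] := exec_term Ht C0.
have [C2 [T2 [C20 HT2 H2]]] := IH C1 HP C10.
exists C2, (fun n => T1 n + T2 n); split=> //; first exact: polyb_add.
move=> n ents p q rho st ap an ad Hi Hl Hc s1 s2 s3 d0.
have [ap1 [an1 [ad1 [t1 t2 t3 [d1 E1 X1]]]]] := H1 _ _ _ _ _ _ _ _ _ Hi Hl Hc s1 s2 s3 d0.
have [ap2 [an2 [ad2 [u1 u2 u3 [d2 E2 X2]]]]] := H2 _ _ _ _ _ _ _ _ _ Hi Hl Hc t1 t2 t3 d1.
exists ap2, an2, ad2; split=> //; split=> //; last by apply: exec_seq X1 X2.
by rewrite E2 E1 /peval big_cons addrA.
Qed.

(** Registers 13 and 14 empty and 15 equal to one represent the sum 0. The denominator stays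
    positive, so comparing P with N decides the sign. *)
Definition TestPos (P : poly_expr) : cmd := Push 15 Bo ;; Terms P ;; Greater ;; Clear 15.

Lemma exec_test_pos vt (P : poly_expr) : all (fun t => all (wf_pair vt) t.2) P -> exists2 T, polyb T &
  forall n ents p q rho st, input_ok ents p q n -> loaded ents p q vt rho st ->
  (forall k, 4 <= k < 20 -> st k = [::]) ->
  exec (TestPos P) st (upd st 4 (nseq (0 < peval (entry_at ents q) rho P)%R Bo)) (T n).
Proof.
move=> HP; have [C [T [C0 HT H]]] := exec_terms HP (ltn0Sn 0).
exists (fun n => T n + 53 * (C * n.+1).+1 + 2); first by polyb_tac.
move=> n ents p q rho st Hi Hl H0.
have Hc : clean st by move=> k Hk _; apply: H0; lia.
have [||||ap [an [ad [s1 s2 s3 [d0 E HX]]]]] := H _ _ _ _ _ _ [::] [::] [:: Bo] Hi Hl Hc;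
  rewrite ?mul1n //.
rewrite /dfrac /= divr1 subrr add0r in E.
have HG := @exec_greater (acc_regs st ap an ad) (C * n.+1).
rewrite [acc_regs _ _ _ _ 4](_ : _ = [::]) in HG; last by rewrite /acc_regs; regs; apply: H0.
have {}HG := HG erefl s1 s2.
have -> : (0 < peval (entry_at ents q) rho P)%R = (bval an < bval ap).
  by rewrite -E pmulr_lgt0 ?invr_gt0 ?ltr0n // subr_gt0 ltr_nat.
have H1 : exec (Push 15 Bo) st (acc_regs st [::] [::] [:: Bo]) 1.
  by apply: exec_eq (exec_push _ _ _) _ _ => //; rewrite /acc_regs; store_eq; rewrite H0.
apply: exec_eq (exec_seq H1 (exec_seq HX (exec_seq HG (exec_clear _ _)))) _ _.
  by rewrite /acc_regs; store_eq; rewrite H0.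
rewrite (_ : upd _ 4 _ 15 = ad) //.
by lia.
Qed.

(** * First-order formulas over the matrix *)

Inductive mxform :=
| FPos of poly_expr
| FNot of mxform
| FAnd of mxform & mxform
| FAll of bool & mxform.

(* [FAll true] ranges over rows and [FAll false] over columns; a quantifier at
   depth [d] binds the variable [d]. *)
Fixpoint sat (e : nat -> nat -> rat) (p q : nat) (rho : nat -> nat) (d : nat) (phi : mxform) : bool :=
  match phi with
  | FPos P => (0 < peval e rho P)%R
  | FNot f => ~~ sat e p q rho d f
  | FAnd f g => sat e p q rho d f && sat e p q rho d g
  | FAll b f => all (fun k => sat e p q (upd rho d k) d.+1 f) (iota 0 (if b then p else q))
  end.

Fixpoint wf (vt : seq bool) (phi : mxform) : bool :=
  match phi with
  | FPos P => all (fun t => all (wf_pair vt) t.2) P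
  | FNot f => wf vt f
  | FAnd f g => wf vt f && wf vt g
  | FAll b f => wf (rcons vt b) f
  end.

(** In a quantifier, once some value refutes the body, register [(xreg d).+2] is empty and the
    remaining rounds only count. *)
Fixpoint Check (d : nat) (phi : mxform) : cmd :=
  match phi with
  | FPos P => TestPos P
  | FNot f => Check d f ;; If 4 None (Push 4 Bo) (Pop 4)
  | FAnd f g => Check d f ;; If 4 None Skip (Pop 4 ;; Check d g)
  | FAll b f =>
      Push (xreg d).+2 Bo ;; Copy (if b then 2 else 3) (xreg d).+1 16 ;;
      Foreach (xreg d).+1 (fun=>
        If (xreg d).+2 None Skip (Check d.+1 f ;; If 4 None (Pop (xreg d).+2) (Pop 4)) ;;
        Push (xreg d) Bz) ;;
      Clear (xreg d) ;; Move (xreg d).+2 4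
  end.

Definition ready ents p q vt rho (st : store) : Prop :=
  [/\ loaded ents p q vt rho st, forall k, 4 <= k < 20 -> st k = [::]
    & forall k, xreg (size vt) <= k -> st k = [::]].

(** A quantifier multiplies the time by at most [n], up to linear terms. As [T] is chosen from [phi]
    alone, the number of such multiplications is fixed. *)
Lemma exec_check phi vt : wf vt phi -> exists2 T, polyb T &
  forall n ents p q rho st, input_ok ents p q n -> ready ents p q vt rho st ->
  exec (Check (size vt) phi) st
     (upd st 4 (nseq (sat (entry_at ents q) p q rho (size vt) phi) Bo)) (T n).
Proof.
elim: phi vt => [P|f IH|f IHf g IHg|b f IH] vt /=.
- move=> HP; have [T HT H] := exec_test_pos HP.
  by exists T => // n ents p q rho st Hi [Hl H0 _]; apply: (H _ _ _ _ _ _ Hi Hl H0).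
- move=> Hf; have [T HT H] := IH _ Hf; exists (fun n => T n + 3); first by polyb_tac.
  move=> n ents p q rho st Hi Hr; apply: exec_seq (H _ _ _ _ _ _ Hi Hr) _.
  apply: (@exec_if _ _ _ _ _ _ 1); rewrite upd_same; case: sat => /=.
    by apply: exec_eq (exec_pop _ _) _ _ => //; rewrite upd_same; store_eq.
  by apply: exec_eq (exec_push _ _ _) _ _ => //; rewrite upd_same; store_eq.
- case/andP=> Hf Hg; have [T1 HT1 H1] := IHf _ Hf; have [T2 HT2 H2] := IHg _ Hg.
  exists (fun n => T1 n + (T2 n + 1 + 2)); first by polyb_tac.
  move=> n ents p q rho st Hi Hr; apply: exec_seq (H1 _ _ _ _ _ _ Hi Hr) _.
  apply: exec_if; rewrite upd_same; case: (sat _ _ _ _ _ f) => /=; last first.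
    by apply: exec_weak (exec_skip _) _.
  have E4 : st 4 = [::] by case: Hr => _ -> .
  rewrite addnC; apply: exec_seq (H2 _ _ _ _ _ _ Hi Hr).
  by apply: exec_eq (exec_pop _ _) _ _ => //; store_eq; rewrite E4.
move=> Hf; have [T HT H] := IH _ Hf; rewrite size_rcons in H.
exists (fun n => n * (T n + 30) + 40 * n + 40); first by polyb_tac.
move=> n ents p q rho st Hi Hr.
set d := size vt in H *; set X := xreg d; set D := if b then p else q.
have leD : D <= n by case: Hi => _ _ lep leq; rewrite /D; case: (b).
case: (Hr) => [[E1 E2 E3 Ei] E0 Ee].
have gX : 20 <= X by rewrite /X /xreg; lia.
pose acc k := all (fun i => sat (entry_at ents q) p q (upd rho d i) d.+1 f) (iota 0 k).
pose S k l := upd (upd (upd st X (nseq k Bz)) X.+1 l) X.+2 (nseq (acc k) Bo).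
pose I l st1 := exists k, [/\ l = nseq (D - k) Bz, k <= D & st1 = S k l].
have EX : st X = [::] by apply: Ee.
have EX1 : st X.+1 = [::] by apply: Ee; rewrite -/X; lia.
have EX2 : st X.+2 = [::] by apply: Ee; rewrite -/X; lia.
set body := fun _ : sym => _.
have [l st1|s l st1||st1 [k [Ek lek ->]] HL] := @exec_foreach X.+1 body I (T n + 10) _ _ (nseq D Bz)
   (S 0 (nseq D Bz)).
- by case=> k [_ _ ->]; rewrite /S; regs.
- case=> k [El lek ->]; have ltk : k < D by case: (ltngtP k D) lek El => // ->; rewrite subnn.
  move: El; rewrite (_ : D - k = (D - k.+1).+1) /=; last by lia.
  case=> -> ->; exists (S k.+1 (nseq (D - k.+1) Bz)); last by exists k.+1.
  set l1 := nseq (D - k.+1) Bz; pose st2 := S k l1.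
  have -> : upd (S k (Bz :: l1)) X.+1 l1 = st2 by rewrite /st2 /S; store_eq.
  have accS : acc k.+1 = acc k && sat (entry_at ents q) p q (upd rho d k) d.+1 f.
    have Ek : iota 0 k.+1 = iota 0 k ++ [:: k] by rewrite -addn1 iotaD.
    by rewrite /acc Ek all_cat /= andbT.
  have HP : exec (Push X Bz) (upd st2 X.+2 (nseq (acc k.+1) Bo)) (S k.+1 l1) 1.
    by apply: exec_eq (exec_push _ _ _) _ _ => //; rewrite /st2 /S; store_eq; regs.
  rewrite (_ : T n + 10 = T n + 9 + 1); last by lia.
  apply: exec_seq HP; rewrite -[T n + 9]/(T n + (7 + 2)) addnA; apply: exec_if.
  have -> : st2 X.+2 = nseq (acc k) Bo by rewrite /st2 /S; regs.
  rewrite accS; case Ea: (acc k) => /=; last first.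
    apply: exec_eq (exec_skip _) _ _ => //; rewrite upd_id // /st2 /S; regs.
    by rewrite Ea.
  have Hr2 : ready ents p q (rcons vt b) (upd rho d k) st2.
    split; first split.
    + by rewrite /st2 /S; regs.
    + by rewrite /st2 /S; regs.
    + by rewrite /st2 /S; regs.
    + move=> v; rewrite size_rcons ltnS leq_eqVlt => /orP[/eqP ->|ltv].
        rewrite -/d upd_same nth_rcons ltnn eqxx; split=> //.
        by rewrite -/X /st2 /S; regs.
      rewrite nth_rcons ltv (upd_diff rho); last by rewrite ltn_eqF.
      have [Ev lt] := Ei _ ltv; split=> //; rewrite -Ev /st2 /S /X /xreg.
      by regs.
    + by move=> i Hk; rewrite /st2 /S; regs; apply: E0.
    + move=> i; rewrite size_rcons -/d => Hk; rewrite /st2 /S !upd_diff; try by rewrite /X /xreg in Hk *; lia.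
      by apply: Ee; rewrite /xreg in Hk *; lia.
  apply: exec_seq (exec_weak (H _ _ _ _ _ _ Hi Hr2) (leqnn _)) _.
  apply: (@exec_if _ _ _ _ _ _ 5); rewrite upd_same.
  case: (sat _ _ _ _ _ f) => /=.
    apply: exec_eq (exec_pop _ _) _ _ => //; rewrite upd_same /st2 /S Ea; store_eq.
    by rewrite E0.
  by apply: exec_eq (exec_pop _ _) _ _ => //; rewrite /st2 /S Ea; store_eq; regs; rewrite E0.
- by exists 0; rewrite subn0.
have {Ek} Ek : k = D by apply/eqP; move: (congr1 size Ek) lek; rewrite size_nseq /=; lia.
rewrite {}Ek {lek} in HL.
have ER : st (if b then 2 else 3) = nseq D Bz by rewrite /D; case: (b).
have H1 : exec (Push X.+2 Bo) st (upd st X.+2 [:: Bo]) 1.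
  by apply: exec_eq (exec_push _ _ _) _ _ => //; rewrite EX2.
have H2 : exec (Copy (if b then 2 else 3) X.+1 16) (upd st X.+2 [:: Bo]) (S 0 (nseq D Bz)) (25 * D + 2).
  apply: exec_eq (exec_copy _ _ _ _) _ _; try by case: (b); lia.
  - by regs; apply: E0.
  - rewrite (_ : upd _ _ _ (if b then 2 else 3) = nseq D Bz); last first.
      by rewrite -ER upd_diff //; case: (b); lia.
    by rewrite /S; store_eq; rewrite ?EX1 ?EX ?cats0.
  - rewrite (_ : upd _ _ _ (if b then 2 else 3) = nseq D Bz) ?size_nseq //.
    by rewrite -ER upd_diff //; case: (b); lia.
have n4 : X.+2 <> 4 by lia.
apply: exec_eq (exec_seq H1 (exec_seq H2 (exec_seq HL (exec_seq (exec_clear _ _) (exec_move _ n4))))) _ _.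
  by rewrite /S; store_eq; regs; rewrite ?E0 ?EX ?EX1 ?EX2 // catrevE rev_nseq cats0.
rewrite (_ : S D [::] X = nseq D Bz) ?size_nseq; last by rewrite /S; regs.
rewrite (_ : upd _ X [::] X.+2 = nseq (acc D) Bo) ?size_nseq; last by rewrite /S; regs.
have := leq_mul leD (leqnn (T n + 30)).
by case: (acc D) => /=; lia.
Qed.

(** * Reading the dimensions and deciding a formula *)

Definition Double (x : nat) : cmd := Move x 16 ;; Foreach 16 (fun=> Push x Bz ;; Push x Bz).

(** Horner's scheme on unary numbers. The time depends on the value and not only on its length, so
    it is polynomial only when the dimensions are bounded by the input length. *)
Definition ToUnary (x : nat) : cmd :=
  While 1 (Some Ha)
    (Case 1 (fun s => Pop 1 ;; Double x ;; if s.2 then Push x Bz else Skip) Skip) ;;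
  Pop 1.

Lemma leq_rbval l v : v <= rbval l v.
Proof. by elim: l v => //= s l IH v; apply: leq_trans (IH _); rewrite -addnn; lia. Qed.

Lemma exec_double x st v : 16 <> x -> st x = nseq v Bz -> st 16 = [::] ->
  exec (Double x) st (upd st x (nseq v.*2 Bz)) (25 * v + 2).
Proof.
move=> nx Ex E16.
pose I l st1 := exists k, [/\ l = nseq (v - k) Bz, k <= v & st1 = upd (upd st 16 l) x (nseq k.*2 Bz)].
have [l st1|s l st1||st1 [k [Ek lek ->]] HL] :=
  @exec_foreach 16 (fun=> Push x Bz ;; Push x Bz) I 2 _ _ (nseq v Bz) (upd (upd st 16 (nseq v Bz)) x [::]).
- by case=> k [_ _ ->]; regs.
- case=> k [El lek ->]; have ltk : k < v by case: (ltngtP k v) lek El => // ->; rewrite subnn.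
  move: El; rewrite (_ : v - k = (v - k.+1).+1) /=; last by lia.
  case=> -> ->; eexists; first by apply: exec_seq (exec_push _ _ _) (exec_push _ _ _).
  by exists k.+1; split=> //; store_eq; regs.
- by exists 0; rewrite subn0.
have {Ek} Ek : k = v by apply/eqP; move: (congr1 size Ek) lek; rewrite size_nseq /=; lia.
rewrite {}Ek {lek} in HL.
have nx' : x <> 16 by lia.
apply: exec_eq (exec_seq (exec_eq (exec_move st nx') _ (leqnn _)) HL) _ _.
- by store_eq; rewrite E16 Ex catrevE rev_nseq cats0.
- by store_eq.
- by rewrite Ex size_nseq; lia.
Qed.

Lemma exec_to_unary x st l l' B v : x <> 1 -> 16 <> x -> Ha \notin l -> st 1 = l ++ Ha :: l' ->
  st x = nseq v Bz -> st 16 = [::] -> rbval l v <= B ->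
  exec (ToUnary x) st (upd (upd st 1 l') x (nseq (rbval l v) Bz)) (size l * (25 * B + 20) + 2).
Proof.
move=> nx1 nx16 Hl E1 Ex E16 leB.
rewrite /ToUnary; set c := Case _ _ _.
have {leB Ex E16 Hl E1} H : exec (While 1 (Some Ha) c) st
    (upd (upd st 1 (Ha :: l')) x (nseq (rbval l v) Bz)) (size l * (25 * B + 20) + 1).
  elim: l v st Hl E1 Ex E16 leB => [|s l IH] v st Hl E1 Ex E16 /= leB.
    by apply: exec_eq (exec_done _ _) _ _; rewrite ?E1 //; store_eq.
  rewrite inE negb_or in Hl; case/andP: Hl => ns Hl.
  pose st1 := upd (upd st 1 (l ++ Ha :: l')) x (nseq (s.2 + v.*2) Bz).
  have [A1 A2 A3] : [/\ st1 1 = l ++ Ha :: l', st1 x = nseq (s.2 + v.*2) Bz & st1 16 = [::]].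
    by rewrite /st1; split; regs.
  have lev : v <= B.
    apply: leq_trans leB; apply: leq_trans (leq_rbval l _).
    by rewrite -addnn; lia.
  apply: exec_eq (exec_loop (t1 := 25 * B + 18) _ _ (IH _ _ Hl A1 A2 A3 leB)) _ _.
  - by rewrite E1 => -[Es]; rewrite Es eqxx in ns.
  - rewrite (_ : 25 * B + 18 = 25 * B + 10 + 8); last by lia.
    apply: exec_case; rewrite E1.
    have Hp : exec (Pop 1) st (upd st 1 (l ++ Ha :: l')) 1.
      by apply: exec_eq (exec_pop _ _) _ _ => //; rewrite E1.
    have D : exec (Double x) (upd st 1 (l ++ Ha :: l'))
        (upd (upd st 1 (l ++ Ha :: l')) x (nseq v.*2 Bz)) (25 * v + 2).
      by apply: exec_double => //; regs.
    have HL : exec (if s.2 then Push x Bz else Skip)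
       (upd (upd st 1 (l ++ Ha :: l')) x (nseq v.*2 Bz)) st1 1.
      rewrite /st1; case: (s.2) => /=.
        by apply: exec_eq (exec_push _ _ _) _ _ => //; store_eq; regs.
      by apply: exec_weak (exec_skip _) _.
    by apply: exec_weak (exec_seq Hp (exec_seq D HL)) _; lia.
  - by rewrite /st1; store_eq.
  - by rewrite (mulSn (size l)); lia.
apply: exec_eq (exec_seq H (exec_pop _ _)) _ _; last by lia.
by store_eq; regs.
Qed.

(** The first input symbol lies next to the marker, at the bottom of register 0; the move to
    register 1 brings it to the top. *)
Definition Decide (phi : mxform) : cmd := Move 0 1 ;; ToUnary 2 ;; ToUnary 3 ;; Check 0 phi.

Lemma exec_decide phi : wf [::] phi -> exists2 T, polyb T &
  forall n ents p q, input_ok ents p q n ->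
  size (nbits p ++ Ha :: nbits q ++ Ha :: ratstrs ents) <= n ->
  exists2 st, st 4 = nseq (sat (entry_at ents q) p q (fun=> 0) 0 phi) Bo
  & exec (Decide phi) (upd (fun=> [::]) 0 (rev (nbits p ++ Ha :: nbits q ++ Ha :: ratstrs ents)))
     st (T n).
Proof.
move=> Hw; have [T HT H] := exec_check Hw.
exists (fun n => 12 * n + 1 + (n * (25 * n + 20) + 2) + (n * (25 * n + 20) + 2) + T n).
  by polyb_tac.
move=> n ents p q Hi; set w := _ ++ _ => lew.
pose S l1 l2 l3 : store := upd (upd (upd (fun=> [::]) 1 l1) 2 l2) 3 l3.
case: (Hi) => _ len lep leq.
have H1 : exec (Move 0 1) (upd (fun=> [::]) 0 (rev w)) (S w [::] [::]) (12 * n + 1).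
  apply: exec_eq (exec_move _ _) _ _ => //; last by rewrite upd_same size_rev; lia.
  by rewrite /S; store_eq; regs; rewrite catrevE revK cats0.
have szp : size (nbits p) <= n by apply: leq_trans lew; rewrite size_cat leq_addr.
have szq : size (nbits q) <= n.
  by apply: leq_trans lew; rewrite !size_cat /= size_cat; lia.
have H2 : exec (ToUnary 2) (S w [::] [::]) (S (nbits q ++ Ha :: ratstrs ents) (nseq p Bz) [::])
    (n * (25 * n + 20) + 2).
  apply: exec_eq (@exec_to_unary 2 _ (nbits p) _ n 0 _ _ (Ha_nbits p) _ _ _ _) _ _ => //.
  - by rewrite rbval_nbits.
  - by rewrite rbval_nbits /S; store_eq.
  - by rewrite leq_add2r leq_mul2r szp orbT.
have H3 : exec (ToUnary 3) (S (nbits q ++ Ha :: ratstrs ents) (nseq p Bz) [::])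
    (S (ratstrs ents) (nseq p Bz) (nseq q Bz)) (n * (25 * n + 20) + 2).
  apply: exec_eq (@exec_to_unary 3 _ (nbits q) _ n 0 _ _ (Ha_nbits q) _ _ _ _) _ _ => //.
  - by rewrite rbval_nbits.
  - by rewrite rbval_nbits /S; store_eq.
  - by rewrite leq_add2r leq_mul2r szq orbT.
have Hr : ready ents p q [::] (fun=> 0) (S (ratstrs ents) (nseq p Bz) (nseq q Bz)).
  by split=> [|k Hk|k Hk]; rewrite /S; [split|regs|regs; rewrite /xreg in Hk; regs].
eexists; last by apply: exec_weak (exec_seq H1 (exec_seq H2 (exec_seq H3 (H _ _ _ _ _ _ Hi Hr)))) _;
  rewrite !addnA.
by rewrite upd_same.
Qed.

Definition entries (p q : nat) (A : 'M[rat]_(p, q)) : seq rat :=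
  [seq A i j | i <- enum 'I_p, j <- enum 'I_q].

Lemma encode_mxE p q (A : 'M[rat]_(p, q)) : encode_mx A =
  map code (nbits p ++ Ha :: nbits q ++ Ha :: ratstrs (entries A)).
Proof.
have -> : nbits p ++ Ha :: nbits q ++ Ha :: ratstrs (entries A) = map decode (encode_mx A).
  rewrite /encode_mx !map_cat /= !map_cat /= map_flatten /ratstrs /entries.
  by rewrite !map_allpairs.
rewrite code_decode //.
have bits_ok n : all (fun x => 0 < x < 5) (nat_bits n).
  by apply: sub_all (nat_bits_ok n) => x /orP[] /eqP ->.
have int_ok z : all (fun x => 0 < x < 5) (int_bits z).
  by case: z => n /=; rewrite bits_ok.
rewrite /encode_mx !all_cat /= !all_cat /= !bits_ok /=.
apply/allP => x /flattenP[l /allpairsP[[i j] [_ _ ->]]] /=.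
suff /allP : all (fun x => 0 < x < 5) (rat_bits (A i j) ++ [:: 4]) by apply.
by rewrite /rat_bits !all_cat /= !int_ok.
Qed.

Lemma nth_allpairs (T1 T2 T3 : Type) (f : T1 -> T2 -> T3) x1 x2 x3 s t i j :
  i < size s -> j < size t ->
  nth x3 [seq f x y | x <- s, y <- t] (i * size t + j) = f (nth x1 s i) (nth x2 t j).
Proof.
elim: s i => [|x s IH] [|i] //= lti ltj; rewrite nth_cat size_map.
  by rewrite ltj (nth_map x2).
by rewrite mulSn -addnA ltnNge leq_addr /= addKn IH.
Qed.

Lemma entry_at_entries p q (A : 'M[rat]_(p, q)) (i : 'I_p) (j : 'I_q) :
  entry_at (entries A) q i j = A i j.
Proof.
have := @nth_allpairs _ _ _ (fun i j => A i j) i j 0%R (enum 'I_p) (enum 'I_q) i j.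
by rewrite !size_enum_ord !nth_ord_enum; apply.
Qed.

Lemma size_ratstrs_ge (l : seq rat) : size l <= size (ratstrs l).
Proof.
elim: l => //= a l IH; rewrite /ratstrs /= size_cat -add1n leq_add //.
by rewrite ratstrE size_cat addnC.
Qed.

(** Positive dimensions satisfy p, q <= p q, and each of the p q entries occupies at least one
    symbol; this bounds the unary counters by the input length. *)
Theorem form_decidable (Dom : forall p q, 'M[rat]_(p, q) -> Prop) phi :
  (forall p q (A : 'M[rat]_(p, q)), Dom p q A -> 0 < p /\ 0 < q) -> wf [::] phi ->
  poly_time_decidable Dom (fun p q A => sat (entry_at (entries A) q) p q (fun=> 0) 0 phi).
Proof.
move=> HD Hw; have [T HT H] := exec_decide Hw.
have [k Hk] : polyb (fun n => (T n + 1) * (2 * (n + T n + 1) + 6) + 3) by polyb_tac.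
exists (cmd_tm (Decide phi)), k => p q A /HD[p0 q0].
set n := size (encode_mx A); set w := nbits p ++ Ha :: nbits q ++ Ha :: ratstrs (entries A).
have En : n = size w by rewrite /n encode_mxE size_map.
have szE : size (entries A) = p * q by rewrite size_allpairs !size_enum_ord.
have szn : size (ratstrs (entries A)) <= n.
  by rewrite En /w !size_cat /= !size_cat /=; lia.
have Hi : input_ok (entries A) p q n.
  have := size_ratstrs_ge (entries A); rewrite szE => le1.
  split=> //; apply: leq_trans szn; apply: leq_trans le1.
    by rewrite leq_pmulr.
  by rewrite leq_pmull.
have [st E4 Hex] := H n _ p q Hi (eq_leq (esym En)).
have [|cf Hr Hc] := @cmd_tm_run _ w st (T n) _ (k * n.+1 ^ k) Hex erefl.
  by rewrite -En.
exists cf; split; first by rewrite encode_mxE.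
rewrite E4 in Hc; split=> [Ec|Hs].
  by move: Hc; rewrite Ec eqxx; case: sat.
by apply/eqP; rewrite Hc Hs.
Qed.

Local Open Scope ring_scope.

(** * The minor criterion *)

Section MinorCriterion.
Variables (F : realFieldType) (p q r : nat) (M : 'M[F]_(p, q)).

Definition minor_row (I : 'I_(r + 1) -> 'I_p) (T : 'I_r -> 'I_q) : 'rV[F]_q :=
  \row_j \det (row_mx (mxsub I T M) (mxsub I (fun _ : 'I_1 => j) M)).

(** Repeated or dependent indices give the zero vector and impose nothing. Both signs occur because
    the order of the rows in [I] decides the orientation. *)
Definition minor_cond : Prop :=
  forall (I : 'I_(r + 1) -> 'I_p) (T : 'I_r -> 'I_q), minor_row I T != 0 ->
  (forall j, 0 <= minor_row I T 0 j) \/ (forall j, minor_row I T 0 j <= 0) ->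
  exists2 i, (forall b, M i (T b) = 0) & row i M != 0.

(** Laplace expansion along the last column, whose cofactors do not depend on [j]. *)
Lemma minor_rowE I T : exists c : 'rV[F]_(r + 1), minor_row I T = c *m rowsub I M.
Proof.
(* The 0 fills the place of the last column, which these cofactors delete. *)
exists (\row_a cofactor (row_mx (mxsub I T M) 0) a (rshift r ord0)).
apply/rowP => j; rewrite !mxE (expand_det_col _ (rshift r ord0)).
apply: eq_bigr => a _; rewrite row_mxEr !mxE mulrC; congr (_ * _).
rewrite /cofactor; congr (_ * \det _); apply/matrixP => x y; rewrite !mxE.
case: (splitP _) => // k Ek; have /eqP[] := neq_lift (rshift r (ord0 : 'I_1)) y.
by apply: val_inj; move: Ek => /= ->; rewrite [k]ord1.
Qed.

Lemma minor_row_eq0 I T b : minor_row I T 0 (T b) = 0.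
Proof.
rewrite mxE -det_tr.
have nbr : lshift 1 b != rshift r ord0 by rewrite eq_lrshift.
apply: (determinant_alternate nbr) => a.
by rewrite [in LHS]mxE [in RHS]mxE row_mxEl row_mxEr !mxE.
Qed.

Hypothesis M_ge0 : forall i j, 0 <= M i j.

(** Write z as a nonnegative combination of rows. A row with nonzero coefficient that is nonzero at
    some column where z is also vanishes on [T], because there a sum of nonnegative terms is 0. *)
Lemma minor_cond_of_cone :
  (forall x : 'rV[F]_p, (forall j, 0 <= (x *m M) 0 j) ->
     exists2 y : 'rV[F]_p, (forall i, 0 <= y 0 i) & x *m M = y *m M) ->
  minor_cond.
Proof.
move=> HR I T; set z := minor_row I T => zn0 Hz.
have [c Ec] := minor_rowE I T; rewrite -/z in Ec.
have [x Ex] : exists x, z = x *m M.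
  exists (c *m rowsub I 1%:M); rewrite Ec -mulmxA; congr (_ *m _).
  by rewrite mul_rowsub_mx mul1mx.
(* If z is nonpositive it is replaced by its negative, which has the same zeros and lies in the same
   row space. *)
wlog Hz0 : c x z zn0 Ec Ex {Hz} / (forall j, 0 <= z 0 j) /\ (forall b, z 0 (T b) = 0).
  move=> H; have zT b : z 0 (T b) = 0 by apply: minor_row_eq0.
  case: Hz => Hz; first by apply: (H c x z).
  apply: (H (- c) (- x) (- z)); rewrite ?oppr_eq0 // ?Ec ?mulNmx // -?Ec ?Ex ?mulNmx // -?Ex.
  by split=> [j|b]; rewrite mxE ?oppr_ge0 // zT oppr0.
case: Hz0 => zge zT.
have [|y yge Ey] := HR x; first by rewrite -Ex.
have zE j : z 0 j = \sum_i y 0 i * M i j by rewrite Ex Ey mxE.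
have [j zj] : exists j, z 0 j != 0.
  by apply/rV0Pn.
have /existsP[i /andP[yi Mi0]] : [exists i, (y 0 i != 0) && (M i j != 0)].
  apply: contraR zj; rewrite negb_exists => /forallP Hi.
  rewrite zE big1 // => i _; move: (Hi i); rewrite negb_and !negbK.
  by case/orP => /eqP ->; rewrite ?mul0r ?mulr0.
exists i; last by apply: contraNneq Mi0 => /rowP/(_ j); rewrite !mxE => ->.
move=> b; have := zT b; rewrite zE => /eqP; rewrite psumr_eq0 => [|k _]; last first.
  by rewrite mulr_ge0.
by move/allP/(_ i (mem_index_enum _)); rewrite /= mulf_eq0 (negbTE yi) => /eqP.
Qed.

Hypothesis rankM : \rank M = (r + 1)%N.
Hypothesis HM : minor_cond.

(** Keeps the columns where z vanishes, the inequalities active at z. For z in the cone,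
    [kermx (zeroed z) *m M] is the linear span of the smallest face containing z. *)
Definition zeroed (z : 'rV[F]_q) : 'M[F]_(p, q) :=
  \matrix_(i, j) if z 0 j == 0 then M i j else 0.

Lemma exists_rowsub_free m n (A : 'M[F]_(m, n)) k : \rank A = k ->
  exists f : 'I_k -> 'I_m, row_free (rowsub f A) /\ (A <= rowsub f A)%MS.
Proof.
move=> <-; exists (maxrankfun A); split; first exact: maxrowsub_free.
by rewrite (eq_maxrowsub A).
Qed.

Lemma mul_zeroed (z : 'rV[F]_q) (x : 'rV[F]_p) j : z 0 j = 0 -> (x *m M) 0 j = (x *m zeroed z) 0 j.
Proof. by move=> zj; rewrite !mxE; apply: eq_bigr => i _; rewrite !mxE zj eqxx. Qed.

Lemma zeroedE z : zeroed z = M *m diag_mx (\row_j (z 0 j == 0)%:R).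
Proof.
apply/matrixP => i j; rewrite mul_mx_diag !mxE.
by case: eqP => _; rewrite ?mulr1 ?mulr0.
Qed.

(** Rank-nullity inside the row space of [M]: the kernel of [M] lies in that of [zeroed z], so both
    dimensions can be counted modulo it. *)
Lemma rank_faces z : (\rank (kermx (zeroed z) *m M) + \rank (zeroed z) = r + 1)%N.
Proof.
have := mxrank_mul_ker (kermx (zeroed z)) M.
have -> : \rank (kermx (zeroed z) :&: kermx M)%MS = \rank (kermx M).
  apply/eqP; rewrite eqn_leq !mxrankS ?capmxSr // sub_capmx submx_refl andbT.
  by apply/sub_kermxP; rewrite zeroedE mulmxA mulmx_ker mul0mx.
rewrite !mxrank_ker rankM; have := rank_leq_row (zeroed z); have := rank_leq_row M.
by rewrite rankM; lia.
Qed.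

(** Here the face of z is a ray. Then r independent active columns [T], a column [j0] with z nonzero
    and suitable rows [I] give a nonzero minor vector proportional to z, and the row supplied by
    [HM] is a positive multiple of z. *)
Lemma extreme_in_cone (x : 'rV[F]_p) : let z := x *m M in
  (forall j, 0 <= z 0 j) -> z != 0 -> (kermx (zeroed z) *m M <= z)%MS ->
  exists2 y : 'rV[F]_p, (forall i, 0 <= y 0 i) & z = y *m M.
Proof.
move=> z zge zn0 Hker; set N := zeroed z in Hker.
have xN : x *m N = 0.
  apply/rowP => j; rewrite [RHS]mxE; have [zj|zj] := eqVneq (z 0 j) 0.
    by rewrite -mul_zeroed.
  by rewrite mxE big1 // => i _; rewrite [N _ _]mxE (negbTE zj) mulr0.
have in_ker (y : 'rV[F]_p) : y *m N = 0 -> exists a, y *m M = a *: z.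
  move=> yN; apply/sub_rVP; apply: submx_trans Hker; apply: submxMr.
  exact/sub_kermxP.
have rankN : \rank N^T = r.
  rewrite mxrank_tr; have := rank_faces z; rewrite -/N.
  have : (\rank (kermx N *m M) <= 1)%N by apply: leq_trans (mxrankS Hker) (rank_leq_row _).
  have : (0 < \rank (kermx N *m M))%N.
    rewrite lt0n mxrank_eq0; apply: contraNneq zn0 => E.
    have : (z <= kermx N *m M)%MS by apply: submxMr; apply/sub_kermxP.
    by rewrite E => /submx0null ->.
  by lia.
have [T [Tfree TN]] := exists_rowsub_free rankN.
(* Members of a free family are nonzero, whereas the columns of [N] at which z is nonzero have been
   set to 0. *)
have TZ b : z 0 (T b) = 0.
  apply/eqP; apply: contraTT Tfree => zb; apply/negP => /row_free_inj Tinj.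
  have /(Tinj 1%N)/matrixP/(_ 0 b)/eqP :
      delta_mx 0 b *m rowsub T N^T = (0 : 'rV_r) *m rowsub T N^T.
    by rewrite -rowE mul0mx; apply/rowP => i; rewrite 3!mxE [N _ _]mxE (negbTE zb) mxE.
  by rewrite !mxE !eqxx oner_eq0.
(* The columns in [T] span those of [N], so a vector of the row space vanishing on [T] vanishes
   wherever z does and is a multiple of z by [in_ker]. *)
have in_kerT (y : 'rV[F]_p) : (forall b, (y *m M) 0 (T b) = 0) -> y *m N = 0.
  move=> yT; have [W EW] := submxP TN.
  have -> : N = (rowsub T N^T)^T *m W^T by rewrite -trmx_mul -EW trmxK.
  rewrite mulmxA; suff -> : y *m (rowsub T N^T)^T = 0 by rewrite mul0mx.
  apply/rowP => b; rewrite [RHS]mxE -[RHS](yT b) (mul_zeroed _ (TZ b)) !mxE.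
  by apply: eq_bigr => i _; rewrite !mxE.
have [j0 zj0] : exists j, z 0 j != 0 by apply/rV0Pn.
pose C : 'M[F]_(p, r + 1) := row_mx (colsub T M) (colsub (fun _ : 'I_1 => j0) M).
have TM : rowsub T M^T = rowsub T N^T.
  by apply/matrixP => b i; rewrite 4!mxE [N _ _]mxE TZ eqxx.
have Cfull : row_full C.
  rewrite /row_full -mxrank_tr -[_ == _]/(row_free _); apply: inj_row_free => v.
  rewrite tr_row_mx -[v]hsubmxK mul_row_col => Hv.
  have v20 : rsubmx v = 0.
    (* Pairing a linear relation between the columns with [x] kills those in [T] and leaves the last
       coefficient times the nonzero entry of z at [j0]. *)
    have : (lsubmx v *m (colsub T M)^T + rsubmx v *m (colsub (fun=> j0) M)^T) *m x^T = 0.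
      by rewrite Hv mul0mx.
    rewrite mulmxDl -!mulmxA -!trmx_mul !mulmx_colsub -/z.
    rewrite (_ : colsub T z = 0) ?trmx0 ?mulmx0 ?add0r => [/rowP/(_ 0)|]; last first.
      by apply/rowP => b; rewrite mxE TZ mxE.
    rewrite !mxE big_ord1 [(colsub _ _)^T _ _]mxE [colsub _ _ _ _]mxE => /eqP.
    rewrite mulf_eq0 (negbTE zj0) orbF => /eqP E.
    by apply/rowP => k; rewrite [k]ord1 E mxE.
  move: Hv; rewrite v20 mul0mx addr0 (_ : (colsub T M)^T = rowsub T N^T); last first.
    by rewrite -TM; apply/matrixP => b i; rewrite !mxE.
  move=> Hv; suff -> : lsubmx v = 0 by rewrite row_mx0.
  by apply: (row_free_inj Tfree); rewrite /= Hv mul0mx.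
have [I Ifull] : exists I : 'I_(r + 1) -> 'I_p, row_full (rowsub I C).
  by exists (fullrankfun Cfull); apply: fullrowsub_full.
have yj0 : minor_row I T 0 j0 != 0.
  rewrite mxE (_ : row_mx _ _ = rowsub I C); last first.
    apply/matrixP => a b; rewrite !mxE; case: splitP => k _; rewrite !mxE //.
  by rewrite -unitfE -unitmxE -row_full_unit.
have [c Ec] := minor_rowE I T.
have [x' Ex'] : exists x', minor_row I T = x' *m M.
  exists (c *m rowsub I 1%:M); rewrite Ec -mulmxA; congr (_ *m _).
  by rewrite mul_rowsub_mx mul1mx.
have [a Ea] : exists a, minor_row I T = a *: z.
  rewrite Ex'; apply/in_ker/in_kerT => b; rewrite -Ex'; exact: minor_row_eq0.
have [||i MiT Mi0] := HM (I := I) (T := T).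
- by apply: contraNneq yj0 => ->; rewrite mxE.
- have [a0|a0] := leP 0 a; [left|right] => j; rewrite Ea mxE.
    by rewrite mulr_ge0.
  by rewrite mulr_le0_ge0 // ltW.
have [b Eb] : exists b, row i M = b *: z.
  rewrite rowE; apply/in_ker/in_kerT => b; rewrite -rowE mxE; exact: MiT.
have b0 : 0 < b.
  rewrite lt_def; apply/andP; split.
    by apply: contraNneq Mi0 => b0; rewrite Eb b0 scale0r.
  have /rowP/(_ j0) := Eb; rewrite [row _ _ _ _]mxE [(b *: z) _ _]mxE => Ej.
  have := M_ge0 i j0; rewrite Ej pmulr_lge0 // lt_def zj0; exact: zge.
exists (b^-1 *: delta_mx 0 i).
  by move=> k; rewrite !mxE mulr_ge0 ?invr_ge0 ?ler0n // ltW.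
by rewrite -scalemxAl -rowE Eb scalerA mulVf ?scale1r // gt_eqF.
Qed.

(* Decomposition into extreme rays, by induction on the support of z: if u lies
   in the face of z but is not a multiple of z, then v = u - s z and
   w = z - t v, for the least ratios s and t, are in the cone and have smaller
   supports, and z = w + t v. *)
Lemma cone_of_minor_cond (x : 'rV[F]_p) : (forall j, 0 <= (x *m M) 0 j) ->
  exists2 y : 'rV[F]_p, (forall i, 0 <= y 0 i) & x *m M = y *m M.
Proof.
move En: #|[pred j | (x *m M) 0 j != 0]| => n.
elim/ltn_ind: n x En => n IH x En zge; set z := x *m M in En zge *.
have [z0|zn0] := eqVneq z 0.
  by exists 0; rewrite ?mul0mx // => i; rewrite mxE.
have [Hker|Hker] := boolP (kermx (zeroed z) *m M <= z)%MS; first exact: extreme_in_cone.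
have [j0 zj0] : exists j, z 0 j != 0 by apply/rV0Pn.
have zpos j : z 0 j != 0 -> 0 < z 0 j by rewrite lt_def zge andbT.
have [k Hk] := row_subPn Hker.
set u := row k _ in Hk.
have [xu Eu] : exists xu, u = xu *m M by exists (row k (kermx (zeroed z))); rewrite -row_mul.
have uZ j : z 0 j = 0 -> u 0 j = 0.
  move=> zj; by rewrite /u row_mul (mul_zeroed _ zj) -row_mul mulmx_ker !mxE.
case: (@arg_minP _ _ _ j0 [pred j | z 0 j != 0] (fun j => u 0 j / z 0 j) zj0) => j1 zj1 Hj1.
pose s := u 0 j1 / z 0 j1; pose xv := xu - s *: x.
have vE j : (xv *m M) 0 j = u 0 j - s * z 0 j.
  by rewrite mulmxBl -scalemxAl -Eu -/z !mxE.
have vge j : 0 <= (xv *m M) 0 j.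
  rewrite vE subr_ge0; have [zj|zj] := eqVneq (z 0 j) 0; first by rewrite uZ // zj mulr0.
  by rewrite -ler_pdivlMr ?zpos //; apply: Hj1.
have vZ j : z 0 j = 0 -> (xv *m M) 0 j = 0 by move=> zj; rewrite vE uZ // zj mulr0 subr0.
have vj1 : (xv *m M) 0 j1 = 0 by rewrite vE /s divfK ?subrr.
have [j2 vj2] : exists j, (xv *m M) 0 j != 0.
  apply/rV0Pn; apply: contraNneq Hk => v0; apply/sub_rVP; exists s.
  by apply/rowP => j; have /rowP/(_ j) := v0; rewrite vE !mxE => /eqP; rewrite subr_eq0 => /eqP.
have vpos j : (xv *m M) 0 j != 0 -> 0 < (xv *m M) 0 j by rewrite lt_def vge andbT.
case: (@arg_minP _ _ _ j2 [pred j | (xv *m M) 0 j != 0]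
   (fun j => z 0 j / (xv *m M) 0 j) vj2) => j3 vj3 Hj3.
pose t := z 0 j3 / (xv *m M) 0 j3; pose xw := x - t *: xv.
have wE j : (xw *m M) 0 j = z 0 j - t * (xv *m M) 0 j.
  by rewrite mulmxBl -scalemxAl -/z !mxE.
have t0 : 0 <= t by rewrite divr_ge0.
have wge j : 0 <= (xw *m M) 0 j.
  rewrite wE subr_ge0; have [vj|vj] := eqVneq ((xv *m M) 0 j) 0; first by rewrite vj mulr0.
  by rewrite -ler_pdivlMr ?vpos //; apply: Hj3.
have wj3 : (xw *m M) 0 j3 = 0 by rewrite wE /t divfK ?subrr.
(* v vanishes wherever z does, so the column that w loses does belong to the support of z. *)
have zj3 : z 0 j3 != 0 by apply: contraNneq vj3 => /vZ ->.
have smaller (x1 : 'rV[F]_p) (j : 'I_q) : z 0 j != 0 -> (x1 *m M) 0 j = 0 ->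
    (forall j : 'I_q, z 0 j = 0 -> (x1 *m M) 0 j = 0) -> (#|[pred j : 'I_q | (x1 *m M) 0%R j != 0%R]| < n)%N.
  move=> zj xj Hx; rewrite -En; apply: proper_card; apply/properP; split.
    by apply/subsetP => i; rewrite !inE; apply: contraNneq => /Hx ->.
  by exists j; rewrite !inE ?xj ?eqxx.
have [yv yvge Ev] := IH _ (smaller xv j1 zj1 vj1 vZ) _ erefl vge.
have [|yw ywge Ew] := IH _ (smaller xw j3 zj3 wj3 _) _ erefl wge.
  by move=> j zj; rewrite wE zj vZ // mulr0 subr0.
exists (yw + t *: yv).
  by move=> i; rewrite !mxE addr_ge0 // mulr_ge0.
rewrite mulmxDl -scalemxAl -Ev -Ew; apply/rowP => j.
by rewrite [RHS]mxE wE [(t *: (xv *m M)) 0 j]mxE subrK.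
Qed.

End MinorCriterion.

(** * Slack matrices *)

Section SlackMatrices.
Variables (p q : nat).
Implicit Type S : 'M[R]_(p, q).

Definition nonneg_mx S := forall i j, 0 <= S i j.

Lemma nonneg_mul n (y : 'rV[R]_n) (m : nat) (S : 'M[R]_(n, m)) :
  nonneg_rv y -> (forall i j, 0 <= S i j) -> nonneg_rv (y *m S).
Proof. by move=> y0 S0 j; rewrite mxE sumr_ge0 // => i _; rewrite mulr_ge0. Qed.

Lemma RCGC_coneP S : nonneg_mx S -> RCGC S <->
  (forall x : 'rV[R]_p, nonneg_rv (x *m S) -> exists2 y, nonneg_rv y & x *m S = y *m S).
Proof.
move=> S0; split=> [HR x xS|HR z].
  by have [_ []] := HR (x *m S); [split; [exists x|]|move=> y [y0 Ey]; exists y].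
split=> [[x [x0 ->]]|[[x ->] xS]].
  by split; [exists x|apply: nonneg_mul].
by have [y y0 ->] := HR x xS; exists y.
Qed.

Lemma CCGC_tr S : CCGC S <-> RCGC S^T.
Proof.
have nnT m (x : 'rV[R]_m) : nonneg_cv x^T <-> nonneg_rv x.
  by split=> H i; have := H i; rewrite !mxE.
have nnT' m (x : 'cV[R]_m) : nonneg_rv x^T <-> nonneg_cv x.
  by split=> H i; have := H i; rewrite !mxE.
split=> H z.
  have := H z^T; rewrite nnT => {}H.
  have -> : (exists x, nonneg_rv x /\ z = x *m S^T) <->
            (exists x, nonneg_cv x /\ z^T = S *m x).
    split=> [[x [x0 ->]]|[x [x0 Ez]]]; first by exists x^T; rewrite nnT trmx_mul trmxK.
    by exists x^T; rewrite nnT' -trmx_mul -Ez trmxK.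
  rewrite {}H; split=> [[[x Ex] z0]|[[x ->] z0]]; split=> //.
    by exists x^T; rewrite -trmx_mul -Ex trmxK.
  by exists x^T; rewrite trmx_mul trmxK.
have := H z^T; rewrite nnT' => {}H.
have -> : (exists x, nonneg_cv x /\ z = S *m x) <->
          (exists x, nonneg_rv x /\ z^T = x *m S^T).
  split=> [[x [x0 ->]]|[x [x0 Ez]]]; first by exists x^T; rewrite nnT' trmx_mul.
  by exists x^T; rewrite nnT -[S]trmxK -trmx_mul -Ez trmxK.
rewrite {}H; split=> [[[x Ex] z0]|[[x ->] z0]]; split=> //.
  by exists x^T; rewrite -[S]trmxK -trmx_mul -Ex trmxK.
by exists x^T; rewrite trmx_mul.
Qed.

(** Every x is y A since the rows of [A] span. If x B = y S is nonnegative, the RCGC replaces y by a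
    nonnegative z with the same product, and cancelling [B] gives x = z A. *)
Lemma slack_factor n S (A : 'M[R]_(p, n)) (B : 'M[R]_(n, q)) :
  S = A *m B -> row_full A -> row_free B -> nonneg_mx S -> RCGC S ->
  forall x, nonneg_rv (x *m B) <-> exists y, nonneg_rv y /\ x = y *m A.
Proof.
move=> ES Afull Bfree S0 /(RCGC_coneP S0) HR x; split=> [xB|[y [y0 ->]]]; last first.
  by rewrite -mulmxA -ES; apply: nonneg_mul.
have [y Ey] := submxP (submx_full x Afull).
have [|z z0 Ez] := HR y; first by rewrite ES mulmxA -Ey.
exists z; split=> //; apply: (row_free_inj Bfree) => /=.
by rewrite -mulmxA -ES -Ez ES mulmxA -Ey.
Qed.

Lemma cone_slackP S : is_cone_slack S <-> nonneg_mx S /\ RCGC S.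
Proof.
split=> [[n [A [B [HK ES]]]]|[S0 HR]].
  have S0 : nonneg_mx S.
    move=> i j; have /HK/(_ j) : exists y, nonneg_rv y /\ row i A = y *m A.
      by exists (delta_mx 0 i); rewrite -rowE; split=> // k; rewrite mxE ler0n.
    by rewrite -row_mul -ES mxE.
  split=> //; apply/(RCGC_coneP S0) => x xS.
  have /HK[y [y0 Ey]] : nonneg_rv (x *m A *m B) by rewrite -mulmxA -ES.
  by exists y => //; rewrite ES !mulmxA -Ey.
(* Any rank factorization serves. *)
exists (\rank S), (col_base S), (row_base S); split; last by rewrite mulmx_base.
by apply: slack_factor; rewrite ?mulmx_base ?col_base_full ?row_base_free.
Qed.

Section PolytopeCone.
Variables (n : nat) (V : 'M[R]_(p, n)) (W : 'M[R]_(q, n)) (w : 'cV[R]_q).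
Hypothesis HP : forall x : 'rV[R]_n, in_conv_rows V x <-> (forall j, (W *m x^T) j 0 <= w j 0).

Lemma conv_rows_bound (x : 'rV[R]_n) k : in_conv_rows V x -> `|x 0 k| <= \sum_i `|V i k|.
Proof.
case=> l [l0 [l1 ->]]; rewrite mxE; apply: le_trans (ler_norm_sum _ _ _) _.
apply: ler_sum => i _; rewrite normrM (ger0_norm (l0 i)) ler_piMl //.
by rewrite -l1 (bigD1 i) //= lerDl sumr_ge0.
Qed.

Lemma polytope_recession (x0 x : 'rV[R]_n) : in_conv_rows V x0 ->
  (forall j, (W *m x^T) j 0 <= 0) -> x = 0.
Proof.
move=> x0P Hx; apply/rowP => k; rewrite [RHS]mxE; apply/eqP; apply: contraT => xk.
(* [b] bounds coordinate [k] on the polytope; moving from [x0] by [t] times [x] makes it at least b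
   + 1 in absolute value. *)
pose b := \sum_i `|V i k|; pose t := (b + `|x0 0 k| + 1) / `|x 0 k|.
have xk0 : 0 < `|x 0 k| by rewrite normr_gt0.
have b0 : 0 <= b by apply: sumr_ge0.
have t0 : 0 <= t by rewrite divr_ge0 // !addr_ge0.
have : in_conv_rows V (x0 + t *: x).
  apply/HP => j; rewrite linearD linearZ /= mulmxDr -scalemxAr mxE [X in _ + X]mxE.
  have := (HP x0).1 x0P j => H0.
  by rewrite -[leRHS]addr0 lerD // mulr_ge0_le0.
move/conv_rows_bound => /(_ k); rewrite -/b mxE [(t *: x) 0 k]mxE => H1.
have := ler_normB (x0 0 k + t * x 0 k) (x0 0 k).
rewrite addrC addKr normrM (ger0_norm t0) /t divfK ?gt_eqF // => H2.
by lra.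
Qed.

Hypothesis HV : exists x1 x2 : 'rV[R]_n, in_conv_rows V x1 /\ in_conv_rows V x2 /\ x1 <> x2.

(** Homogenization: the rows of [A] generate the cone over {1} x P, and the columns of [B] are the
    inequalities t w - W x >= 0. *)
Let A := row_mx (const_mx 1) V : 'M[R]_(p, 1 + n).
Let B := (row_mx w (- W))^T : 'M[R]_(1 + n, q).

Lemma polytope_coneE (t : R) (x : 'rV[R]_n) j :
  (row_mx t%:M x *m B) 0 j = t * w j 0 - (W *m x^T) j 0.
Proof.
rewrite /B tr_row_mx mul_row_col mxE mul_scalar_mx !mxE; congr (_ + _).
by rewrite -sumrN; apply: eq_bigr => k _; rewrite !mxE mulrN mulrC.
Qed.

(** If t < 0, then x - t y is a recession direction for every y in P, hence 0, so x = t y for two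
    distinct points y. If t = 0, x itself is a recession direction. *)
Lemma polytope_cone_ge0 (t : R) (x : 'rV[R]_n) : nonneg_rv (row_mx t%:M x *m B) ->
  0 <= t /\ (t = 0 -> x = 0).
Proof.
case: HV => x1 [x2 [P1 [P2 n12]]] H.
have {}H j : (W *m x^T) j 0 <= t * w j 0 by have := H j; rewrite polytope_coneE subr_ge0.
split; last first.
  by move=> t0; apply: (polytope_recession P1) => j; have := H j; rewrite t0 mul0r.
rewrite leNgt; apply/negP => t0.
have Hx y : in_conv_rows V y -> x = t *: y.
  move=> Py; apply/eqP; rewrite -subr_eq0; apply/eqP; apply: (polytope_recession P1) => j.
  have -> : (W *m (x - t *: y)^T) j 0 = (W *m x^T) j 0 - t * (W *m y^T) j 0.
    by rewrite linearB linearZ /= mulmxBr -scalemxAr !mxE.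
  have := (HP y).1 Py j => Hy; have := H j.
  by have : t * w j 0 <= t * (W *m y^T) j 0 by [rewrite ler_nM2l]; lra.
apply: n12; have := Hx _ P1; rewrite (Hx _ P2) => /eqP.
by rewrite -subr_eq0 -scalerBr scaler_eq0 (lt_eqF t0) /= subr_eq0 => /eqP.
Qed.

Lemma polytope_cone (x : 'rV[R]_(1 + n)) :
  nonneg_rv (x *m B) <-> exists y, nonneg_rv y /\ x = y *m A.
Proof.
rewrite -[x]hsubmxK [lsubmx x]mx11_scalar; set t := lsubmx x 0 0; set x' := rsubmx x.
have yA (y : 'rV[R]_p) : y *m A = row_mx (\sum_i y 0 i)%:M (y *m V).
  rewrite /A mul_mx_row; congr row_mx; apply/matrixP => i j.
  by rewrite [i]ord1 [j]ord1 !mxE eqxx mulr1n; apply: eq_bigr => k _; rewrite mxE mulr1.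
split=> [H|[y [y0 Ey]]].
  have [t0 tx] := polytope_cone_ge0 H.
  have [/esym t0'|tn0] := eqVneq 0 t.
    exists 0; split; first by move=> i; rewrite mxE.
    by rewrite t0' tx // mul0mx raddf0 row_mx0.
  have tp : 0 < t by rewrite lt_def eq_sym tn0.
  have : in_conv_rows V (t^-1 *: x').
    apply/HP => j; rewrite linearZ /= -scalemxAr mxE ler_pdivrMl //.
    by have := H j; rewrite polytope_coneE subr_ge0.
  case=> l [l0 [l1 El]]; exists (t *: l); split.
    by move=> i; rewrite mxE mulr_ge0.
  rewrite yA -scalemxAl -El scalerA divff ?gt_eqF // scale1r; congr (row_mx _%:M _).
  by rewrite -[LHS]mulr1 -l1 mulr_sumr; apply: eq_bigr => i _; rewrite mxE.
rewrite Ey -mulmxA; apply: (nonneg_mul y0) => i j.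
have : in_conv_rows V (row i V).
  exists (delta_mx 0 i); split; first by move=> k; rewrite mxE ler0n.
  rewrite -rowE; split=> //; rewrite (bigD1 i) //= big1 ?mxE ?eqxx ?addr0 // => k nk.
  by rewrite mxE (negbTE nk) andbF.
move/HP/(_ j) => H.
have := polytope_coneE 1 (row i V) j; rewrite mul1r => E.
have -> : (A *m B) i j = (row i A *m B) 0 j by rewrite -row_mul [RHS]mxE.
rewrite /A row_row_mx (_ : row i (const_mx 1) = 1%:M) ?E ?subr_ge0 //.
by apply/matrixP => a b; rewrite [a]ord1 [b]ord1 !mxE eqxx.
Qed.

(** The homogenized cone is pointed: if x B = 0, both x and its negative lie in it. *)
Lemma polytope_row_free : row_free B.
Proof.
apply: inj_row_free => x xB.
have [|t0 tx] := @polytope_cone_ge0 (lsubmx x 0 0) (rsubmx x).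
  by rewrite -mx11_scalar hsubmxK xB => j; rewrite mxE.
have [|t0' _] := @polytope_cone_ge0 (- lsubmx x 0 0) (- rsubmx x).
  rewrite raddfN /= -mx11_scalar -opp_row_mx hsubmxK mulNmx xB => j.
  by rewrite !mxE oppr0.
have E : lsubmx x 0 0 = 0 by apply/eqP; rewrite eq_le t0 -oppr_ge0 t0'.
by rewrite -[x]hsubmxK [lsubmx x]mx11_scalar E tx // raddf0 row_mx0.
Qed.

(** Distinct points of P lift to independent vectors (1, x) in the row space of [A]. *)
Lemma polytope_rank : (1 < \rank A)%N.
Proof.
case: HV => x1 [x2 [P1 [P2 n12]]]; rewrite ltnNge; apply/negP => leA.
have inA y : in_conv_rows V y -> (row_mx 1%:M y <= A)%MS.
  case=> l [_ [l1 ->]]; apply/submxP; exists l; rewrite /A mul_mx_row; congr row_mx.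
  apply/matrixP => i j; rewrite [i]ord1 [j]ord1 !mxE eqxx mulr1n -[LHS]l1.
  by apply: eq_bigr => k _; rewrite mxE mulr1.
have rk1 : \rank (row_mx 1%:M x1) = 1%N.
  apply/eqP; rewrite eqn_leq rank_leq_row lt0n mxrank_eq0.
  apply/negP => /eqP/(congr1 lsubmx); rewrite row_mxKl => /matrixP/(_ 0 0)/eqP.
  by rewrite !mxE eqxx oner_eq0.
have [_ E] := mxrank_leqif_sup (inA _ P1).
have /sub_rVP[c /eqP] : (row_mx 1%:M x2 <= row_mx 1%:M x1)%MS.
  apply: submx_trans (inA _ P2) _; rewrite -E rk1 eqn_leq leA andbT.
  by have := mxrankS (inA _ P1); rewrite rk1.
rewrite scale_row_mx => /eqP/eq_row_mx[/matrixP/(_ 0 0)]; rewrite !mxE eqxx mulr1n mulr1 => <-.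
by rewrite scale1r => E12; apply: n12.
Qed.

End PolytopeCone.

(** A polytope factorization is a cone factorization whose left factor has the all-ones vector as
    first column. The rank condition provides two distinct points. *)
Lemma polytope_slackP S : is_polytope_slack S <->
  [/\ nonneg_mx S, RCGC S, (1 < \rank S)%N & exists u : 'cV[R]_q, S *m u = const_mx 1].
Proof.
split=> [[n [V [W [w [HP [HV ES]]]]]]|[S0 HR rS [u Su]]].
  have [S0 HR] : nonneg_mx S /\ RCGC S.
    by apply/cone_slackP; do 3!eexists; split; [exact: (polytope_cone HP HV)|].
  have Bfree := polytope_row_free HP HV; split=> //.
    by rewrite ES mxrankMfree // (polytope_rank HV).
  have [B' EB] := row_freeP Bfree; exists (B' *m col_mx 1%:M 0).
  by rewrite ES -mulmxA (mulmxA _ B') EB mul1mx mul_row_col mulmx1 mulmx0 addr0.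
(* [c] holds the coordinates of the all-ones vector in the column basis. Completing it by a
   complement gives the base change [G], after which the first column of the left factor is constant
   1. *)
pose c := row_base S *m u; pose C := (c^T)^C%MS; pose n := \rank C.
have Ac : col_base S *m c = const_mx 1 by rewrite mulmxA mulmx_base.
have p0 : (0 < p)%N by apply: leq_trans (rank_leq_row S); apply: ltnW.
pose i0 := Ordinal p0.
have c0 : c^T != 0.
  apply: contraTneq isT => /(congr1 trmx); rewrite trmxK trmx0 => c0.
  by have /matrixP/(_ i0 0)/eqP := Ac; rewrite c0 mulmx0 !mxE eq_sym oner_eq0.
have rkc : \rank c^T = 1%N.
  by apply/eqP; rewrite eqn_leq rank_leq_row lt0n mxrank_eq0.
have En : (1 + n = \rank S)%N by rewrite /n mxrank_compl rkc; lia.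
pose G := col_mx c^T (row_base C).
have Gfull : row_full G.
  rewrite /row_full /G -(addsmxE c^T) (adds_eqmx (eqmx_refl c^T) (eq_row_base C)).
  exact: addsmx_compl_full.
have rkG : \rank G = (1 + n)%N by rewrite [RHS]En; apply/eqP.
have [H HG] := row_fullP Gfull.
have rkH : \rank H^T = (1 + n)%N.
  rewrite mxrank_tr; apply/eqP; rewrite eqn_leq rank_leq_col [X in (X <= _)%N]En.
  by have := mxrankM_maxl H G; rewrite HG mxrank1.
pose V := col_base S *m (row_base C)^T.
pose A := row_mx (const_mx 1 : 'cV[R]_p) V.
pose B := H^T *m row_base S.
have EA : A = col_base S *m G^T.
  by rewrite /A /G tr_col_mx trmxK mul_mx_row Ac.
have ES : S = A *m B.
  by rewrite EA mulmxA -(mulmxA _ G^T) -trmx_mul HG trmx1 mulmx1 mulmx_base.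
pose w := (usubmx B)^T; pose W := - (dsubmx B)^T.
have EB : B = (row_mx w (- W))^T.
  by rewrite /w /W opprK tr_row_mx !trmxK vsubmxK.
have Afull : row_full A.
  by rewrite EA /row_full (eqmxMfull _ (col_base_full S)) mxrank_tr rkG.
have Bfree : row_free B.
  by rewrite /row_free mxrankMfree ?row_base_free // rkH.
have HC := slack_factor ES Afull Bfree S0 HR.
exists n, V, W, w; split.
  move=> x; have -> : in_conv_rows V x <->
      exists y, nonneg_rv y /\ row_mx 1%:M x = y *m A.
    have yA (y : 'rV[R]_p) : y *m A = row_mx (\sum_i y 0 i)%:M (y *m V).
      rewrite /A mul_mx_row; congr row_mx; apply/matrixP => i j.
      by rewrite [i]ord1 [j]ord1 !mxE eqxx mulr1n; apply: eq_bigr => k _; rewrite mxE mulr1.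
    split=> [[l [l0 [l1 ->]]]|[l [l0 El]]]; exists l; first by rewrite yA l1.
    move: El; rewrite yA => /eq_row_mx[/matrixP/(_ 0 0)].
    by rewrite !mxE eqxx !mulr1n => <- ->.
  rewrite -HC EB; split=> Hx j; have := Hx j; rewrite polytope_coneE mul1r subr_ge0 //.
split; last by rewrite -EB.
(* If all rows of [V] were equal, [A] would have rank at most one. *)
have /existsP[i Hi] : [exists i, row i V != row i0 V].
  apply: contraTT rS; rewrite negb_exists => /forallP Hall; rewrite -leqNgt.
  rewrite ES mxrankMfree // (_ : A = const_mx 1 *m row i0 A).
    by apply: leq_trans (mxrankM_maxl _ _) (rank_leq_col _).
  apply/row_matrixP => i; rewrite row_mul (_ : row i (const_mx 1) = 1%:M); last first.
    by apply/matrixP => a b; rewrite [a]ord1 [b]ord1 !mxE eqxx.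
  rewrite mul1mx /A !row_row_mx; move: (Hall i); rewrite negbK => /eqP ->.
  by congr row_mx; apply/rowP => a; rewrite !mxE.
have rowP k : in_conv_rows V (row k V).
  exists (delta_mx 0 k); split; first by move=> a; rewrite mxE ler0n.
  rewrite -rowE; split=> //; rewrite (bigD1 k) //= big1 ?mxE ?eqxx ?addr0 // => a na.
  by rewrite mxE (negbTE na) andbF.
by exists (row i V), (row i0 V); split=> //; split=> //; apply/eqP.
Qed.

End SlackMatrices.

(** The all-ones vector is in the column space iff [S, 1] still has rank r. Only minors through the
    last column matter: for a column basis [J], independence of the all-ones column would give a
    nonzero one. *)
Lemma ones_minorP p q (r : nat) (S : 'M[R]_(p, q)) : \rank S = r ->
  (exists u : 'cV[R]_q, S *m u = const_mx 1) <->
  (forall (I : 'I_(r + 1) -> 'I_p) (J : 'I_r -> 'I_q),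
     \det (row_mx (mxsub I J S) (const_mx 1)) = 0).
Proof.
move=> rkS; split=> [[u Su] I J|Hdet].
  have E : row_mx (mxsub I J S) (const_mx 1) = rowsub I S *m row_mx (colsub J 1%:M) u.
    rewrite mul_mx_row; congr row_mx.
      by rewrite mulmx_colsub mulmx1; apply/matrixP => a b; rewrite !mxE.
    by rewrite mul_rowsub_mx Su; apply/matrixP => a b; rewrite !mxE.
  apply/eqP; apply: contraT; rewrite -unitfE => Hu.
  have : (\rank (row_mx (mxsub I J S) (const_mx 1%R : 'cV[R]_(r + 1))) <= r)%N.
    rewrite E; apply: leq_trans (mxrankM_maxl _ _) _.
    by rewrite -[leqRHS]rkS mxrankS // rowsubE submxMl.
  by rewrite mxrank_unit ?unitmxE // addn1 ltnn.
have [J [Jfree JS]] := exists_rowsub_free (etrans (mxrank_tr S) rkS).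
pose C := row_mx (colsub J S) (const_mx 1 : 'cV[R]_p).
have nfull : ~~ row_full C.
  apply/negP => Cfull; have := fullrowsub_unit Cfull; set I := fullrankfun Cfull.
  rewrite unitmxE (_ : rowsub I C = row_mx (mxsub I J S) (const_mx 1)) ?Hdet ?unitr0 //.
  by apply/matrixP => a b; rewrite !mxE; case: splitP => k _; rewrite !mxE.
have rkJ : \rank (rowsub J S^T) = r by apply/eqP.
have CT : C^T = col_mx (rowsub J S^T) (const_mx 1).
  by rewrite /C tr_row_mx trmx_const; congr col_mx; apply/matrixP => a b; rewrite !mxE.
have leJ : (rowsub J S^T <= C^T)%MS by rewrite CT -addsmxE addsmxSl.
have [_ EJ] := mxrank_leqif_sup leJ.
have : (C^T <= rowsub J S^T)%MS.
  rewrite -EJ eqn_leq mxrankS // rkJ mxrank_tr.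
  by move: nfull (rank_leq_col C); rewrite /row_full; lia.
rewrite CT -addsmxE addsmx_sub => /andP[_ H1].
have /submxP[D ED] : ((const_mx 1 : 'rV[R]_p) <= S^T)%MS.
  by apply: submx_trans H1 _; rewrite rowsubE submxMl.
by exists D^T; rewrite -[S]trmxK -trmx_mul -ED trmx_const.
Qed.

(** * Determinants and the criteria as formulas *)

(** Leibniz expansion with rows indexed by the variables below [n] and columns by the following
    ones. Columns from [m] on are all ones, so their factors are omitted. *)
Definition det_poly (n m : nat) : poly_expr :=
  [seq (odd_perm s, [seq (val i, (n + val (s i))%N) | i <- enum 'I_n & (val (s i) < m)%N])
  | s : {perm 'I_n} <- enum {perm 'I_n}].

Definition neg_poly (P : poly_expr) : poly_expr := [seq (~~ t.1, t.2) | t <- P].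

Lemma peval_det e rho n m : peval e rho (det_poly n m) =
  \det (\matrix_(i < n, j < n) if (j < m)%N then e (rho i) (rho (n + j)%N) else 1).
Proof.
rewrite /peval /det_poly big_map big_enum; apply: eq_bigr => s _ /=; congr (_ * _).
rewrite big_map big_filter big_enum_cond big_mkcond.
by apply: eq_bigr => i _; rewrite mxE.
Qed.

Lemma peval_neg e rho P : peval e rho (neg_poly P) = - peval e rho P.
Proof.
rewrite /peval big_map -sumrN; apply: eq_bigr => t _ /=.
by rewrite signrN mulNr.
Qed.

Definition FTrue := FNot (FPos [::]).
Definition FOr f g := FNot (FAnd (FNot f) (FNot g)).
Definition FEx b f := FNot (FAll b (FNot f)).
Definition FZero P := FAnd (FNot (FPos P)) (FNot (FPos (neg_poly P))).
Definition entry_poly (u v : nat) : poly_expr := [:: (false, [:: (u, v)])].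

Lemma peval_entry e rho u v : peval e rho (entry_poly u v) = e (rho u) (rho v).
Proof. by rewrite /peval !big_seq1 mul1r. Qed.

Section Semantics.
Variables (e : nat -> nat -> rat) (p q : nat).

Lemma sat_zero rho d P : sat e p q rho d (FZero P) = (peval e rho P == 0).
Proof. by rewrite /= peval_neg oppr_gt0 -!leNgt eq_le. Qed.

Lemma sat_ex rho d b f :
  sat e p q rho d (FEx b f) = has (fun k => sat e p q (upd rho d k) d.+1 f) (iota 0 (if b then p else q)).
Proof. by rewrite /= -has_predC; apply: eq_has => k /=; rewrite negbK. Qed.

Lemma sat_or rho d f g : sat e p q rho d (FOr f g) = sat e p q rho d f || sat e p q rho d g.
Proof. by rewrite /= negb_and !negbK. Qed.

Lemma sat_not rho d f : sat e p q rho d (FNot f) = ~~ sat e p q rho d f.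
Proof. by []. Qed.

Lemma sat_and rho d f g : sat e p q rho d (FAnd f g) = sat e p q rho d f && sat e p q rho d g.
Proof. by []. Qed.

Lemma sat_foldr rho d (F : nat -> mxform) l :
  sat e p q rho d (foldr FAnd FTrue [seq F c | c <- l]) = all (fun c => sat e p q rho d (F c)) l.
Proof. by elim: l => [|c l IH] /=; rewrite ?IH // /peval big_nil ltxx. Qed.

(** Assigns a block of [k] variables at once, so that nested quantifiers can be read as one over
    index functions. *)
Definition ext (rho : nat -> nat) (d k : nat) (g : nat -> nat) (v : nat) : nat :=
  if (d <= v < d + k)%N then g (v - d)%N else rho v.

Lemma sat_iter b k f rho d : sat e p q rho d (iter k (FAll b) f) <->
  (forall g : nat -> nat, (forall i, (i < k)%N -> (g i < if b then p else q)%N) ->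
     sat e p q (ext rho d k g) (d + k) f).
Proof.
elim: k rho d => [|k IH] rho d.
  have E g : ext rho d 0 g = rho.
    by apply: functional_extensionality => v; rewrite /ext; case: ifP => //; lia.
  rewrite addn0; split=> [H g _|H]; first by rewrite E.
  by have := H id; rewrite E; apply.
have Ext x g : ext (upd rho d x) d.+1 k g = ext rho d k.+1 (fun i => if i is i'.+1 then g i' else x).
  apply: functional_extensionality => v; rewrite /ext /upd.
  case: (ltngtP v d) => [ltv|gtv|->].
  - by [].
  - by rewrite addSnnS /=; have -> : (v - d = (v - d.+1).+1)%N by lia.
  - by rewrite /= addnS ltnS leq_addr subnn.
rewrite iterS /=; split.
  move/allP => H g Hg.
  have /IH : sat e p q (upd rho d (g 0%N)) d.+1 (iter k (FAll b) f).
    by apply: H; rewrite mem_iota /= add0n Hg.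
  move=> /(_ (fun i => g i.+1)); rewrite Ext addSnnS.
  rewrite (_ : (fun i => _) = g); last by apply: functional_extensionality => -[].
  by apply=> i ltik; apply: Hg.
move=> H; apply/allP => x; rewrite mem_iota add0n => ltx; apply/IH => g Hg.
by rewrite Ext addSnnS; apply: H => -[|i] //; apply: Hg.
Qed.

End Semantics.

Section CriterionFormula.
Variable r : nat.

Definition minor_poly := det_poly (r + 1) (r + 1).

(** Variables up to [r] are the rows [I] and the next [r] are the columns [T]. Variable [r + 1 + r]
    is the column j in the minors and, in the last disjunct, the row sought, whose nonzero column is
    the variable after it. *)
Definition minor_body : mxform :=
  FOr (FNot (FAnd (FOr (FAll false (FNot (FPos minor_poly)))
                       (FAll false (FNot (FPos (neg_poly minor_poly)))))
                  (FEx false (FNot (FZero minor_poly)))))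
      (FEx true (FAnd
         (foldr FAnd FTrue
           [seq FZero (entry_poly (r + 1 + r) (r + 1 + c)) | c <- iota 0 r])
         (FEx false (FNot (FZero (entry_poly (r + 1 + r) (r + 1 + r).+1)))))).

Definition minor_form : mxform := iter (r + 1) (FAll true) (iter r (FAll false) minor_body).

Definition minor_val (e : nat -> nat -> rat) (g h : nat -> nat) (j : nat) : rat :=
  \det (\matrix_(a < r + 1, b < r + 1) e (g a) (if (b < r)%N then h b else j)).

Lemma sat_minor_form e p q : sat e p q (fun=> 0%N) 0 minor_form <->
  forall g h, (forall i, (i < r + 1)%N -> (g i < p)%N) -> (forall i, (i < r)%N -> (h i < q)%N) ->
  ((forall j, (j < q)%N -> minor_val e g h j <= 0) \/
   (forall j, (j < q)%N -> 0 <= minor_val e g h j)) ->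
  (exists2 j, (j < q)%N & minor_val e g h j != 0) ->
  exists i, [/\ (i < p)%N, forall c, (c < r)%N -> e i (h c) = 0
                & exists2 j, (j < q)%N & e i j != 0].
Proof.
rewrite /minor_form sat_iter add0n.
have Erho g h (rho := ext (ext (fun=> 0%N) 0 (r + 1) g) (r + 1) r h) :
    (forall a, (a < r + 1)%N -> rho a = g a) /\ (forall b, (b < r)%N -> rho (r + 1 + b)%N = h b).
  split=> [a lta|b ltb]; rewrite /rho /ext; first by rewrite leqNgt lta /= subn0.
  by rewrite leq_addr ltn_add2l ltb /= addKn.
have Epoly g h j (rho := ext (ext (fun=> 0%N) 0 (r + 1) g) (r + 1) r h) :
    peval e (upd rho (r + 1 + r) j) minor_poly = minor_val e g h j.
  have [E1 E2] := Erho g h; rewrite -/rho in E1 E2.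
  rewrite peval_det; congr (\det _); apply/matrixP => a b; rewrite !mxE ltn_ord.
  rewrite upd_diff; last by rewrite ltn_eqF // (leq_trans (ltn_ord a)) ?leq_addr.
  rewrite E1 ?ltn_ord //; congr (e _ _).
  case: ltnP => [ltb|geb]; first by rewrite upd_diff ?E2 // ltn_eqF // ltn_add2l.
  by rewrite (_ : val b = r) ?upd_same //; have := ltn_ord b; rewrite /=; lia.
have Ebody g h (rho := ext (ext (fun=> 0%N) 0 (r + 1) g) (r + 1) r h) :
    sat e p q rho (r + 1 + r) minor_body =
    ~~ ((all (fun j => minor_val e g h j <= 0) (iota 0 q) ||
         all (fun j => 0 <= minor_val e g h j) (iota 0 q)) &&
        has (fun j => minor_val e g h j != 0) (iota 0 q))
    || has (fun i => all (fun c => e i (h c) == 0) (iota 0 r) &&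
                     has (fun j => e i j != 0) (iota 0 q)) (iota 0 p).
  have [E1 E2] := Erho g h; rewrite -/rho in E1 E2.
  rewrite /minor_body sat_or sat_ex sat_not sat_and; congr (~~ (_ && _) || _).
  - rewrite sat_or; congr orb; apply: eq_all => j /=; rewrite ?peval_neg Epoly.
      by rewrite -leNgt.
    by rewrite oppr_gt0 -leNgt.
  - by rewrite sat_ex; apply: eq_has => j; rewrite sat_not sat_zero Epoly.
  apply: eq_has => i; rewrite sat_and sat_foldr sat_ex; congr (_ && _).
    apply: eq_in_all => c; rewrite mem_iota add0n => /andP[_ ltc].
    rewrite sat_zero peval_entry upd_same upd_diff ?E2 //.
    by rewrite ltn_eqF // ltn_add2l.
  apply: eq_has => j; rewrite sat_not sat_zero peval_entry upd_same.
  by rewrite upd_diff ?upd_same // ltn_eqF.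
split=> [H g h Hg Hh Hs [j ltj nz]|H g Hg].
  have := H g Hg; rewrite sat_iter => /(_ h Hh); rewrite Ebody => /orP[/negP[]|].
    apply/andP; split; last by apply/hasP; exists j; rewrite ?mem_iota.
    apply/orP; case: Hs => Hs; [left|right]; apply/allP => k; rewrite mem_iota; exact: Hs.
  case/hasP => i; rewrite mem_iota => lti /andP[/allP Hc /hasP[k]].
  rewrite mem_iota => ltk ek; exists i; split=> //; last by exists k.
  by move=> c ltc; apply/eqP/Hc; rewrite mem_iota.
rewrite sat_iter => h Hh; rewrite Ebody -implybE; apply/implyP => /andP[Hs /hasP[j]].
rewrite mem_iota => ltj nz; have [||i [lti Hc [k ltk ek]]] := H g h Hg Hh.
- by case/orP: Hs => /allP Hs; [left|right] => k ltk; apply: Hs; rewrite mem_iota.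
- by exists j.
apply/hasP; exists i; first by rewrite mem_iota.
apply/andP; split; last by apply/hasP; exists k; rewrite ?mem_iota.
by apply/allP => c; rewrite mem_iota => ltc; rewrite Hc.
Qed.

End CriterionFormula.

Lemma real_mxE p q (A : 'M[rat]_(p, q)) i j : real_mx A i j = ratr (A i j).
Proof. by rewrite mxE. Qed.

Definition ord_fun n m (I : 'I_n -> 'I_m) (v : nat) : nat :=
  if insub v is Some i then val (I i) else 0%N.

Lemma ord_funE n m (I : 'I_n -> 'I_m) (i : 'I_n) : ord_fun I i = I i :> nat.
Proof. by rewrite /ord_fun valK. Qed.

Lemma ord_fun_lt n m (I : 'I_n -> 'I_m) v : (v < n)%N -> (ord_fun I v < m)%N.
Proof. by move=> ltv; rewrite /ord_fun insubT /=. Qed.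

Section Link.
Variables (p q r : nat) (A : 'M[rat]_(p, q)) (e : nat -> nat -> rat).
Hypothesis eA : forall (i : 'I_p) (j : 'I_q), e i j = A i j.

(** [ratr] commutes with determinants and preserves order, so rational evaluation decides the
    condition over the reals. *)
Lemma minor_valE (I : 'I_(r + 1) -> 'I_p) (T : 'I_r -> 'I_q) (g h : nat -> nat) (j : 'I_q) :
  (forall a : 'I_(r + 1), g a = I a :> nat) -> (forall b : 'I_r, h b = T b :> nat) ->
  minor_row (real_mx A) I T 0 j = ratr (minor_val r e g h j).
Proof.
move=> Hg Hh; rewrite mxE /minor_val -det_map_mx; congr (\det _).
apply/matrixP => a b; rewrite !mxE Hg; case: splitP => k Ek; rewrite !mxE.
  by rewrite Ek Hh eA.
by rewrite eA.
Qed.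

Lemma minor_formP : sat e p q (fun=> 0%N) 0 (minor_form r) <-> minor_cond r (real_mx A).
Proof.
rewrite sat_minor_form; split=> [H I T zn0 Hz|H g h Hg Hh Hs [j ltj nz]].
  pose g := ord_fun I; pose h := ord_fun T.
  have E j := minor_valE (I := I) (T := T) (g := g) (h := h) j (ord_funE I) (ord_funE T).
  have [||i [lti Hc [j ltj ej]]] := H g h (@ord_fun_lt _ _ I) (@ord_fun_lt _ _ T).
  - case: Hz => Hz; [right|left] => j ltj; have := Hz (Ordinal ltj); rewrite E /=.
      by rewrite ler0q.
    by rewrite lerq0.
  - have [j zj] : exists j, minor_row (real_mx A) I T 0 j != 0 by apply/rV0Pn.
    by exists j => //; move: zj; rewrite E fmorph_eq0.
  exists (Ordinal lti).
    by move=> b; rewrite real_mxE -eA -ord_funE Hc ?rmorph0.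
  apply: contraNneq ej => /rowP/(_ (Ordinal ltj))/eqP.
  by rewrite !mxE fmorph_eq0 -eA.
pose I (a : 'I_(r + 1)) := Ordinal (Hg a (ltn_ord a)).
pose T (b : 'I_r) := Ordinal (Hh b (ltn_ord b)).
have E j' := @minor_valE I T g h j' (fun=> erefl) (fun=> erefl).
have [||i Hi Mi0] := H I T.
- by apply: contraNneq nz => /rowP/(_ (Ordinal ltj))/eqP; rewrite E mxE fmorph_eq0.
- by case: Hs => Hs; [right|left] => k; rewrite E ?lerq0 ?ler0q Hs.
exists i; split=> //.
  move=> c ltc; have /eqP := Hi (Ordinal ltc); rewrite real_mxE fmorph_eq0 -eA => /eqP <-.
  by [].
have [k Mk] : exists k, row i (real_mx A) 0 k != 0 by apply/rV0Pn.
by exists k => //; move: Mk; rewrite !mxE fmorph_eq0 -eA.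
Qed.

Definition nonneg_form : mxform :=
  FAll true (FAll false (FNot (FPos (neg_poly (entry_poly 0 1))))).

Lemma nonneg_formP : sat e p q (fun=> 0%N) 0 nonneg_form <-> nonneg_mx (real_mx A).
Proof.
have E i j : sat e p q (upd (upd (fun=> 0%N) 0 i) 1 j) 2 (FNot (FPos (neg_poly (entry_poly 0 1))))
    = (0 <= e i j).
  by rewrite sat_not -[X in ~~ X]/(0 < peval _ _ _) peval_neg peval_entry oppr_gt0 -leNgt.
split=> [/allP H i j|H].
  have Hi : val i \in iota 0 p by rewrite mem_iota /=.
  have /allP Hj : all (fun k => sat e p q (upd (upd (fun=> 0%N) 0 (val i)) 1 k) 2
      (FNot (FPos (neg_poly (entry_poly 0 1))))) (iota 0 q) := H _ Hi.
  by rewrite real_mxE ler0q -eA -E Hj // mem_iota /=.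
apply/allP => i; rewrite mem_iota => lti; apply/allP => j; rewrite mem_iota => ltj.
by have := H (Ordinal lti) (Ordinal ltj); rewrite real_mxE ler0q -eA -E.
Qed.

(** Here [r] is the rank of the matrix, whereas [minor_form r] is meant for rank [r + 1]. *)
Definition ones_form : mxform :=
  iter (r + 1) (FAll true) (iter r (FAll false) (FZero (det_poly (r + 1) r))).

Lemma ones_formP : sat e p q (fun=> 0%N) 0 ones_form <->
  (forall (I : 'I_(r + 1) -> 'I_p) (J : 'I_r -> 'I_q),
     \det (row_mx (mxsub I J (real_mx A)) (const_mx 1)) = 0).
Proof.
have Eval (I : 'I_(r + 1) -> 'I_p) (J : 'I_r -> 'I_q) (g h : nat -> nat)
    (rho := ext (ext (fun=> 0%N) 0 (r + 1) g) (r + 1) r h) :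
    (forall a : 'I_(r + 1), g a = I a :> nat) -> (forall b : 'I_r, h b = J b :> nat) ->
    \det (row_mx (mxsub I J (real_mx A)) (const_mx 1)) =
    ratr (peval e rho (det_poly (r + 1) r)).
  move=> Hg Hh; rewrite peval_det -det_map_mx; congr (\det _).
  apply/matrixP => a b; rewrite !mxE; case: splitP => k Ek; rewrite !mxE.
    rewrite Ek -eA -Hg -Hh /rho /ext leq_addr ltn_add2l ltn_ord /= addKn.
    by rewrite leqNgt ltn_ord /= subn0.
  by rewrite rmorph1.
rewrite /ones_form sat_iter; split=> [H I J|H g Hg].
  have := H (ord_fun I) (@ord_fun_lt _ _ I); rewrite sat_iter add0n.
  move=> /(_ (ord_fun J) (@ord_fun_lt _ _ J)); rewrite sat_zero.
  by rewrite (Eval _ _ _ _ (ord_funE I) (ord_funE J)) => /eqP ->; rewrite rmorph0.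
rewrite sat_iter add0n => h Hh; rewrite sat_zero.
pose I (a : 'I_(r + 1)) := Ordinal (Hg a (ltn_ord a)).
pose J (b : 'I_r) := Ordinal (Hh b (ltn_ord b)).
by have /esym/eqP := @Eval I J g h (fun=> erefl) (fun=> erefl); rewrite H fmorph_eq0.
Qed.

End Link.

(** * Transposed formulas and well-formedness *)

(** Lets a condition on the transpose be checked on the original matrix, without a program that
    transposes the input. *)
Fixpoint transpose_form (f : mxform) : mxform :=
  match f with
  | FPos P => FPos [seq (t.1, [seq (uv.2, uv.1) | uv <- t.2]) | t <- P]
  | FNot f => FNot (transpose_form f)
  | FAnd f g => FAnd (transpose_form f) (transpose_form g)
  | FAll b f => FAll (~~ b) (transpose_form f)
  end.

Lemma sat_transpose e p q rho d f :
  sat e p q rho d (transpose_form f) = sat (fun i j => e j i) q p rho d f.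
Proof.
elim: f rho d => [P|f IH|f IHf g IHg|b f IH] rho d /=.
- rewrite /peval big_map; congr (_ < _); apply: eq_bigr => t _ /=; congr (_ * _).
  by rewrite big_map.
- by rewrite IH.
- by rewrite IHf IHg.
- by case: b; apply: eq_all => k; rewrite IH.
Qed.

Lemma wf_transpose vt f : wf (map negb vt) (transpose_form f) = wf vt f.
Proof.
elim: f vt => [P|f IH|f IHf g IHg|b f IH] vt /=.
- rewrite all_map; apply: eq_all => t /=; rewrite all_map; apply: eq_all => -[u v] /=.
  rewrite /wf_pair /= size_map; case: ltnP => ltv; rewrite ?andbF //=.
  case: ltnP => ltu; rewrite ?andbF //= !(nth_map false) // negbK.
  by rewrite andbC.
- by rewrite IH.
- by rewrite IHf IHg.
- by rewrite -map_rcons IH.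
Qed.

Lemma wf_iter vt k b f : wf vt (iter k (FAll b) f) = wf (vt ++ nseq k b) f.
Proof.
elim: k vt => [|k IH] vt; first by rewrite cats0.
by rewrite iterS /= IH -cats1 -catA.
Qed.

Lemma wf_neg vt P : wf vt (FPos (neg_poly P)) = wf vt (FPos P).
Proof. by rewrite /= all_map. Qed.

Lemma wf_det n m k : (m <= k)%N -> wf (nseq n true ++ nseq k false) (FPos (det_poly n m)).
Proof.
move=> lemk; rewrite /= all_map; apply/allP => s _ /=.
rewrite all_map; apply/allP => i; rewrite mem_filter => /andP[lts _].
apply/and4P; split; rewrite /= ?size_cat ?nth_cat ?size_nseq ?ltn_ord.
- by rewrite ltn_addr ?ltn_ord.
- by rewrite nth_nseq ltn_ord.
- by rewrite ltn_add2l (leq_trans lts).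
- by rewrite ltnNge leq_addr /= nth_nseq if_same.
Qed.

Lemma wf_zero vt P : wf vt (FZero P) = wf vt (FPos P).
Proof. by rewrite /FZero -[LHS]/(wf vt (FPos P) && wf vt (FPos (neg_poly P))) wf_neg andbb. Qed.

Lemma wf_ones_form r : wf [::] (ones_form r).
Proof. by rewrite /ones_form !wf_iter cat0s wf_zero wf_det. Qed.

Lemma wf_entry vt u v : wf vt (FPos (entry_poly u v)) = wf_pair vt (u, v).
Proof. by rewrite /= !andbT. Qed.

Lemma wf_foldr vt (F : nat -> mxform) l :
  wf vt (foldr FAnd FTrue [seq F c | c <- l]) = all (fun c => wf vt (F c)) l.
Proof. by elim: l => //= c l ->. Qed.

Lemma wf_minor_form r : wf [::] (minor_form r).
Proof.
rewrite /minor_form !wf_iter cat0s /minor_body.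
set vt := _ ++ _.
have Evt : rcons vt false = nseq (r + 1) true ++ nseq (r + 1) false.
  by rewrite /vt rcons_cat -cats1 -[[:: false]]/(nseq 1 false) -nseqD.
have Hd : wf (rcons vt false) (FPos (minor_poly r)) by rewrite Evt wf_det.
have Hn : wf (rcons vt false) (FPos (neg_poly (minor_poly r))) by rewrite wf_neg.
have szvt : size vt = (r + 1 + r)%N by rewrite size_cat !size_nseq.
have H1 : wf (rcons vt true) (foldr FAnd FTrue
    [seq FZero (entry_poly (r + 1 + r) (r + 1 + c)) | c <- iota 0 r]).
  rewrite wf_foldr; apply/allP => c; rewrite mem_iota add0n => /andP[_ ltc].
  rewrite wf_zero wf_entry; apply/and4P; rewrite /= size_rcons !nth_rcons szvt; split.
  - exact: leqnn.
  - by rewrite ltnn eqxx.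
  - by rewrite ltnS ltnW // ltn_add2l.
  - by rewrite ltn_add2l ltc nth_cat size_nseq ltnNge leq_addr /= nth_nseq if_same.
have H2 : wf (rcons (rcons vt true) false)
    (FNot (FZero (entry_poly (r + 1 + r) (r + 1 + r).+1))).
  rewrite -[wf _ _]/(wf _ (FZero _)) wf_zero wf_entry; apply/and4P.
  rewrite /= !size_rcons !nth_rcons !size_rcons szvt; split.
  - by rewrite ltnS leqnSn.
  - by rewrite ltnS leqnn ltnn eqxx.
  - exact: leqnn.
  - by rewrite ltnn eqxx.
have H3 : wf (rcons vt false) (FNot (FZero (minor_poly r))).
  by rewrite -[wf _ _]/(wf _ (FZero _)) wf_zero.
apply/andP; split; last by apply/andP; split.
by apply/andP; split=> //; apply/andP; split.
Qed.

(** * The decision problems *)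

Lemma poly_time_decidable_ext (Dom P Q : forall p q, 'M[rat]_(p, q) -> Prop) :
  (forall p q (A : 'M[rat]_(p, q)), Dom p q A -> P p q A <-> Q p q A) ->
  poly_time_decidable Dom P -> poly_time_decidable Dom Q.
Proof.
move=> PQ [M [k H]]; exists M, k => p q A HA.
by have [c [Hr Hc]] := H p q A HA; exists c; rewrite -(PQ p q A HA).
Qed.

(** The empty machine halts at once in state 0; one step to state 1 accepts. Nothing is read, so
    empty matrices are covered too. *)
Lemma poly_time_decidable_bool (Dom : forall p q, 'M[rat]_(p, q) -> Prop) (b : bool) :
  poly_time_decidable Dom (fun _ _ _ => b).
Proof.
case: b; last first.
  exists [::], 0%N => p q A _; exists (init_config (encode_mx A)).
  by split; last by split=> //; case: (encode_mx A).
pose f (s c : nat) := if s is 0%N then Some (1%N, c, MStay) else None.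
exists (tm_of f 2 5), 1%N => p q A _; rewrite encode_mxE; set w := _ ++ _.
have -> : init_config (map code w) =
    Config 0 [::] (head 0%N (map code w)) (behead (map code w)) by case: w.
have ltc : (head 0%N (map code w) < 5)%N by case: w => //= -[[] []].
exists (Config 1 [::] (head 0%N (map code w)) (behead (map code w))); split=> //.
apply: (tsteps_run (n := 1%N)); last by rewrite mul1n expn1.
  by eexists; first by rewrite step_tm_of.
by rewrite step_tm_of.
Qed.

Lemma nonneg_real_mx p q (A : 'M[rat]_(p, q)) :
  (forall i j, 0 <= A i j) -> nonneg_mx (real_mx A).
Proof. by move=> HA i j; rewrite real_mxE ler0q. Qed.

Lemma RCGC_minorP p q r (S : 'M[R]_(p, q)) : nonneg_mx S -> \rank S = (r + 1)%N ->
  RCGC S <-> minor_cond r S.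
Proof.
move=> S0 rS; rewrite RCGC_coneP //; split=> H; first exact: minor_cond_of_cone.
by move=> x xS; apply: cone_of_minor_cond rS H _ xS.
Qed.

Lemma RCGC_rank0 p q (S : 'M[R]_(p, q)) : \rank S = 0%N -> RCGC S.
Proof.
move/eqP; rewrite mxrank_eq0 => /eqP ->; apply/RCGC_coneP => [i j|x _].
  by rewrite mxE.
by exists 0; rewrite ?mulmx0 // => i; rewrite mxE.
Qed.

Lemma real_mx_tr p q (A : 'M[rat]_(p, q)) : (real_mx A)^T = real_mx A^T.
Proof. by apply/matrixP => i j; rewrite !mxE. Qed.

Theorem theorem3p2 (r : nat) :
  poly_time_decidable (nonneg_rank r) (fun p q A => RCGC (real_mx A))
  /\ poly_time_decidable (nonneg_rank r) (fun p q A => CCGC (real_mx A))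
  /\ poly_time_decidable (has_rank r) (fun p q A => is_cone_slack (real_mx A))
  /\ poly_time_decidable (has_rank r) (fun p q A => is_polytope_slack (real_mx A)).
Proof.
(* Rank 0 is separate: it contains the empty matrices, and the minor criterion needs rank
   [r + 1]. *)
case: r => [|r].
  split; [|split; [|split]];
    [apply: poly_time_decidable_ext (poly_time_decidable_bool _ true)..
    |apply: poly_time_decidable_ext (poly_time_decidable_bool _ false)] => p q A.
  - by case=> _ /RCGC_rank0.
  - case=> _ rk; split=> // _; apply/CCGC_tr/RCGC_rank0.
    by rewrite mxrank_tr.
  - move=> rk; split=> // _; apply/cone_slackP; split; last exact: RCGC_rank0.
    by move/eqP: rk; rewrite mxrank_eq0 => /eqP -> i j; rewrite mxE.
  - by move=> rk; split=> // /polytope_slackP[_ _]; rewrite rk.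
have pos p q (A : 'M[rat]_(p, q)) : \rank (real_mx A) = r.+1 -> (0 < p)%N /\ (0 < q)%N.
  move=> rk; have := rank_leq_row (real_mx A); have := rank_leq_col (real_mx A).
  by rewrite rk => q0 p0; split; [apply: leq_trans p0|apply: leq_trans q0].
have entA p q (A : 'M[rat]_(p, q)) := @entry_at_entries p q A.
have HR p q (A : 'M[rat]_(p, q)) : nonneg_mx (real_mx A) -> \rank (real_mx A) = r.+1 ->
    sat (entry_at (entries A) q) p q (fun=> 0%N) 0 (minor_form r) <-> RCGC (real_mx A).
  move=> A0; rewrite -addn1 => rk.
  by rewrite (RCGC_minorP A0 rk) (minor_formP _ (entA p q A)).
have pos' p q (A : 'M[rat]_(p, q)) : nonneg_rank r.+1 A -> (0 < p)%N /\ (0 < q)%N.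
  by case=> _; apply: pos.
have HC p q (A : 'M[rat]_(p, q)) : \rank (real_mx A) = r.+1 ->
    sat (entry_at (entries A) q) p q (fun=> 0%N) 0 (FAnd nonneg_form (minor_form r)) <->
    nonneg_mx (real_mx A) /\ RCGC (real_mx A).
  move=> rk; rewrite sat_and; split=> [/andP[/(nonneg_formP (entA p q A)) A0 /(HR _ _ _ A0 rk)//]|].
  case=> A0 /(HR _ _ _ A0 rk) ->; rewrite andbT; exact/(nonneg_formP (entA p q A)).
split; [|split; [|split]].
- apply: poly_time_decidable_ext (form_decidable pos' (wf_minor_form r)) => p q A [A0 rk].
  exact/HR/rk/nonneg_real_mx.
- have wfT : wf [::] (transpose_form (minor_form r)).
    by rewrite -[[::]]/(map negb [::]) wf_transpose wf_minor_form.
  apply: poly_time_decidable_ext (form_decidable pos' wfT) => p q A [A0 rk].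
  rewrite sat_transpose CCGC_tr real_mx_tr RCGC_minorP; last 2 first.
  + by apply: nonneg_real_mx => i j; rewrite mxE.
  + by rewrite -real_mx_tr mxrank_tr rk addn1.
  by apply: minor_formP => i j; rewrite entA mxE.
- have wfC : wf [::] (FAnd nonneg_form (minor_form r)) by apply/andP; split=> //; apply: wf_minor_form.
  apply: poly_time_decidable_ext (form_decidable pos wfC) => p q A rk.
  by rewrite HC // cone_slackP.
(* Rank one: slack matrices of polytopes of positive dimension have rank at least two, so the answer
   is constant. *)
case: r => [|r] in pos pos' HR HC *.
  apply: poly_time_decidable_ext (poly_time_decidable_bool _ false) => p q A rk.
  by split=> // /polytope_slackP[_ _]; rewrite rk.
have wfP : wf [::] (FAnd (FAnd nonneg_form (minor_form r.+1)) (ones_form r.+2)).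
  rewrite -[wf _ _]/(wf [::] nonneg_form && wf [::] (minor_form r.+1) && wf [::] (ones_form r.+2)).
  by rewrite wf_minor_form wf_ones_form.
apply: poly_time_decidable_ext (form_decidable pos wfP) => p q A rk.
rewrite sat_and polytope_slackP; split.
  move=> /andP[/(HC _ _ _ rk)[A0 HRA] /(ones_formP _ (entA p q A)) H1].
  by split; rewrite ?rk //; apply/(ones_minorP rk).
case=> A0 HRA _ /(ones_minorP rk) H1; apply/andP; split; first exact/HC.
exact/(ones_formP _ (entA p q A)).
Qed.
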